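(* Let $f:\mathbb{B}\to\mathbb{B}$ be a regular function, let $q_0=x_0+Iy_0\in\mathbb{B}$ (with $x_0,y_0\in\mathbb{R}$, $I^2=-1$) and let $n\ge1$ be an integer. For $k\ge 0$ set $A_{2k}=(R_{\bar q_0}R_{q_0})^kf(q_0)$ and $A_{2k+1}=R_{q_0}(R_{\bar q_0}R_{q_0})^kf(\bar q_0)$. If $A_m=0$ for $1\le m\le 2n-1$, then for all $q\in\mathbb{B}$ $$|(f(q)-f(q_0))*(1-\overline{f(q_0)}*f(q))^{-*}|\le|\mathcal{M}_{q_0}^s(q)|^n,$$ $$|(R_{\bar q_0}R_{q_0})^nf(q)*(1-\overline{f(q_0)}*f(q))^{-*}|\le|(1-qx_0)^2+(qy_0)^2|^{-n}.$$ If $A_{2n}=0$ as well, then for all $q\in\mathbb{B}$ $$|(f(q)-f(q_0))*(1-\overline{f(q_0)}*f(q))^{-*}|\le|\mathcal{M}_{q_0}^s(q)|^n\,|\mathcal{M}_{q_0}(q)|,$$ $$|R_{q_0}(R_{\bar q_0}R_{q_0})^nf(q)*(1-\overline{f(q_0)}*f(q))^{-*}|\le|(1-qx_0)^2+(qy_0)^2|^{-n}\cdot|(1-q\bar q_0)^{-*}|.$$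
   Context: $\mathbb{H}$ denotes the quaternions, $\mathbb{B}=\{q\in\mathbb{H}: |q|<1\}$, $\mathbb{S}=\{q\in\mathbb{H}: q^2=-1\}$, $L_I=\mathbb{R}+I\mathbb{R}$ for $I\in\mathbb{S}$. A function $f:\Omega\to\mathbb{H}$ on a domain $\Omega\subseteq\mathbb{H}$ is (slice) regular if for every $I\in\mathbb{S}$ its restriction to $\Omega\cap L_I$ is real differentiable and $\frac12\left(\frac{\partial}{\partial x}+I\frac{\partial}{\partial y}\right)f(x+Iy)=0$ there. On a ball $B(0,R)=\{|q|<R\}$ the regular functions are exactly the convergent power series $f(q)=\sum_n q^na_n$, $a_n\in\mathbb{H}$. Regular product: for $f(q)=\sum q^na_n$, $g(q)=\sum q^nb_n$, $f*g(q)=f(q)*g(q)=\sum_n q^n\sum_{k=0}^n a_kb_{n-k}$ (the letter $q$ always denotes the variable and other quaternions are treated as constant functions). Regular conjugate: $f^c(q)=\sum q^n\bar a_n$; symmetrization: $f^s=f*f^c=f^c*f$. For $f\not\equiv0$ the regular reciprocal is $f^{-*}(q)=f^s(q)^{-1}f^c(q)$, and $f^{-*}*g(q)=f^s(q)^{-1}(f^c*g)(q)$, $g*f^{-*}(q)=f^s(q)^{-1}(g*f^c)(q)$, wherever $f^s\ne0$. Symmetrization extends to quotients by $(f^{-*}*g)^s(q)=f^s(q)^{-1}g^s(q)$. The functions $1-q\bar q_0$ and $1-\overline{f(q_0)}*f(q)$ have reciprocals defined and regular on all of $\mathbb{B}$. $\mathcal{M}_{q_0}(q)=(1-q\bar q_0)^{-*}*(q-q_0)=(q-q_0)*(1-q\bar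 q_0)^{-*}$, so that $\mathcal{M}_{q_0}^s(q)=[(1-qx_0)^2+(qy_0)^2]^{-1}[(q-x_0)^2+y_0^2]$. Differential quotient: for $p\in\mathbb{B}$ and $g$ regular on $\mathbb{B}$, $R_{p}g(q)=(q-p)^{-*}*(g(q)-g(p))$, i.e. $R_pg$ is the unique regular function on $\mathbb{B}$ with $g(q)-g(p)=(q-p)*R_pg(q)$. Juxtaposition $R_{\bar q_0}R_{q_0}$ denotes composition of operators (first $R_{q_0}$, then $R_{\bar q_0}$), and $(R_{\bar q_0}R_{q_0})^k$ its $k$th iterate. The $A_m$ are the coefficients of the expansion $f(q)=\sum_{k\ge 0}[(q-x_0)^2+y_0^2]^k[A_{2k}+(q-q_0)A_{2k+1}]$, valid on every set $\{q:|(q-x_0)^2+y_0^2|<r^2\}$ contained in $\mathbb{B}$. *)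

(* Defs.v *)
From HB Require Import structures.
From mathcomp Require Import all_boot all_order all_algebra.
From mathcomp Require Import ring lra.
From mathcomp Require Import all_classical all_reals all_analysis.

Set Implicit Arguments.
Unset Strict Implicit.
Unset Printing Implicit Defensive.

Import Order.TTheory GRing.Theory Num.Theory.
Import numFieldNormedType.Exports.

Local Open Scope classical_set_scope.
Local Open Scope ring_scope.

(* [Quat a b c d] is a + b i + c j + d k. *)
Record quat (R : Type) := Quat { q_re : R; q_i : R; q_j : R; q_k : R }.

Section QuatInstances.
Variable R : realType.
Local Notation H := (quat R).
Implicit Types p q : H.

Definition quat_tuple q := (q_re q, q_i q, q_j q, q_k q).
Definition tuple_quat (t : R * R * R * R) :=
  Quat t.1.1.1 t.1.1.2 t.1.2 t.2.
Fact quat_tupleK : cancel quat_tuple tuple_quat. Proof. by case. Qed.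

HB.instance Definition _ := Equality.copy H (can_type quat_tupleK).
HB.instance Definition _ := Choice.copy H (can_type quat_tupleK).

Fact quat_eqP p q : q_re p = q_re q -> q_i p = q_i q -> q_j p = q_j q ->
  q_k p = q_k q -> p = q.
Proof. by case: p => ? ? ? ?; case: q => ? ? ? ? /= -> -> -> ->. Qed.

Definition quat0 : H := Quat 0 0 0 0.
Definition quat1 : H := Quat 1 0 0 0.
Definition quat_opp q := Quat (- q_re q) (- q_i q) (- q_j q) (- q_k q).
Definition quat_add p q :=
  Quat (q_re p + q_re q) (q_i p + q_i q) (q_j p + q_j q) (q_k p + q_k q).
Definition quat_mul p q :=
  Quat (q_re p * q_re q - q_i p * q_i q - q_j p * q_j q - q_k p * q_k q)
       (q_re p * q_i q + q_i p * q_re q + q_j p * q_k q - q_k p * q_j q)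
       (q_re p * q_j q - q_i p * q_k q + q_j p * q_re q + q_k p * q_i q)
       (q_re p * q_k q + q_i p * q_j q - q_j p * q_i q + q_k p * q_re q).
Definition quat_scale (a : R) q :=
  Quat (a * q_re q) (a * q_i q) (a * q_j q) (a * q_k q).

Fact quat_addA : associative quat_add.
Proof. by move=> p q r; apply: quat_eqP => /=; ring. Qed.
Fact quat_addC : commutative quat_add.
Proof. by move=> p q; apply: quat_eqP => /=; ring. Qed.
Fact quat_add0 : left_id quat0 quat_add.
Proof. by move=> p; apply: quat_eqP => /=; ring. Qed.
Fact quat_addN : left_inverse quat0 quat_opp quat_add.
Proof. by move=> p; apply: quat_eqP => /=; ring. Qed.
HB.instance Definition _ :=
  GRing.isZmodule.Build H quat_addA quat_addC quat_add0 quat_addN.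

Fact quat_mulA : associative quat_mul.
Proof. by move=> p q r; apply: quat_eqP => /=; ring. Qed.
Fact quat_mul1l : left_id quat1 quat_mul.
Proof. by move=> p; apply: quat_eqP => /=; ring. Qed.
Fact quat_mul1r : right_id quat1 quat_mul.
Proof. by move=> p; apply: quat_eqP => /=; ring. Qed.
Fact quat_mulDl : left_distributive quat_mul +%R.
Proof. by move=> p q r; apply: quat_eqP => /=; ring. Qed.
Fact quat_mulDr : right_distributive quat_mul +%R.
Proof. by move=> p q r; apply: quat_eqP => /=; ring. Qed.
Fact quat_1neq0 : quat1 != 0.
Proof. by apply/eqP => -[/eqP]; rewrite oner_eq0. Qed.
HB.instance Definition _ := GRing.Zmodule_isNzRing.Build H
  quat_mulA quat_mul1l quat_mul1r quat_mulDl quat_mulDr quat_1neq0.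

Fact quat_scaleA a b q : quat_scale a (quat_scale b q) = quat_scale (a * b) q.
Proof. by apply: quat_eqP => /=; ring. Qed.
Fact quat_scale1 : left_id 1 quat_scale.
Proof. by move=> q; apply: quat_eqP => /=; ring. Qed.
Fact quat_scaleDr : right_distributive quat_scale +%R.
Proof. by move=> a p q; apply: quat_eqP => /=; ring. Qed.
Fact quat_scaleDl q : {morph quat_scale^~ q : a b / a + b}.
Proof. by move=> a b; apply: quat_eqP => /=; ring. Qed.
HB.instance Definition _ := GRing.Zmodule_isLmodule.Build R H
  quat_scaleA quat_scale1 quat_scaleDr quat_scaleDl.

Fact quat_scaleAl (a : R) p q : a *: (p * q) = (a *: p) * q.
Proof. by apply: quat_eqP => /=; ring. Qed.
HB.instance Definition _ := GRing.Lmodule_isLalgebra.Build R H quat_scaleAl.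
Fact quat_scaleAr (a : R) p q : a *: (p * q) = p * (a *: q).
Proof. by apply: quat_eqP => /=; ring. Qed.
HB.instance Definition _ := GRing.Lalgebra_isAlgebra.Build R H quat_scaleAr.

Definition qconj q := Quat (q_re q) (- q_i q) (- q_j q) (- q_k q).

Definition quat_sqn q := q_re q ^+ 2 + q_i q ^+ 2 + q_j q ^+ 2 + q_k q ^+ 2.

Definition quat_norm q : R := Num.sqrt (quat_sqn q).

Definition quat_inv q := (quat_sqn q)^-1 *: qconj q.

Fact quat_sqn_ge0 q : 0 <= quat_sqn q.
Proof. by rewrite /quat_sqn !addr_ge0 ?sqr_ge0. Qed.

Fact quat_sqn_eq0 q : quat_sqn q = 0 -> q = 0.
Proof.
move/eqP; rewrite /quat_sqn !paddr_eq0 ?addr_ge0 ?sqr_ge0// !sqrf_eq0.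
by case/andP => /andP[/andP[/eqP ? /eqP ?] /eqP ?] /eqP ?; apply: quat_eqP.
Qed.

Fact quat_mulVr : {in [pred q | q != 0], left_inverse 1 quat_inv *%R}.
Proof.
move=> q; rewrite inE => q0.
have : quat_sqn q != 0 by apply: contra q0 => /eqP/quat_sqn_eq0 ->.
by rewrite /quat_inv /quat_sqn => ?; apply: quat_eqP => /=; field.
Qed.

Fact quat_mulrV : {in [pred q | q != 0], right_inverse 1 quat_inv *%R}.
Proof.
move=> q; rewrite inE => q0.
have : quat_sqn q != 0 by apply: contra q0 => /eqP/quat_sqn_eq0 ->.
by rewrite /quat_inv /quat_sqn => ?; apply: quat_eqP => /=; field.
Qed.

Fact quat_unitP p q : q * p = 1 /\ p * q = 1 -> [pred q | q != 0] p.
Proof.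
by case=> qp _ /=; apply/eqP => p0; move: qp; rewrite p0 mulr0 => /esym/eqP;
  rewrite oner_eq0.
Qed.

Fact quat_inv_out : {in [predC [pred q | q != 0]], quat_inv =1 id}.
Proof.
move=> q; rewrite !inE negbK => /eqP ->.
by apply: quat_eqP => /=; rewrite ?oppr0 mulr0.
Qed.

HB.instance Definition _ := GRing.NzRing_hasMulInverse.Build H
  quat_mulVr quat_mulrV quat_unitP quat_inv_out.

Fact quat_normD p q : quat_norm (p + q) <= quat_norm p + quat_norm q.
Proof.
have s0 := quat_sqn_ge0; rewrite /quat_norm.
rewrite -(@ler_pXn2r _ 2) ?nnegrE ?addr_ge0 ?sqrtr_ge0// sqr_sqrtr ?s0//.
rewrite sqrrD !sqr_sqrtr ?s0//.
pose d := q_re p * q_re q + q_i p * q_i q + q_j p * q_j q + q_k p * q_k q.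
have -> : quat_sqn (p + q) = quat_sqn p + d *+ 2 + quat_sqn q.
  by rewrite /quat_sqn /d /=; ring.
rewrite lerD2r lerD2l lerMn2r /= -sqrtrM ?s0//.
have [d0|d0] := lerP d 0; first by rewrite (le_trans d0)// sqrtr_ge0.
rewrite -(ger0_norm (ltW d0)) -sqrtr_sqr ler_wsqrtr// -subr_ge0.
have -> : quat_sqn p * quat_sqn q - d ^+ 2 =
  q_i (qconj p * q) ^+ 2 + q_j (qconj p * q) ^+ 2 + q_k (qconj p * q) ^+ 2.
  by rewrite /quat_sqn /d /=; ring.
by rewrite !addr_ge0 ?sqr_ge0.
Qed.

Fact quat_normZ (a : R) q : quat_norm (a *: q) = `|a| * quat_norm q.
Proof.
rewrite /quat_norm -sqrtr_sqr -sqrtrM ?sqr_ge0//; congr Num.sqrt.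
by rewrite /quat_sqn /=; ring.
Qed.

Fact quat_norm_eq0 q : quat_norm q = 0 -> q = 0.
Proof.
move/eqP; rewrite sqrtr_eq0 => h; apply: quat_sqn_eq0.
by apply/eqP; rewrite eq_le h quat_sqn_ge0.
Qed.

HB.instance Definition _ := Lmodule_isNormed.Build R H
  quat_normD quat_normZ quat_norm_eq0.

End QuatInstances.

Section SliceRegular.
Variable R : realType.
Local Notation H := (quat R).
Implicit Types (f g : H -> H) (p q : H) (a : nat -> H).

Definition qball : set H := [set q | `|q| < 1].

Definition slice_pt (I : H) (z : R * R) : H := z.1%:A + z.2 *: I.

(* [Omega] is meant to be open, so that the values of [f] outside of it are
   irrelevant. *)
Definition slice_regular (Omega : set H) f := forall I : H, I ^+ 2 = -1 ->
  forall z : R * R, Omega (slice_pt I z) ->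
    let fI := f \o slice_pt I in
    differentiable fI z /\
    2^-1 *: ('D_((1, 0) : R * R) fI z + I * 'D_((0, 1) : R * R) fI z) = 0.

(* Power series have their coefficients on the right. *)
Definition qseries a q : H ^nat := [series q ^+ n * a n]_n.

Definition qsum a q : H := limn (qseries a q).

(* The coefficients of the expansion of [f] on the unit ball (0 if there is no
   such expansion); the operations below are those of functions regular on the
   unit ball, and see their arguments only through their values there. *)
Definition coefs f : nat -> H :=
  xget (fun=> 0) [set a | forall q, qball q -> qseries a q @ \oo --> f q].

Definition rmul f g : H -> H :=
  qsum (fun n => \sum_(k < n.+1) coefs f k * coefs g (n - k)%N).

Definition rconj f : H -> H := qsum (fun n => qconj (coefs f n)).

Definition rsym f : H -> H := rmul f (rconj f).

Definition rrecip f : H -> H := fun q => (rsym f q)^-1 * rconj f q.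

Definition moebius q0 : H -> H :=
  rmul (rrecip (fun q => 1 - q * qconj q0)) (fun q => q - q0).

(* The pointwise formula for (q - p)^{-*} * (g(q) - g(p)) breaks down on the
   sphere through [p], where values are needed as well; hence the
   characterization as a regular function on the whole ball, which determines
   it there. *)
Definition dquot p g : H -> H :=
  xget (fun=> 0) [set h | slice_regular qball h /\
    forall q, qball q -> g q - g p = rmul (fun q => q - p) h q].

(* (R_{conj q0} R_{q0})^k f *)
Definition dquot_iter q0 k f : H -> H :=
  iter k (fun g => dquot (qconj q0) (dquot q0 g)) f.

Definition sph_coef q0 f m : H :=
  if odd m then dquot q0 (dquot_iter q0 m./2 f) (qconj q0)
  else dquot_iter q0 m./2 f q0.

End SliceRegular.

Arguments qball {R}.

(* Main.v *)
(* A slice regular [f] on the unit ball has a power series expansion: on a slice,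
   Goursat's bisection argument applied to the homotopy
   [z + t * (rho * exp (I * v) - z)] gives Cauchy's formula on circles without
   assuming any continuity of the derivative, and the coefficients do not depend
   on the slice because all slices share the real axis. The regular product
   becomes the product of power series, and
   [(a * b)(q) = a(q) * b(a(q)^-1 * q * a(q))] wherever [a(q) != 0].

   Put [w = f q0], [Delta = (q - x0)^2 + y0^2], [D = (1 - q x0)^2 + (q y0)^2], and
   let [F = (f - w) * (1 - conj w * f)^-*], which is bounded by 1 because it is
   a pointwise quotient of Moebius type after a change of argument. If
   [A_1 = ... = A_(2n-1) = 0] then [f - w = Delta^n * g] with [g] the n-th iterated
   quotient of [f], so [F = Delta^n * W] with [W = g * (1 - conj w * f)^-*].
   Put [X = D^n * W]: as [|F| <= 1] and [|Delta / D|] tends to 1 at the boundary,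
   [|X| <= 1] by the maximum modulus principle, and both estimates follow, because
   [Delta] and [D] have real coefficients and multiply pointwise. If moreover
   [A_2n = 0], the same argument applies with one further factor [M_q0]. *)

Require Import Defs.
From HB Require Import structures.
From mathcomp Require Import all_boot all_order all_algebra.
From mathcomp Require Import ring lra zify.
From mathcomp Require Import all_classical all_reals all_analysis.
Set Implicit Arguments.
Unset Strict Implicit.
Unset Printing Implicit Defensive.
Import Order.TTheory GRing.Theory Num.Theory.
Import numFieldNormedType.Exports.
Local Open Scope classical_set_scope.
Local Open Scope ring_scope.

(** Two features of quaternionic series shape the argument. Evaluation is not multiplicative: it is
    so when the value of the left factor commutes with the point, and otherwise only after the
    argument of the right factor is replaced by a conjugate. Conjugation preserves the modulus, so
    bounds valid on whole balls or spheres pass to products even though values do not. And since the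
    operations of the statement see their arguments through coefficients, the algebra is done in the
    ring [ps] of coefficient sequences, with convolution as product; functions come back only
    through [expands] and [qsum]. Inverses in [ps] are geometric series ([neumann]), and they also
    keep denominators away from zero: the symmetrization of an invertible series is invertible, and
    it is evaluated pointwise. The maximum principle avoids any open mapping argument: Cauchy's
    estimate, applied to all powers of a series, loses a constant that an N-th root removes. *)

(** * Norm, conjugation and slices of the quaternions *)

Section QuatBasics.
Variable R : realType.
Local Notation H := (quat R).
Implicit Types p q : H.

Lemma quat_normE q : `|q| = Num.sqrt (quat_sqn q).
Proof. by []. Qed.

Lemma sqr_quat_norm q : `|q| ^+ 2 = quat_sqn q.
Proof. by rewrite quat_normE sqr_sqrtr ?quat_sqn_ge0. Qed.

Lemma quat_normM p q : `|p * q| = `|p| * `|q|.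
Proof.
rewrite !quat_normE -sqrtrM ?quat_sqn_ge0//; congr Num.sqrt.
by rewrite /quat_sqn /=; ring.
Qed.

Lemma quat_norm1 : `|1 : H| = 1.
Proof. by rewrite quat_normE /quat_sqn /= !expr0n expr1n !addr0 sqrtr1. Qed.

Lemma quat_normX q n : `|q ^+ n| = `|q| ^+ n.
Proof. by elim: n => [|n IH]; rewrite ?quat_norm1// !exprS quat_normM IH. Qed.

Lemma quat_normA (a : R) : `|a%:A : H| = `|a|.
Proof. by rewrite normrZ quat_norm1 mulr1. Qed.

Lemma qconjK q : qconj (qconj q) = q.
Proof. by apply: quat_eqP => /=; ring. Qed.

Lemma qconjD p q : qconj (p + q) = qconj p + qconj q.
Proof. by apply: quat_eqP => /=; ring. Qed.

Lemma qconjN p : qconj (- p) = - qconj p.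
Proof. by apply: quat_eqP => /=; ring. Qed.

Lemma qconj0 : qconj 0 = 0 :> H.
Proof. by apply: quat_eqP => /=; ring. Qed.

Lemma qconj1 : qconj 1 = 1 :> H.
Proof. by apply: quat_eqP => /=; ring. Qed.

Lemma qconjM p q : qconj (p * q) = qconj q * qconj p.
Proof. by apply: quat_eqP => /=; ring. Qed.

Lemma quat_norm_conj q : `|qconj q| = `|q|.
Proof. by rewrite !quat_normE; congr Num.sqrt; rewrite /quat_sqn /=; ring. Qed.

Lemma qconj_sum (I : Type) (r : seq I) (P : pred I) (F : I -> H) :
  qconj (\sum_(i <- r | P i) F i) = \sum_(i <- r | P i) qconj (F i).
Proof. by apply: (big_morph (@qconj R) qconjD qconj0). Qed.

Lemma mulq_conj q : q * qconj q = (`|q| ^+ 2)%:A.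
Proof. by rewrite sqr_quat_norm; apply: quat_eqP; rewrite /quat_sqn /=; ring. Qed.

Lemma mul_conjq q : qconj q * q = (`|q| ^+ 2)%:A.
Proof. by rewrite sqr_quat_norm; apply: quat_eqP; rewrite /quat_sqn /=; ring. Qed.

Lemma quat_unitE q : (q \is a GRing.unit) = (q != 0).
Proof. by []. Qed.

Lemma quat_normV q : `|q^-1| = `|q|^-1.
Proof.
have [->|q0] := eqVneq q 0.
  by rewrite invr_out ?quat_unitE ?eqxx// normr0 invr0.
apply: (mulfI (x := `|q|)); first by rewrite normr_eq0.
by rewrite -quat_normM mulrV ?quat_unitE// quat_norm1 divff// normr_eq0.
Qed.

Lemma scale_commq (a : R) q : a%:A * q = q * a%:A.
Proof. by rewrite mulr_algl mulr_algr. Qed.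

Lemma abs_q_re q : `|q_re q| <= `|q|.
Proof.
rewrite quat_normE -sqrtr_sqr ler_wsqrtr// /quat_sqn.
by rewrite -!addrA lerDl !addr_ge0 ?sqr_ge0.
Qed.

Lemma abs_q_i q : `|q_i q| <= `|q|.
Proof.
rewrite quat_normE -sqrtr_sqr ler_wsqrtr// /quat_sqn.
by rewrite (addrC (q_re q ^+ 2)) -!addrA lerDl !addr_ge0 ?sqr_ge0.
Qed.

Lemma abs_q_j q : `|q_j q| <= `|q|.
Proof.
rewrite quat_normE -sqrtr_sqr ler_wsqrtr// /quat_sqn.
by rewrite -addrA (addrC (_ + q_i q ^+ 2)) -!addrA lerDl !addr_ge0 ?sqr_ge0.
Qed.

Lemma abs_q_k q : `|q_k q| <= `|q|.
Proof.
rewrite quat_normE -sqrtr_sqr ler_wsqrtr// /quat_sqn.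
by rewrite lerDr !addr_ge0 ?sqr_ge0.
Qed.

Lemma quat_norm_le q :
  `|q| <= `|q_re q| + `|q_i q| + `|q_j q| + `|q_k q|.
Proof.
rewrite -(@ler_pXn2r _ 2) ?nnegrE ?addr_ge0// sqr_quat_norm /quat_sqn.
rewrite -(real_normK (num_real (q_re q))) -(real_normK (num_real (q_i q))).
rewrite -(real_normK (num_real (q_j q))) -(real_normK (num_real (q_k q))).
have := normr_ge0 (q_re q); have := normr_ge0 (q_i q).
have := normr_ge0 (q_j q); have := normr_ge0 (q_k q).
by nra.
Qed.

Lemma imag_unitP (I : H) : I ^+ 2 = -1 ->
  q_re I = 0 /\ q_i I ^+ 2 + q_j I ^+ 2 + q_k I ^+ 2 = 1.
Proof.
rewrite expr2; case: I => a b c d [] /= h0 h1 h2 h3.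
have a0 : a = 0.
  (* If [a] were nonzero, the vector part of [I ^+ 2], which is [2 * a] times that of [I], would
     force [b = c = d = 0] and leave [a ^+ 2 = -1] in [R]. *)
  apply/eqP/negPn/negP => a0.
  have e0 t : a * t + t * a = 0 -> t = 0.
    move=> h; have : a * t = 0 by lra.
    by move/eqP; rewrite mulf_eq0 (negPf a0) => /eqP.
  have b0 : b = 0 by apply: e0; lra.
  have c0 : c = 0 by apply: e0; lra.
  have d0 : d = 0 by apply: e0; lra.
  by subst; nra.
by subst; split=> //; nra.
Qed.

Lemma imag_unit_conj (I : H) : I ^+ 2 = -1 -> qconj I = - I.
Proof.
by move=> /imag_unitP[h _]; apply: quat_eqP => //=; rewrite h oppr0.
Qed.

Lemma imag_unit_norm (I : H) : I ^+ 2 = -1 -> `|I| = 1.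
Proof.
by move=> /imag_unitP[h0 h1]; rewrite quat_normE /quat_sqn h0 expr0n add0r h1 sqrtr1.
Qed.

Lemma sqr_norm_slice (I : H) z : I ^+ 2 = -1 ->
  `|slice_pt I z| ^+ 2 = z.1 ^+ 2 + z.2 ^+ 2.
Proof.
move=> /imag_unitP[h0 h1]; rewrite sqr_quat_norm /quat_sqn /slice_pt /=.
rewrite h0 !mulr0 addr0 mulr1 !add0r !exprMn -!addrA -!mulrDr !addrA h1.
by rewrite mulr1.
Qed.

Lemma slice_exists q : exists I, I ^+ 2 = -1 /\ exists z, q = slice_pt I z.
Proof.
case: q => a b c d.
have s0 : 0 <= b ^+ 2 + c ^+ 2 + d ^+ 2 by rewrite !addr_ge0 ?sqr_ge0.
have [s|s] := eqVneq (b ^+ 2 + c ^+ 2 + d ^+ 2) 0.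
  exists (Quat 0 1 0 0); split; first by rewrite expr2; apply: quat_eqP => /=; ring.
  move/eqP: s; rewrite !paddr_eq0 ?addr_ge0 ?sqr_ge0// !sqrf_eq0.
  move=> /andP[/andP[/eqP-> /eqP->] /eqP->].
  by exists (a, 0); apply: quat_eqP => /=; ring.
pose t := Num.sqrt (b ^+ 2 + c ^+ 2 + d ^+ 2).
have t0 : t != 0 by rewrite sqrtr_eq0 -ltNge lt_neqAle eq_sym s.
have t2 : t ^+ 2 = b ^+ 2 + c ^+ 2 + d ^+ 2 by rewrite sqr_sqrtr.
exists (Quat 0 (b / t) (c / t) (d / t)); split; last first.
  by exists (a, t); apply: quat_eqP => /=; field.
rewrite expr2; apply: quat_eqP => /=; last 3 first.
- by field.
- by field.
- by field.
apply: (mulIf (x := t ^+ 2)); first by rewrite expf_neq0.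
transitivity (- (b ^+ 2 + c ^+ 2 + d ^+ 2)); first by field.
by rewrite -t2 mulN1r.
Qed.

Lemma slice_comm (I : H) z w : GRing.comm (slice_pt I z) (slice_pt I w).
Proof.
by rewrite /GRing.comm /slice_pt; apply: quat_eqP => /=; ring.
Qed.

End QuatBasics.

(** * Geometric bounds for real sequences *)

Section GeometricBounds.
Variable R : realType.
Implicit Types x C M : R.

Lemma sum_expr_le x m (n : nat) : 0 <= x < 1 ->
  \sum_(m <= k < n) x ^+ k <= x ^+ m / (1 - x).
Proof.
move=> /andP[x0 x1]; have x1' : 0 < 1 - x by rewrite subr_gt0.
have [mn|nm] := leqP m n; last first.
  by rewrite big_geq ?(ltnW nm)// divr_ge0 ?exprn_ge0// ltW.
rewrite ler_pdivlMr// mulr_suml (eq_bigr (fun k => - (x ^+ k.+1 - x ^+ k))).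
  by rewrite sumrN telescope_sumr// opprB lerBlDr lerDl exprn_ge0.
by move=> k _; rewrite exprS; ring.
Qed.

(** The linear factor is absorbed by a larger ratio [y], the midpoint of [x] and [1]: [N] times
    [(x / y) ^+ N] is at most the sum of the first [N] powers of [x / y], as these decrease.
    Convolutions of geometrically bounded sequences produce such factors. *)
Lemma muln_expr_le x : 0 <= x < 1 ->
  exists C y, [/\ 0 <= C, 0 <= y < 1 & forall N : nat, N%:R * x ^+ N <= C * y ^+ N].
Proof.
move=> /andP[x0 x1]; pose y := (1 + x) / 2.
have y0 : 0 < y by rewrite /y; lra.
have y1 : y < 1 by rewrite /y; lra.
have xy : x < y by rewrite /y; lra.
have r01 : 0 <= x / y < 1 by rewrite divr_ge0 ?(ltW y0)//= ltr_pdivrMr// mul1r.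
exists (1 - x / y)^-1, y; split.
- by case/andP: r01 => _ r1; rewrite invr_ge0 subr_ge0 ltW.
- by rewrite (ltW y0).
move=> N; rewrite -ler_pdivrMr ?exprn_gt0// -mulrA -expr_div_n.
apply: le_trans (_ : \sum_(0 <= k < N) (x / y) ^+ k <= _); last first.
  by rewrite (le_trans (sum_expr_le 0 N r01))// expr0 mul1r.
rewrite -[X in X%:R]subn0 mulr_natl -sumr_const_nat.
rewrite big_nat [leRHS]big_nat; apply: ler_sum => k /andP[_ kN].
by case/andP: r01 => r0 r1; rewrite ler_wiXn2l ?(ltW r1) ?(ltnW kN).
Qed.

Lemma le_expr_eq0 (c C x : R) : 0 <= x < 1 ->
  (forall N : nat, c <= C * x ^+ N) -> c <= 0.
Proof.
move=> /andP[x0 x1] h.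
have : C * x ^+ n @[n --> \oo] --> C * 0.
  by apply: cvgMl_tmp; apply: cvg_expr; rewrite ger0_norm.
by rewrite mulr0 => /cvgr_to_ge; apply; near=> n.
Unshelve. all: by end_near. Qed.

End GeometricBounds.

(** * Convergence of quaternionic series *)

Section QuatSeries.
Variable R : realType.
Local Notation H := (quat R).
Implicit Types (p q l : H) (u : nat -> H) (M x : R).

Lemma quat_cvg u l : (q_re (u n) @[n --> \oo] --> q_re l) ->
  (q_i (u n) @[n --> \oo] --> q_i l) -> (q_j (u n) @[n --> \oo] --> q_j l) ->
  (q_k (u n) @[n --> \oo] --> q_k l) -> u @ \oo --> l.
Proof.
move=> /cvgrPdist_lt h0 /cvgrPdist_lt h1 /cvgrPdist_lt h2 /cvgrPdist_lt h3.
apply/cvgrPdist_lt => e e0.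
have e4 : 0 < e / 4 by rewrite divr_gt0.
near=> n; apply: le_lt_trans (quat_norm_le _) _ => /=.
rewrite [ltRHS](_ : e = e / 4 + e / 4 + e / 4 + e / 4); last by field.
by rewrite !ltrD//; near: n; [apply: h0|apply: h1|apply: h2|apply: h3].
Unshelve. all: by end_near. Qed.

Lemma q_re_sum (I : Type) (r : seq I) (P : pred I) (F : I -> H) :
  q_re (\sum_(i <- r | P i) F i) = \sum_(i <- r | P i) q_re (F i).
Proof. exact: big_morph. Qed.
Lemma q_i_sum (I : Type) (r : seq I) (P : pred I) (F : I -> H) :
  q_i (\sum_(i <- r | P i) F i) = \sum_(i <- r | P i) q_i (F i).
Proof. exact: big_morph. Qed.
Lemma q_j_sum (I : Type) (r : seq I) (P : pred I) (F : I -> H) :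
  q_j (\sum_(i <- r | P i) F i) = \sum_(i <- r | P i) q_j (F i).
Proof. exact: big_morph. Qed.
Lemma q_k_sum (I : Type) (r : seq I) (P : pred I) (F : I -> H) :
  q_k (\sum_(i <- r | P i) F i) = \sum_(i <- r | P i) q_k (F i).
Proof. exact: big_morph. Qed.

Lemma geo_real_cvg (v : nat -> R) M x : 0 <= x < 1 ->
  (forall n, `|v n| <= M * x ^+ n) -> cvgn (series v).
Proof.
move=> /andP[x0 x1] h; apply: normed_cvg.
have M0 : 0 <= M by have := h 0%N; rewrite expr0 mulr1; apply: le_trans.
apply: (series_le_cvg (v_ := geometric M x)) => //=.
- by move=> n; rewrite mulr_ge0 ?exprn_ge0.
- by apply: is_cvg_geometric_series; rewrite ger0_norm.
Qed.

Lemma geo_quat_cvg u M x : 0 <= x < 1 ->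
  (forall n, `|u n| <= M * x ^+ n) -> cvgn (series u).
Proof.
move=> x01 h.
have hre : cvgn (series (@q_re R \o u)).
  by apply: (geo_real_cvg (M := M) x01) => n; apply: le_trans (abs_q_re _) (h n).
have hi : cvgn (series (@q_i R \o u)).
  by apply: (geo_real_cvg (M := M) x01) => n; apply: le_trans (abs_q_i _) (h n).
have hj : cvgn (series (@q_j R \o u)).
  by apply: (geo_real_cvg (M := M) x01) => n; apply: le_trans (abs_q_j _) (h n).
have hk : cvgn (series (@q_k R \o u)).
  by apply: (geo_real_cvg (M := M) x01) => n; apply: le_trans (abs_q_k _) (h n).
apply: (@cvgP _ _ (Quat (limn (series (@q_re R \o u))) (limn (series (@q_i R \o u)))
  (limn (series (@q_j R \o u))) (limn (series (@q_k R \o u))))).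
apply: quat_cvg => /=.
- by under eq_fun do rewrite /series/= q_re_sum.
- by under eq_fun do rewrite /series/= q_i_sum.
- by under eq_fun do rewrite /series/= q_j_sum.
- by under eq_fun do rewrite /series/= q_k_sum.
Qed.

Lemma geo_tail u l M x N : 0 <= x < 1 ->
  (forall n, `|u n| <= M * x ^+ n) -> series u @ \oo --> l ->
  `|l - \sum_(0 <= k < N) u k| <= M * (x ^+ N / (1 - x)).
Proof.
move=> x01 h ul.
have M0 : 0 <= M by have := h 0%N; rewrite expr0 mulr1; apply: le_trans.
have : `|series u n - \sum_(0 <= k < N) u k| @[n --> \oo] -->
    `|l - \sum_(0 <= k < N) u k|.
  by apply: cvg_norm; apply: cvgB => //; exact: cvg_cst.
move/cvgr_to_le; apply; near=> n.
have Nn : (N <= n)%N by near: n; exists N.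
rewrite (sub_series_geq u Nn) (le_trans (ler_norm_sum _ _ _))//.
apply: le_trans (ler_sum _ (fun k _ => h k)) _.
by rewrite -mulr_sumr ler_wpM2l// sum_expr_le.
Unshelve. all: by end_near. Qed.

Lemma quat_cvg_unique u l l' : u @ \oo --> l -> u @ \oo --> l' -> l = l'.
Proof. by apply: cvg_unique; exact: norm_hausdorff. Qed.

Lemma quat_cvgMl u l q : u @ \oo --> l -> (q * u n) @[n --> \oo] --> q * l.
Proof.
move=> /cvgrPdist_lt h; apply/cvgrPdist_lt => e e0.
have q1 : 0 < `|q| + 1 by rewrite ltr_wpDl.
have := h (e / (`|q| + 1)) (divr_gt0 e0 q1); apply: filterS => n.
rewrite -mulrBr quat_normM ltr_pdivlMr// => hn.
by apply: le_lt_trans hn; rewrite mulrC ler_wpM2l// lerDl.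
Qed.

Lemma quat_cvgMr u l q : u @ \oo --> l -> (u n * q) @[n --> \oo] --> l * q.
Proof.
move=> /cvgrPdist_lt h; apply/cvgrPdist_lt => e e0.
have q1 : 0 < `|q| + 1 by rewrite ltr_wpDl.
have := h (e / (`|q| + 1)) (divr_gt0 e0 q1); apply: filterS => n.
rewrite -mulrBl quat_normM ltr_pdivlMr// => hn.
by apply: le_lt_trans hn; rewrite ler_wpM2l// lerDl.
Qed.

End QuatSeries.

(** * Power series with radius of convergence at least one *)

Section PowerSeries.
Variable R : realType.
Local Notation H := (quat R).
Implicit Types (p q : H) (a b : nat -> H) (f : H -> H).

(* Radius of convergence at least [1], as boundedness of the terms. *)
Definition tame a :=
  forall s : R, 0 <= s < 1 -> exists M, forall k, `|a k| * s ^+ k <= M.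

Definition expands a f := forall q, qball q -> qseries a q @ \oo --> f q.

(** A radius [s] strictly between [|q|] and [1] turns bounded terms at [s] into geometric decay with
    ratio [|q| / s] at [q]. *)
Lemma tame_geo a q : tame a -> qball q -> exists M x,
  [/\ 0 <= M, 0 <= x < 1 & forall k, `|q ^+ k * a k| <= M * x ^+ k].
Proof.
rewrite /qball /= => ta q1; pose s := (1 + `|q|) / 2.
have q0 := normr_ge0 q.
have s01 : 0 < s < 1 by rewrite /s; apply/andP; split; lra.
have qs : `|q| < s by rewrite /s; lra.
case/andP: s01 => s0 s1; have [M hM] := ta s (introT andP (conj (ltW s0) s1)).
exists M, (`|q| / s); split.
- by apply: le_trans (hM 0%N); rewrite mulr_ge0// exprn_ge0// ltW.
- by rewrite divr_ge0 ?(ltW s0)//= ltr_pdivrMr// mul1r.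
move=> k; rewrite quat_normM quat_normX expr_div_n mulrA ler_pdivlMr ?exprn_gt0//.
by rewrite -mulrA mulrC ler_wpM2r ?exprn_ge0.
Qed.

Lemma qsum_cvg a q : tame a -> qball q -> qseries a q @ \oo --> qsum a q.
Proof. by move=> ta /(tame_geo ta)[M [x [_ x01 h]]]; apply: geo_quat_cvg x01 h. Qed.

Lemma expands_qsum a : tame a -> expands a (qsum a).
Proof. by move=> ta q; exact: qsum_cvg. Qed.

Lemma qsumP a q l : qseries a q @ \oo --> l -> qsum a q = l.
Proof. by move=> h; apply: cvg_lim => //; exact: norm_hausdorff. Qed.

Lemma expandsE a f q : expands a f -> qball q -> f q = qsum a q.
Proof. by move=> h /h /qsumP. Qed.

Lemma ball_real (s : R) : 0 <= s < 1 -> qball (s%:A : H).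
Proof. by case/andP=> s0 s1; rewrite /qball /= quat_normA ger0_norm. Qed.

Lemma expands_tame a f : expands a f -> tame a.
Proof.
move=> h s s01; have /cvgP/cvg_series_cvg_0/cvgP/cvg_seq_bounded := h _ (ball_real s01).
move=> /ex_strict_bound_gt0[M _ hM]; exists M => k.
have /= := hM k I; rewrite quat_normM quat_normX quat_normA.
by case/andP: s01 => s0 _; rewrite ger0_norm// mulrC => /ltW.
Qed.

Lemma eq_expands a f g : (forall q, qball q -> f q = g q) -> expands a f ->
  expands a g.
Proof. by move=> fg af q qB; rewrite -fg//; exact: af. Qed.

Lemma tameB a b : tame a -> tame b -> tame (fun k => a k - b k).
Proof.
move=> ta tb s s01; have [M hM] := ta s s01; have [M' hM'] := tb s s01.
exists (M + M') => k; apply: le_trans (lerD (hM k) (hM' k)).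
rewrite -mulrDl ler_wpM2r ?exprn_ge0//; first by case/andP: s01.
exact: ler_normB.
Qed.

Lemma expandsB a b f g : expands a f -> expands b g ->
  expands (fun k => a k - b k) (fun q => f q - g q).
Proof.
move=> af bg q qB.
have -> : qseries (fun k => a k - b k) q = qseries a q - qseries b q.
  apply/funext => n; rewrite /qseries /series/= -[RHS]/(_ - _) -sumrB.
  by apply: eq_bigr => k _; rewrite mulrBr.
by apply: cvgB; [exact: af|exact: bg].
Qed.

Lemma expandsMr a f q0 : expands a f ->
  expands (fun k => a k * q0) (fun q => f q * q0).
Proof.
move=> af q qB.
have -> : qseries (fun k => a k * q0) q = (fun n => qseries a q n * q0).
  apply/funext => n; rewrite /qseries /series/= mulr_suml.
  by apply: eq_bigr => k _; rewrite mulrA.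
by apply: quat_cvgMr; exact: af.
Qed.

(** If the coefficients below [k] vanish, the value at a small [x] is [x ^+ k] times [a k] up to an
    error of order [x ^+ k.+1]. Only small positive reals are tested, because they lie on every
    slice. *)
Lemma expands0_inj a (r s M : R) : 0 < r -> 0 < s ->
  (forall k, `|a k| * s ^+ k <= M) ->
  (forall x : R, 0 < x < r -> qseries a x%:A @ \oo --> (0 : H)) -> forall k, a k = 0.
Proof.
move=> r0 s0 hM h.
have M0 : 0 <= M by apply: le_trans (hM 0%N); rewrite mulr_ge0// exprn_ge0// ltW.
elim/ltn_ind => k IH; apply/eqP; rewrite -normr_le0; apply/ler_addgt0Pr => e e0.
(* [C] bounds the tail after index [k] divided by [x ^+ k.+1]. The three bounds on [x] serve in turn
   to stay in the interval of [h], to get [x / s <= 1 / 2] (whence the factor 2 in [C]), and to get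
   [x * C <= e]. *)
rewrite add0r; pose C := M * (s^-1 ^+ k.+1 * 2).
have C0 : 0 <= C by rewrite mulr_ge0// mulr_ge0// exprn_ge0// invr_ge0 ltW.
pose x := Num.min (Num.min (r / 2) (s / 2)) (e / (C + 1)).
have C1 : 0 < C + 1 by lra.
have x0 : 0 < x by rewrite !lt_min !divr_gt0.
have xr : x < r by rewrite (@le_lt_trans _ _ (r / 2)) ?ge_min ?lexx//; lra.
have xs : x <= s / 2 by rewrite !ge_min lexx orbT.
have xe : x * C <= e.
  apply: (@le_trans _ _ (e / (C + 1) * C)); first by rewrite ler_wpM2r// ge_min lexx orbT.
  by rewrite -mulrA ler_piMr ?(ltW e0)// mulrC ler_pdivrMr// mul1r; lra.
have y2 : x / s <= 2^-1 by rewrite ler_pdivrMr// mulrC.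
have y0 : 0 <= x / s by rewrite divr_ge0// ltW.
have y01 : 0 <= x / s < 1 by rewrite y0 /=; lra.
have ua n : `|(x%:A) ^+ n * a n| <= M * (x / s) ^+ n.
  rewrite quat_normM quat_normX quat_normA ger0_norm ?(ltW x0)// expr_div_n.
  rewrite mulrA ler_pdivlMr ?exprn_gt0// -mulrA mulrC ler_wpM2r//.
  by rewrite exprn_ge0// ltW.
have S0 : \sum_(0 <= j < k.+1) (x%:A : H) ^+ j * a j = (x%:A : H) ^+ k * a k.
  rewrite big_nat_recr//= big_nat big1 ?add0r// => j /andP[_ /IH ->].
  by rewrite mulr0.
have := geo_tail k.+1 y01 ua (h x (introT andP (conj x0 xr))).
rewrite S0 sub0r normrN quat_normM quat_normX quat_normA ger0_norm ?(ltW x0)//.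
move=> hk; rewrite -(@ler_pM2l _ (x ^+ k)) ?exprn_gt0//; apply: le_trans hk _.
apply: (@le_trans _ _ (x ^+ k * (x * C))); last by rewrite ler_pM2l// exprn_gt0.
have d2 : (1 - x / s)^-1 <= 2.
  by rewrite -[leRHS]invrK lef_pV2 ?posrE ?invr_gt0//; lra.
apply: (@le_trans _ _ (M * ((x / s) ^+ k.+1 * 2))).
  by rewrite !ler_wpM2l// exprn_ge0.
by rewrite /C !exprMn [x ^+ k.+1]exprS le_eqVlt; apply/orP; left; apply/eqP; ring.
Qed.

Lemma expands_inj a b f : expands a f -> expands b f -> a = b.
Proof.
move=> af bf; apply/funext => k; apply/eqP; rewrite -subr_eq0; apply/eqP.
have tab : tame (fun k => a k - b k).
  by apply: tameB; [exact: expands_tame af|exact: expands_tame bf].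
have [|M hM] := tab 2^-1; first by apply/andP; split; lra.
apply: (@expands0_inj (fun k => a k - b k) 1 2^-1 M) => //.
move=> x /andP[x0 x1]; have xB : qball (x%:A : H) by apply: ball_real; rewrite ltW.
by have := expandsB af bf xB; rewrite subrr.
Qed.

Lemma coefsE a f : expands a f -> coefs f = a.
Proof. by move=> af; apply: xget_unique => // b bf; exact: expands_inj bf af. Qed.

End PowerSeries.

(** * The ring of coefficient sequences under the regular product *)

Section RegularProduct.
Variable R : realType.
Local Notation H := (quat R).

(** A name of its own, to carry convolution as product rather than the pointwise product of
    functions. *)
Definition ps := nat -> H.
Implicit Types (a b c : ps) (p q : H).

HB.instance Definition _ := gen_eqMixin ps.
HB.instance Definition _ := gen_choiceMixin ps.

Definition ps0 : ps := fun=> 0.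
Definition ps1 : ps := fun n => (n == 0)%N%:R.
Definition ps_opp a : ps := fun n => - a n.
Definition ps_add a b : ps := fun n => a n + b n.
Definition ps_mul a b : ps := fun n => \sum_(k < n.+1) a k * b (n - k)%N.

Fact ps_addA : associative ps_add.
Proof. by move=> a b c; apply/funext => n; exact: addrA. Qed.
Fact ps_addC : commutative ps_add.
Proof. by move=> a b; apply/funext => n; exact: addrC. Qed.
Fact ps_add0 : left_id ps0 ps_add.
Proof. by move=> a; apply/funext => n; exact: add0r. Qed.
Fact ps_addN : left_inverse ps0 ps_opp ps_add.
Proof. by move=> a; apply/funext => n; exact: addNr. Qed.
HB.instance Definition _ :=
  GRing.isZmodule.Build ps ps_addA ps_addC ps_add0 ps_addN.

(** Coefficient [n] of a convolution sees only indices up to [n], so associativity is inherited from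
    polynomials over [H]. *)
Let trunc N a : {poly H} := \poly_(i < N) a i.

Let ps_mul_trunc a b n N : (n < N)%N -> ps_mul a b n = (trunc N a * trunc N b)`_n.
Proof.
move=> nN; rewrite coefM; apply: eq_bigr => k _; rewrite !coef_poly.
have kN : (k < N)%N by apply: leq_trans nN; rewrite ltn_ord.
have nkN : (n - k < N)%N by apply: leq_ltn_trans nN; rewrite leq_subr.
by rewrite kN nkN.
Qed.

Fact ps_mulA : associative ps_mul.
Proof.
move=> a b c; apply/funext => n; pose t := trunc n.+1.
transitivity ((t a * (t b * t c))`_n).
  rewrite coefM; apply: eq_bigr => k _; rewrite coef_poly ltn_ord.
  by rewrite (ps_mul_trunc _ _ (N := n.+1))// ltnS leq_subr.
rewrite mulrA coefM; apply: eq_bigr => k _.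
by rewrite -ps_mul_trunc// coef_poly ltnS leq_subr.
Qed.
Fact ps_mul1l : left_id ps1 ps_mul.
Proof.
move=> a; apply/funext => n; rewrite /ps_mul big_ord_recl /ps1 eqxx mul1r subn0.
by rewrite big1 ?addr0// => k _; rewrite mul0r.
Qed.
Fact ps_mul1r : right_id ps1 ps_mul.
Proof.
move=> a; apply/funext => n; rewrite /ps_mul big_ord_recr /ps1 /= subnn eqxx mulr1.
by rewrite big1 ?add0r// => k _; rewrite subn_eq0 leqNgt ltn_ord mulr0.
Qed.
Fact ps_mulDl : left_distributive ps_mul +%R.
Proof.
move=> a b c; apply/funext => n; rewrite -[RHS]/(_ + _) -big_split /=.
by apply: eq_bigr => k _; rewrite -mulrDl.
Qed.
Fact ps_mulDr : right_distributive ps_mul +%R.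
Proof.
move=> a b c; apply/funext => n; rewrite -[RHS]/(_ + _) -big_split /=.
by apply: eq_bigr => k _; rewrite -mulrDr.
Qed.
Fact ps_1neq0 : ps1 != 0.
Proof. by apply/eqP => /(congr1 (@^~ 0%N)) /eqP; rewrite oner_eq0. Qed.
HB.instance Definition _ := GRing.Zmodule_isNzRing.Build ps
  ps_mulA ps_mul1l ps_mul1r ps_mulDl ps_mulDr ps_1neq0.

Lemma ps_addE a b n : (a + b) n = a n + b n. Proof. by []. Qed.
Lemma ps_subE a b n : (a - b) n = a n - b n. Proof. by []. Qed.
Lemma ps_mulE a b n : (a * b) n = \sum_(k < n.+1) a k * b (n - k)%N.
Proof. by []. Qed.
Lemma ps_mulEr a b n : (a * b) n = \sum_(k < n.+1) a (n - k)%N * b k.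
Proof.
rewrite ps_mulE (reindex_inj rev_ord_inj) /=; apply: eq_bigr => k _.
by rewrite subSS subKn// -ltnS.
Qed.

Definition psC q : ps := fun n => if n is 0 then q else 0.
Definition psX : ps := fun n => (n == 1)%N%:R.

Lemma psC0 : psC 0 = 0. Proof. by apply/funext => -[]. Qed.
Lemma psC1 : psC 1 = 1. Proof. by apply/funext => -[]. Qed.

Lemma psCM p q : psC (p * q) = psC p * psC q.
Proof.
apply/funext => n; rewrite ps_mulE big_ord_recl subn0 big1 ?addr0 => [|k _].
  by case: n => [|n] //=; rewrite mulr0.
by rewrite mul0r.
Qed.

Lemma psCD p q : psC (p + q) = psC p + psC q.
Proof. by apply/funext => -[|n]; rewrite ps_addE //= addr0. Qed.

Lemma psMC a q n : (a * psC q) n = a n * q.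
Proof.
rewrite ps_mulEr big_ord_recl subn0 big1 ?addr0// => k _.
by rewrite /= mulr0.
Qed.

Lemma psCM_coef a q n : (psC q * a) n = q * a n.
Proof. by rewrite ps_mulE big_ord_recl subn0 big1 ?addr0// => k _; rewrite mul0r. Qed.

Lemma psXM_coef a n : (psX * a) n = if n is n'.+1 then a n' else 0.
Proof.
rewrite ps_mulE; case: n => [|n]; first by rewrite big_ord_recl big_ord0 mul0r addr0.
rewrite big_ord_recl mul0r add0r big_ord_recl /= mul1r subn1 big1 ?addr0// => k _.
by rewrite mul0r.
Qed.

Lemma psX_comm a : a * psX = psX * a.
Proof.
apply/funext => n; rewrite psXM_coef ps_mulEr.
case: n => [|n]; first by rewrite big_ord_recl big_ord0 mulr0 addr0.
rewrite big_ord_recl mulr0 add0r big_ord_recl /= mulr1 subn1 big1 ?addr0// => k _.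
by rewrite mulr0.
Qed.

Definition ps_conj a : ps := fun n => qconj (a n).

Lemma ps_conjK a : ps_conj (ps_conj a) = a.
Proof. by apply/funext => n; exact: qconjK. Qed.

Lemma ps_conjB a b : ps_conj (a - b) = ps_conj a - ps_conj b.
Proof. by apply/funext => n; rewrite /ps_conj ps_subE qconjD qconjN. Qed.

Lemma ps_conj1 : ps_conj 1 = 1.
Proof. by apply/funext => -[|n]; rewrite /ps_conj /= ?qconj1 ?qconj0. Qed.

Lemma ps_conjC q : ps_conj (psC q) = psC (qconj q).
Proof. by apply/funext => -[|n]; rewrite /ps_conj /= ?qconj0. Qed.

Lemma ps_conjX : ps_conj psX = psX.
Proof.
by apply/funext => n; rewrite /ps_conj /psX; case: eqP => _; rewrite ?qconj1 ?qconj0.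
Qed.

Lemma ps_conjM a b : ps_conj (a * b) = ps_conj b * ps_conj a.
Proof.
apply/funext => n; rewrite /ps_conj ps_mulE ps_mulEr qconj_sum.
by apply: eq_bigr => k _; rewrite qconjM.
Qed.

Definition ps_real a := forall n, exists r : R, a n = r%:A.

Lemma ps_realC a b : ps_real a -> a * b = b * a.
Proof.
move=> ra; apply/funext => n; rewrite ps_mulE ps_mulEr; apply: eq_bigr => k _.
by have [r ->] := ra k; rewrite scale_commq.
Qed.

Lemma ps_realM a b : ps_real a -> ps_real b -> ps_real (a * b).
Proof.
move=> ra rb n.
have [x hx] := choice ra; have [y hy] := choice rb.
exists (\sum_(k < n.+1) x k * y (n - k)%N).
rewrite ps_mulE scaler_suml; apply: eq_bigr => k _.
by rewrite hx hy -scalerAl mul1r scalerA.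
Qed.

Lemma ps_real1 : ps_real 1.
Proof. by move=> [|n]; [exists 1; rewrite scale1r|exists 0; rewrite scale0r]. Qed.

Lemma ps_realX a n : ps_real a -> ps_real (a ^+ n).
Proof.
move=> ra; elim: n => [|n IH]; first exact: ps_real1.
by rewrite exprS; exact: ps_realM.
Qed.

Lemma qconj_fixed q : qconj q = q -> exists r : R, q = r%:A.
Proof.
case: q => x y z t [] /= h1 h2 h3; exists x.
by apply: quat_eqP => /=; lra.
Qed.

(* [a * conj a] is fixed by the anti-automorphism [conj]. *)
Lemma ps_real_sym a : ps_real (a * ps_conj a).
Proof.
move=> n; apply: qconj_fixed; rewrite -[LHS]/(ps_conj (a * ps_conj a) n).
by rewrite ps_conjM ps_conjK.
Qed.

(** Coefficients on both sides are real, hence equal to their real parts, and the real part of a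
    product of two quaternions is symmetric. *)
Lemma ps_symC a : a * ps_conj a = ps_conj a * a.
Proof.
apply/funext => n; have [x hx] := ps_real_sym a n.
have [y hy] := ps_real_sym (ps_conj a) n; rewrite ps_conjK in hy.
have reA (r : R) : q_re (r%:A : H) = r by rewrite /= mulr1.
rewrite hx hy; congr (_ %:A); rewrite -[x]reA -[y]reA -hx -hy.
rewrite ps_mulE ps_mulEr !q_re_sum; apply: eq_bigr => k _ /=.
by ring.
Qed.

End RegularProduct.

(** * Evaluation of series and of their regular products *)

Section Evaluation.
Variable R : realType.
Local Notation H := (quat R).
Local Notation ps := (ps R).
Implicit Types (a b c : ps) (p q : H).

Lemma tameP a : (forall s : R, 0 < s < 1 -> exists M, forall k, `|a k| * s ^+ k <= M) ->
  tame a.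
Proof.
move=> h s; rewrite le_eqVlt => /andP[/orP[/eqP<-|s0] s1]; last by apply: h; rewrite s0.
have [|M hM] := h 2^-1; first by apply/andP; split; lra.
exists `|a 0%N| => -[|k]; first by rewrite expr0 mulr1.
by rewrite expr0n mulr0.
Qed.

Lemma tame_bounded a M : (forall k, `|a k| <= M) -> tame a.
Proof.
move=> h s /andP[s0 s1]; exists M => k; apply: le_trans (h k).
by rewrite ler_piMr// exprn_ile1// ltW.
Qed.

Lemma tame_psC q : tame (psC q).
Proof. by apply: (@tame_bounded _ `|q|) => -[|k] //=; rewrite normr0. Qed.

Lemma tame1 : tame (1 : ps).
Proof. by rewrite -psC1; exact: tame_psC. Qed.

Lemma tameX : tame (psX R).
Proof.
apply: (@tame_bounded _ 1) => k; rewrite /psX.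
by case: eqP => _; rewrite ?quat_norm1 ?normr0.
Qed.

Lemma tame_sub a b : tame a -> tame b -> tame (a - b).
Proof. exact: tameB. Qed.

Lemma tame_conj a : tame a -> tame (ps_conj a).
Proof. by move=> ta s /ta[M h]; exists M => k; rewrite quat_norm_conj. Qed.

(** Comparing with a radius [t] between [s] and [1] gains a factor [(s / t) ^+ n], which beats the
    [n.+1] terms of the convolution. *)
Lemma tameM a b : tame a -> tame b -> tame (a * b).
Proof.
move=> ta tb; apply: tameP => s /andP[s0 s1]; pose t := (1 + s) / 2.
have t0 : 0 < t by rewrite /t; lra.
have t01 : 0 <= t < 1 by rewrite ltW//= /t; lra.
have st : 0 <= s / t < 1.
  by rewrite divr_ge0 ?ltW//= ltr_pdivrMr// mul1r /t; lra.
have [Ma ha] := ta t t01; have [Mb hb] := tb t t01.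
have Ma0 : 0 <= Ma by apply: le_trans (ha 0%N); rewrite mulr_ge0// exprn_ge0// ltW.
have Mb0 : 0 <= Mb by apply: le_trans (hb 0%N); rewrite mulr_ge0// exprn_ge0// ltW.
have [C [y [C0 /andP[y0 y1] hy]]] := muln_expr_le st.
exists (Ma * Mb * (C + 1)) => n; rewrite ps_mulE.
apply: (@le_trans _ _ (n.+1%:R * (Ma * Mb / t ^+ n) * s ^+ n)).
  rewrite ler_wpM2r ?exprn_ge0 ?(ltW s0)//; apply: le_trans (ler_norm_sum _ _ _) _.
  rewrite mulr_natl -[n.+1 in leRHS]card_ord -sumr_const; apply: ler_sum => k _.
  rewrite quat_normM ler_pdivlMr ?exprn_gt0//.
  have kn : (k <= n)%N by rewrite -ltnS.
  rewrite -[X in t ^+ X](subnKC kn) exprD mulrACA.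
  by apply: ler_pM; rewrite ?mulr_ge0 ?exprn_ge0 ?(ltW t0).
rewrite -mulrA mulrCA -!mulrA ler_wpM2l// ler_wpM2l//.
rewrite mulrCA (mulrC _ (s ^+ n)) -expr_div_n -natr1 mulrDl mul1r lerD//.
  by apply: le_trans (hy n) _; rewrite ler_piMr// exprn_ile1// ltW.
by case/andP: st => st0 st1; rewrite exprn_ile1// ltW.
Qed.

Lemma tame_expn a n : tame a -> tame (a ^+ n).
Proof.
by move=> ta; elim: n => [|n IH]; [exact: tame1|rewrite exprS; exact: tameM].
Qed.

(** In [q ^+ (i + k) * a i * b k] all powers of [q] stand on the left, so [q ^+ k] can be split off
    only to the left of the partial sum of [a]. This is the exact finite form of the evaluation
    formula below. *)
Lemma partial_sum_mul a b q N :
  \sum_(0 <= n < N) q ^+ n * (a * b) n =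
  \sum_(0 <= k < N) q ^+ k * (\sum_(0 <= i < N - k) q ^+ i * a i) * b k.
Proof.
elim: N => [|N IH]; first by rewrite !big_nil.
rewrite big_nat_recr//= IH [RHS]big_nat_recr//= subSn// subnn big_nat1.
rewrite ps_mulEr big_ord_recr /= subnn mulrDr addrA; congr (_ + _); last first.
  by rewrite expr0 mul1r mulrA.
rewrite mulr_sumr -(big_mkord xpredT (fun k => q ^+ N * (a (N - k)%N * b k))).
rewrite -big_split big_nat [RHS]big_nat; apply: eq_bigr => k /andP[_ kN] /=.
rewrite subSn ?(ltnW kN)// big_nat_recr//= mulrDr mulrDl; congr (_ + _).
by rewrite [in RHS]mulrA -exprD subnKC ?(ltnW kN)// mulrA.
Qed.

(** The relation [q * A = A * p] carries [q ^+ k] across [A = qsum a q], turning the sum of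
    [q ^+ k * A * b k] into [A] times the value of [b] at [p]. Stated without an inverse of [A], it
    covers at once the commuting case [p = q], the conjugated argument, and [A = 0]. *)
Lemma qsum_mul a b p q : tame a -> tame b -> qball q -> qball p ->
  q * qsum a q = qsum a q * p -> qsum (a * b) q = qsum a q * qsum b p.
Proof.
move=> ta tb qB pB; set A := qsum a q => qA.
have [M1 [x1 [M10 x101 h1]]] := tame_geo ta qB.
have [M2 [x2 [M20 x201 h2]]] := tame_geo tb qB.
have T m : `|A - \sum_(0 <= i < m) q ^+ i * a i| <= M1 * (x1 ^+ m / (1 - x1)).
  by apply: geo_tail (x101) h1 _; exact: qsum_cvg.
pose x := Num.max x1 x2.
have x1x : x1 <= x by rewrite le_max lexx.
have x2x : x2 <= x by rewrite le_max lexx orbT.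
case/andP: x101 => x10 x11; case/andP: x201 => x20 x21.
have x01 : 0 <= x < 1 by rewrite (le_trans x10 x1x)/= gt_max x11.
have x0 : 0 <= x by case/andP: x01.
have [C [y [C0 y01 hy]]] := muln_expr_le x01.
have qAk k : q ^+ k * A = A * p ^+ k.
  elim: k => [|k IH]; first by rewrite !expr0 mulr1 mul1r.
  by rewrite exprSr -mulrA qA mulrA IH -mulrA -exprSr.
have S1 : (fun N => A * qseries b p N) @ \oo --> A * qsum b p.
  by apply: quat_cvgMl; exact: qsum_cvg.
have S2 := qsum_cvg (tameM ta tb) qB.
pose K := M1 / (1 - x1) * M2; have K0 : 0 <= K.
  by rewrite mulr_ge0// divr_ge0// subr_ge0 ltW.
(* The difference is a sum over [k < N] of a tail of [a] after [N - k] terms, flanked by [q ^+ k]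
   and [b k]. Tail and term contribute [x ^+ (N - k)] and [x ^+ k], so each summand is at most
   [K * x ^+ N]. *)
have D N : `|A * qseries b p N - qseries (a * b) q N| <= K * C * y ^+ N.
  rewrite /qseries /series /= partial_sum_mul mulr_sumr -sumrB.
  apply: le_trans (ler_norm_sum _ _ _) _.
  rewrite -mulrA; apply: le_trans (ler_wpM2l K0 (hy N)).
  have -> : K * (N%:R * x ^+ N) = \sum_(0 <= k < N) (K * x ^+ N).
    by rewrite sumr_const_nat subn0 mulr_natl mulrnAr.
  rewrite big_nat [leRHS]big_nat; apply: ler_sum => k /andP[_ kN].
  rewrite mulrA -qAk -mulrBl -mulrBr.
  rewrite !quat_normM mulrAC -quat_normM mulrC.
  rewrite -[X in x ^+ X](subnK (ltnW kN)) exprD.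
  rewrite /K mulrACA.
  apply: ler_pM => //.
  - apply: le_trans (T _) _; rewrite mulrCA mulrC ler_wpM2l//.
      by rewrite divr_ge0// subr_ge0 ltW.
    by rewrite lerXn2r ?nnegrE.
  - apply: le_trans (h2 k) _.
    by rewrite ler_wpM2l// lerXn2r// nnegrE.
have : (fun N => A * qseries b p N - qseries (a * b) q N) @ \oo -->
    A * qsum b p - qsum (a * b) q by apply: cvgB.
have D0 : (fun N => A * qseries b p N - qseries (a * b) q N) @ \oo --> (0 : H).
  apply/norm_cvg0P; apply: (@squeeze_cvgr _ _ _ _ (cst 0) (geometric (K * C) y)).
  - by near=> n; rewrite normr_ge0 D.
  - exact: cvg_cst.
  - by apply: cvg_geometric; case/andP: y01 => y0 y1; rewrite ger0_norm.
by move=> /quat_cvg_unique/(_ D0) /eqP; rewrite subr_eq0 => /eqP.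
Unshelve. all: by end_near. Qed.

Lemma qsum_commute a q : tame a -> qball q -> (forall k, GRing.comm q (a k)) ->
  GRing.comm q (qsum a q).
Proof.
move=> ta qB h; have S := qsum_cvg ta qB.
have S1 := @quat_cvgMl _ _ _ q S; have S2 := @quat_cvgMr _ _ _ q S.
suff e : (fun n => q * qseries a q n) = (fun n => qseries a q n * q).
  by rewrite e in S1; exact: quat_cvg_unique S1 S2.
apply/funext => n; rewrite /qseries/series/= mulr_sumr mulr_suml.
by apply: eq_bigr => k _; apply: commrM; [exact: commrX|exact: h].
Qed.

Lemma ps_real_commute a q : ps_real a -> tame a -> qball q -> GRing.comm q (qsum a q).
Proof.
move=> ra ta qB; apply: qsum_commute => // k.
by have [r ->] := ra k; rewrite /GRing.comm scale_commq.
Qed.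

Lemma qsum_mul_comm a b q : tame a -> tame b -> qball q ->
  GRing.comm q (qsum a q) -> qsum (a * b) q = qsum a q * qsum b q.
Proof. by move=> ta tb qB; apply: qsum_mul. Qed.

Lemma qsum_real_mul a b q : ps_real a -> tame a -> tame b -> qball q ->
  qsum (a * b) q = qsum a q * qsum b q.
Proof.
by move=> ra ta tb qB; apply: qsum_mul_comm => //; exact: ps_real_commute.
Qed.

Lemma qsum_psC p q : qsum (psC p) q = p.
Proof.
apply: qsumP; apply/cvgrPdist_lt => e e0; near=> n.
rewrite /qseries /series /= big_ltn; last by near: n; exists 1%N.
rewrite expr0 mul1r big_nat big1 ?addr0 ?subrr ?normr0// => k /andP[k1 _].
by case: k k1 => [|k] //= _; rewrite mulr0.
Unshelve. all: by end_near. Qed.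

Lemma qsum1 q : qsum (1 : ps) q = 1.
Proof. by rewrite -psC1 qsum_psC. Qed.

Lemma qsumX q : qsum (psX R) q = q.
Proof.
apply: qsumP; apply/cvgrPdist_lt => e e0; near=> n.
have n1 : (1 < n)%N by near: n; exists 2%N.
rewrite /qseries /series /= big_ltn; last by apply: ltn_trans n1.
rewrite mulr0 add0r big_ltn// expr1 mulr1 big_nat big1 ?addr0 ?subrr ?normr0//.
by move=> [|[|k]] //= _; rewrite mulr0.
Unshelve. all: by end_near. Qed.

Lemma qsum_sub a b q : tame a -> tame b -> qball q ->
  qsum (a - b) q = qsum a q - qsum b q.
Proof.
move=> ta tb qB; apply/qsumP.
exact: (expandsB (expands_qsum ta) (expands_qsum tb) qB).
Qed.

Lemma qsum_mulC a p q : tame a -> qball q -> qsum (a * psC p) q = qsum a q * p.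
Proof.
move=> ta qB; apply: qsumP.
have -> : a * psC p = (fun k => a k * p) by apply/funext => k; rewrite psMC.
exact: (@expandsMr _ _ _ p (expands_qsum ta) q qB).
Qed.

Lemma qsum_expn_real a q n : ps_real a -> tame a -> qball q ->
  qsum (a ^+ n) q = qsum a q ^+ n.
Proof.
move=> ra ta qB; elim: n => [|n IH]; first by rewrite !expr0 qsum1.
by rewrite !exprS qsum_real_mul// ?IH//; exact: tame_expn.
Qed.

(* The transformation [T q = A(q)^-1 q A(q)] has an explicit preimage as soon
   as the symmetrization does not vanish at the target. *)
Lemma sphere_preimage a p : tame a -> qball p -> qsum (a * ps_conj a) p != 0 ->
  exists q, [/\ `|q| = `|p|, q * qsum a q = qsum a q * p & qsum a q != 0].
Proof.
move=> ta pB s0; set B := qsum (ps_conj a) p.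
have tc := tame_conj ta.
have B0 : B != 0.
  apply: contra s0 => /eqP B0; rewrite ps_symC (@qsum_mul _ _ p)// -/B B0 ?mul0r//.
  by rewrite mulr0.
exists (B^-1 * p * B).
have nq : `|B^-1 * p * B| = `|p|.
  by rewrite !quat_normM quat_normV mulrC mulrA divff ?mul1r// normr_eq0.
have qB : qball (B^-1 * p * B) by rewrite /qball /= nq.
have e : qsum (a * ps_conj a) p = B * qsum a (B^-1 * p * B).
  rewrite ps_symC; apply: qsum_mul => //.
  by rewrite !mulrA mulrV ?quat_unitE// mul1r.
have A0 : qsum a (B^-1 * p * B) != 0.
  by apply: contra s0; rewrite e => /eqP->; rewrite mulr0.
(* [B] times the value of [a] at the new point is the value at [p] of a series with real
   coefficients, so it commutes with [p]; cancelling [B] on the left leaves the required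
   relation. *)
split=> //; have := ps_real_commute (ps_real_sym a) (tameM ta tc) pB.
rewrite /GRing.comm e; move: (qsum a _) => A h; rewrite -!mulrA h -!mulrA.
by rewrite mulKr ?quat_unitE.
Qed.

End Evaluation.

(** * One-variable integrals and bisection of rectangles *)

Section Goursat.
Variable R : realType.
Implicit Types (f g : R -> R) (a b c d m x y e : R).

Definition cont_on a b f := forall x, a <= x <= b -> {for x, continuous f}.

Definition Int a b f : R := \int[lebesgue_measure]_(x in `[a, b]) f x.

Lemma cont_on_integrable a b f : cont_on a b f ->
  lebesgue_measure.-integrable `[a, b] (EFin \o f).
Proof.
move=> cf; apply: continuous_compact_integrable; first exact: segment_compact.
apply: continuous_in_subspaceT => x; rewrite inE /= in_itv /=; exact: cf.
Qed.

Lemma IntB a b f g : cont_on a b f -> cont_on a b g ->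
  Int a b (fun x => f x - g x) = Int a b f - Int a b g.
Proof. by move=> cf cg; rewrite /Int RintegralB//; exact: cont_on_integrable. Qed.

Lemma IntD a b f g : cont_on a b f -> cont_on a b g ->
  Int a b (fun x => f x + g x) = Int a b f + Int a b g.
Proof. by move=> cf cg; rewrite /Int RintegralD//; exact: cont_on_integrable. Qed.

Lemma IntZ a b f k : cont_on a b f -> Int a b (fun x => k * f x) = k * Int a b f.
Proof. by move=> cf; rewrite /Int RintegralZl//; exact: cont_on_integrable. Qed.

Lemma Int_cst a b k : a <= b -> Int a b (fun=> k) = k * (b - a).
Proof.
move=> ab; rewrite /Int Rintegral_cst//= lebesgue_measure_itv /= lte_fin.
by move: ab; rewrite le_eqVlt => /predU1P[->|->] //=; rewrite ltxx /= subrr.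
Qed.

Lemma eq_Int a b f g : (forall x, a <= x <= b -> f x = g x) -> Int a b f = Int a b g.
Proof. by move=> fg; apply: eq_Rintegral => x; rewrite inE /= in_itv /=; exact: fg. Qed.

Lemma le_Int a b f g : cont_on a b f -> cont_on a b g ->
  (forall x, a <= x <= b -> f x <= g x) -> Int a b f <= Int a b g.
Proof.
move=> cf cg fg; apply: le_Rintegral => //.
- exact: cont_on_integrable cf.
- exact: cont_on_integrable cg.
Qed.

Lemma Int_split a m b f : a <= m <= b -> cont_on a b f ->
  Int a b f = Int a m f + Int m b f.
Proof.
move=> /andP[am mb] cf; have := cont_on_integrable cf => itf.
have := @Rintegral_itvB R f (BLeft a) (BRight b) m itf.
rewrite !bnd_simp => /(_ am mb).
rewrite Rintegral_itv_obnd_cbnd; last first.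
  by apply: integrableS itf => //; apply: subset_itvr; rewrite bnd_simp.
by rewrite /Int => <-; rewrite addrC subrK.
Qed.

Lemma Int_near a b f k C : a <= b -> cont_on a b f ->
  (forall x, a <= x <= b -> `|f x - k| <= C) ->
  `|Int a b f - k * (b - a)| <= C * (b - a).
Proof.
move=> ab cf h; have ck z : cont_on a b (fun=> z) by move=> x _; exact: cst_continuous.
rewrite ler_distl -!(Int_cst _ ab) -(IntB (ck _) (ck _)) -(IntD (ck _) (ck _)).
by apply/andP; split; apply: le_Int => // x /h; rewrite ler_distl => /andP[].
Qed.

Lemma Int_norm_le a b f C : a <= b -> cont_on a b f ->
  (forall x, a <= x <= b -> `|f x| <= C) -> `|Int a b f| <= C * (b - a).
Proof.
move=> ab cf h; have := @Int_near a b f 0 C ab cf.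
by rewrite mul0r subr0; apply=> x /h; rewrite subr0.
Qed.

(* Bisect, and look at the limit point. *)
Lemma additive_rect_eq0 (mu : R -> R -> R -> R -> R) a b c d :
  a <= b -> c <= d ->
  (forall x m y z t, a <= x -> x <= m -> m <= y -> y <= b ->
     c <= z -> z <= t -> t <= d -> mu x y z t = mu x m z t + mu m y z t) ->
  (forall x y z m t, a <= x -> x <= y -> y <= b ->
     c <= z -> z <= m -> m <= t -> t <= d -> mu x y z t = mu x y z m + mu x y m t) ->
  (forall x0 y0 e, a <= x0 <= b -> c <= y0 <= d -> 0 < e -> exists2 r, 0 < r &
     forall x y z t, a <= x -> x <= x0 -> x0 <= y -> y <= b ->
       c <= z -> z <= y0 -> y0 <= t -> t <= d -> y - x < r -> t - z < r ->
       `|mu x y z t| <= e * ((y - x) + (t - z)) ^+ 2) ->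
  mu a b c d = 0.
Proof.
move=> ab cd add1 add2 loc; pose l n : R := (b - a) / 2 ^+ n; pose w n : R := (d - c) / 2 ^+ n.
have l0 n : 0 <= l n by rewrite divr_ge0 ?exprn_ge0// subr_ge0.
have w0 n : 0 <= w n by rewrite divr_ge0 ?exprn_ge0// subr_ge0.
have half (k : R) n : k / 2 ^+ n = k / 2 ^+ n.+1 + k / 2 ^+ n.+1.
  by rewrite exprS; field; rewrite expf_neq0.
have lS n : l n = l n.+1 + l n.+1 := half _ n.
have wS n : w n = w n.+1 + w n.+1 := half _ n.
pose good n (s : R * R) := [/\ a <= s.1, s.1 + l n <= b, c <= s.2 & s.2 + w n <= d].
pose m n (s : R * R) := `|mu s.1 (s.1 + l n) s.2 (s.2 + w n)|.
(* One of the four quarters carries at least a fourth of [|mu|]. A rectangle is recorded by its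
   lower left corner and its generation; [good] is a premise under the existential so that [choice]
   yields a total selection function. *)
have step : forall ns : nat * (R * R), exists s' : R * R, good ns.1 ns.2 ->
    [/\ good ns.1.+1 s', m ns.1 ns.2 <= 4 * m ns.1.+1 s',
     ns.2.1 <= s'.1 <= ns.2.1 + l ns.1.+1 & ns.2.2 <= s'.2 <= ns.2.2 + w ns.1.+1].
  move=> [n [x y]] /=; have [[/= ax xb cy yd]|] := pselect (good n (x, y)); last first.
    by move=> ng; exists (x, y).
  have := l0 n.+1; have := w0 n.+1 => W0 L0.
  have M : mu x (x + l n) y (y + w n) =
      mu x (x + l n.+1) y (y + w n.+1) +
      mu x (x + l n.+1) (y + w n.+1) (y + w n.+1 + w n.+1) +
      (mu (x + l n.+1) (x + l n.+1 + l n.+1) y (y + w n.+1) +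
       mu (x + l n.+1) (x + l n.+1 + l n.+1) (y + w n.+1) (y + w n.+1 + w n.+1)).
    rewrite lS wS in xb yd *; rewrite !addrA in xb yd.
    rewrite [x + (_ + _)]addrA [y + (_ + _)]addrA.
    rewrite (add1 _ (x + l n.+1)); [|lra..].
    rewrite (add2 x _ y (y + w n.+1)); [|lra..].
    by rewrite (add2 (x + l n.+1) _ y (y + w n.+1)); [|lra..].
  suff : exists s' : R * R, [/\ s'.1 = x \/ s'.1 = x + l n.+1,
      s'.2 = y \/ s'.2 = y + w n.+1 & m n (x, y) <= 4 * m n.+1 s'].
    move=> [[x' y'] /= [hx hy hm]]; exists (x', y') => _; clear M; rewrite lS in xb; rewrite wS in yd.
    by split=> //=; first split => /=; case: hx => hx; case: hy => hy;
      try (apply/andP; split); lra.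
  apply: contrapT => hn.
  have H s : (s.1 = x \/ s.1 = x + l n.+1) -> (s.2 = y \/ s.2 = y + w n.+1) ->
      4 * m n.+1 s < m n (x, y).
    by move=> h1 h2; rewrite ltNge; apply/negP => h3; apply: hn; exists s.
  have h1 := H (x, y) (or_introl erefl) (or_introl erefl).
  have h2 := H (x, y + w n.+1) (or_introl erefl) (or_intror erefl).
  have h3 := H (x + l n.+1, y) (or_intror erefl) (or_introl erefl).
  have h4 := H (x + l n.+1, y + w n.+1) (or_intror erefl) (or_intror erefl).
  have : m n (x, y) <= m n.+1 (x, y) + m n.+1 (x, y + w n.+1) +
     (m n.+1 (x + l n.+1, y) + m n.+1 (x + l n.+1, y + w n.+1)).
    rewrite {1}/m /= M; apply: le_trans (ler_normD _ _) _.
    by rewrite lerD// ler_normD.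
  by lra.
have [F hF] := choice step.
pose s := fix s n := if n is n'.+1 then F (n', s n') else (a, c).
have s_good n : good n (s n).
  elim: n => [|n IH]; last by have [] := hF (n, s n) IH.
  by split=> //=; rewrite /l /w expr0 divr1 addrC subrK.
have s_step n : [/\ m n (s n) <= 4 * m n.+1 (s n.+1),
    (s n).1 <= (s n.+1).1 <= (s n).1 + l n.+1 & (s n).2 <= (s n.+1).2 <= (s n).2 + w n.+1].
  by have [_ ? ? ?] := hF (n, s n) (s_good n).
(* Nested intervals: as [k n] is twice [k n.+1], the right ends [u n + k n] decrease, and the limit
   of the left ends lies in every interval. *)
have lim_pt (u k : nat -> R) : (forall n, 0 <= k n) -> (forall n, k n = k n.+1 + k n.+1) ->
    (forall n, u n <= u n.+1 <= u n + k n.+1) -> exists x, forall n, u n <= x <= u n + k n.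
  move=> k0 kS uk.
  have nd : {homo u : n p / (n <= p)%N >-> n <= p}.
    by apply: homo_leq => [x|y x z|n]; [exact: lexx|exact: le_trans|case/andP: (uk n)].
  have uu n p : (n <= p)%N -> u p + k p <= u n + k n.
    move: n p; apply: (@homo_leq _ (fun n => u n + k n) (fun x y => y <= x)) => [x|y x z|n].
    - exact: lexx.
    - by move=> h1 h2; exact: le_trans h2 h1.
    - by have /andP[_] := uk n; rewrite (kS n); lra.
  have ub n p : u p <= u n + k n.
    have [np|/ltnW pn] := leqP n p.
      by apply: le_trans (uu _ _ np); rewrite lerDl.
    by apply: le_trans (nd _ _ pn) _; rewrite lerDl.
  have cu : cvgn u.
    by apply: nondecreasing_is_cvgn => //; exists (u 0%N + k 0%N) => _ [p _ <-].
  exists (limn u) => n; apply/andP; split.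
    by apply: limr_ge => //; near=> p; apply: nd; near: p; exists n.
  by apply: limr_le => //; near=> p.
have [x0 hx0] := lim_pt (fun n => (s n).1) l l0 lS (fun n => let: And3 _ h _ := s_step n in h).
have [y0 hy0] := lim_pt (fun n => (s n).2) w w0 wS (fun n => let: And3 _ _ h := s_step n in h).
have mn n : m 0%N (a, c) <= 4 ^+ n * m n (s n).
  elim: n => [|n IH]; first by rewrite expr0 mul1r.
  apply: le_trans IH _; rewrite exprSr -mulrA ler_wpM2l ?exprn_ge0//.
  by have [] := s_step n.
have x0ab : a <= x0 <= b.
  by have := hx0 0%N; rewrite /= /l expr0 divr1 addrC subrK.
have y0cd : c <= y0 <= d.
  by have := hy0 0%N; rewrite /= /w expr0 divr1 addrC subrK.
have : m 0%N (a, c) <= 0.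
  apply/ler_addgt0Pr => e e0; rewrite add0r.
  (* Sides are halved [n] times, so [4 ^+ n] times the square of the half perimeter is the constant
     [D]; the tolerance [e / (D + 1)] then gives a final bound of at most [e]. *)
  pose D := ((b - a) + (d - c)) ^+ 2; have D0 : 0 <= D by rewrite exprn_ge0// addr_ge0 ?subr_ge0.
  have D1 : 0 < D + 1 by lra.
  have [r r0 hr] := loc x0 y0 (e / (D + 1)) x0ab y0cd (divr_gt0 e0 D1).
  have kr (k : R) : \forall n \near \oo, k / 2 ^+ n < r.
    have : (k * (2^-1) ^+ n : R) @[n --> \oo] --> k * 0.
      by apply: cvgMl_tmp; apply: cvg_expr; rewrite ger0_norm; lra.
    rewrite mulr0 => /cvgr_lt /(_ r r0); apply: filterS => n.
    by rewrite exprVn.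
  near \oo => n.
  have lr : l n < r by near: n; exact: kr.
  have wr : w n < r by near: n; exact: kr.
  apply: le_trans (mn n) _.
  have [g1 g2 g3 g4] := s_good n; have /andP[a1 a2] := hx0 n; have /andP[a3 a4] := hy0 n.
  have := hr _ _ _ _ g1 a1 a2 g2 g3 a3 a4 g4.
  rewrite ![_ + _ - _]addrAC !subrr !add0r -/(m n (s n)) => /(_ lr wr) hm.
  apply: (@le_trans _ _ (4 ^+ n * (e / (D + 1) * (l n + w n) ^+ 2))).
    by rewrite ler_wpM2l// exprn_ge0.
  have -> : 4 ^+ n * (e / (D + 1) * (l n + w n) ^+ 2) = e / (D + 1) * D.
    have -> : (4 : R) ^+ n = (2 ^+ n) ^+ 2.
      by rewrite -exprM mulnC exprM; congr (_ ^+ n); ring.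
    rewrite /l /w -mulrDl exprMn -/D; set h : R := 2 ^+ n.
    have h0 : h != 0 by rewrite expf_neq0.
    by rewrite exprVn; field; rewrite h0 lt0r_neq0.
  by rewrite mulrAC ler_pdivrMr// ler_wpM2l ?(ltW e0)//; lra.
rewrite /m /= /l /w expr0 !divr1 ![_ + (_ - _)]addrC !subrK.
by rewrite normr_le0 => /eqP.
Unshelve. all: by end_near. Qed.

End Goursat.

(** * Goursat's theorem for closed differentiable forms on a rectangle *)

Section GoursatDiff.
Variable R : realType.

Lemma diff_eps (V W : normedModType R) (f : V -> W) (x : V) :
  differentiable f x -> forall e : R, 0 < e -> exists2 r : R, 0 < r &
    forall h, `|h| < r -> `|f (x + h) - f x - 'd f x h| <= e * `|h|.
Proof.
move=> /diff_locally/eqaddoP h e e0.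
have /nbhs_ballP[r r0 hr] := h e e0; exists r => // k kr.
have := hr k; rewrite -ball_normE /= sub0r normrN => /(_ kr).
by rewrite -[X in `|X|]/(f (k + x) - (f x + 'd f x k)) opprD addrA [k + x]addrC.
Qed.

(** The bound by [C] supplies the continuity of [df], on which the uniqueness of the differential
    rests. *)
Lemma eps_diff (V W : normedModType R) (f : V -> W) (df : {linear V -> W}) (x : V) (C : R) :
  (forall h, `|df h| <= C * `|h|) ->
  (forall e : R, 0 < e -> exists2 r : R, 0 < r &
    forall h, `|h| < r -> `|f (x + h) - f x - df h| <= e * `|h|) ->
  is_diff x f df.
Proof.
move=> dC h.
have cdf : continuous df.
  apply: bounded_linear_continuous; apply/linear_boundedP.
  by exists `|C|; split; [exact: num_real|move=> B CB v; apply: le_trans (dC v) _;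
    rewrite ler_wpM2r// ltW// (le_lt_trans (ler_norm _))].
have hf : f \o shift x = cst (f x) + df +o_ 0 id.
  apply/eqaddoP => e e0; have [r r0 hr] := h e e0.
  apply/nbhs_ballP; exists r => // k; rewrite -ball_normE /= sub0r normrN => /hr.
  by rewrite -[X in _ -> `|X| <= _]/(f (k + x) - (f x + df k)) opprD addrA [k + x]addrC.
have dE := diff_unique cdf hf.
by apply: DiffDef => //; apply/diff_locallyP; rewrite dE.
Qed.

Lemma cont_hline (P : R * R -> R) (x y : R) : differentiable P (x, y) ->
  {for x, continuous (fun u => P (u, y))}.
Proof.
move=> dP; apply: differentiable_continuous.
by apply: (@differentiable_comp _ _ _ _ (fun u : R => (u, y)) P).
Qed.

Lemma cont_vline (P : R * R -> R) (x y : R) : differentiable P (x, y) ->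
  {for y, continuous (fun v => P (x, v))}.
Proof.
move=> dP; apply: differentiable_continuous.
by apply: (@differentiable_comp _ _ _ _ (fun v : R => (x, v)) P).
Qed.

Lemma diff_box (P : R * R -> R) (x0 y0 e : R) : differentiable P (x0, y0) -> 0 < e ->
  exists2 r : R, 0 < r & forall x y z t u v, x <= x0 <= y -> z <= y0 <= t ->
    y - x < r -> t - z < r -> x <= u <= y -> z <= v <= t ->
    `|P (u, v) - P (x0, y0) - 'd P (x0, y0) (u - x0, v - y0)| <= e * ((y - x) + (t - z)).
Proof.
move=> dP e0; have [r r0 hr] := diff_eps dP e0; exists r => // x y z t u v.
move=> /andP[xx0 x0y] /andP[zy0 y0t] yx tz /andP[xu uy] /andP[zv vt].
have hu : `|u - x0| <= y - x by rewrite ler_norml; apply/andP; split; lra.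
have hv : `|v - y0| <= t - z by rewrite ler_norml; apply/andP; split; lra.
have -> : (u, v) = (x0, y0) + (u - x0, v - y0).
  by congr (_, _); rewrite /= addrC subrK.
have hn : `|(u - x0, v - y0) : R * R| = Num.max `|u - x0| `|v - y0| by rewrite prod_normE.
apply: le_trans (hr _ _) _.
  by rewrite hn gt_max (le_lt_trans hu yx) (le_lt_trans hv tz).
rewrite hn; apply: ler_wpM2l; first exact: ltW.
have := normr_ge0 (u - x0); have := normr_ge0 (v - y0) => ? ?.
by rewrite ge_max; apply/andP; split; lra.
Qed.

Lemma diff_snd_sub (P : R * R -> R) (p : R * R) (u v w : R) : differentiable P p ->
  'd P p (u, v) - 'd P p (u, w) = (v - w) * 'd P p (0, 1).
Proof.
move=> dP; rewrite -linearB -[RHS]/(_ *: _) -linearZ; congr ('d P _ _).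
by congr (_, _); rewrite /= ?subrr ?scaler0// -[RHS]/(_ * _) mulr1.
Qed.

Lemma diff_fst_sub (P : R * R -> R) (p : R * R) (u v w : R) : differentiable P p ->
  'd P p (v, u) - 'd P p (w, u) = (v - w) * 'd P p (1, 0).
Proof.
move=> dP; rewrite -linearB -[RHS]/(_ *: _) -linearZ; congr ('d P _ _).
by congr (_, _); rewrite /= ?subrr ?scaler0// -[RHS]/(_ * _) mulr1.
Qed.

Lemma cont_onB (f g : R -> R) x y : cont_on x y f -> cont_on x y g ->
  cont_on x y (fun u => f u - g u).
Proof. by move=> cf cg u xuy; apply: continuousB; [exact: cf|exact: cg]. Qed.

Lemma distB_le (a b a' b' c k : R) : `|a - c - a'| <= k -> `|b - c - b'| <= k ->
  `|a - b - (a' - b')| <= 2 * k.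
Proof. by rewrite !ler_norml => /andP[? ?] /andP[? ?]; apply/andP; split; lra. Qed.

(** This is the circulation of [P du + Q dv] around a rectangle. Partial derivatives may be
    discontinuous, which rules out differentiating under the integral; bisection asks only for a
    local bound. Once [P] and [Q] are linearized at the limit point, the two pairs of sides
    contribute opposite amounts, so only the linearization errors remain. *)
Theorem goursat (P Q : R * R -> R) (a b c d : R) : a <= b -> c <= d ->
  (forall x y, a <= x <= b -> c <= y <= d ->
     [/\ differentiable P (x, y), differentiable Q (x, y) &
         'd P (x, y) (0, 1) = 'd Q (x, y) (1, 0)]) ->
  Int a b (fun u => P (u, c) - P (u, d)) + Int c d (fun v => Q (b, v) - Q (a, v)) = 0.
Proof.
move=> ab cd h.
have cP y x z : a <= x -> z <= b -> c <= y <= d -> cont_on x z (fun u => P (u, y)).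
  move=> ax zb ycd u /andP[xu uz]; apply: cont_hline; have [] // := h u y.
  by rewrite (le_trans ax xu) (le_trans uz zb).
have cQ x y z : c <= y -> z <= d -> a <= x <= b -> cont_on y z (fun v => Q (x, v)).
  move=> cy zd xab v /andP[yv vz]; apply: cont_vline; have [] // := h x v.
  by rewrite (le_trans cy yv) (le_trans vz zd).
pose mu x y z t := Int x y (fun u => P (u, z) - P (u, t)) +
  Int z t (fun v => Q (y, v) - Q (x, v)).
apply: (additive_rect_eq0 (mu := mu) ab cd); rewrite /mu {mu}.
- move=> x m y z t ax xm my yb cz zt td.
  have am : a <= m := le_trans ax xm; have mb : m <= b := le_trans my yb.
  have zB : c <= z <= d by rewrite cz (le_trans zt td).
  have tB : c <= t <= d by rewrite td (le_trans cz zt).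
  have xB : a <= x <= b by rewrite ax (le_trans xm mb).
  have yB : a <= y <= b by rewrite yb (le_trans am my).
  have mB : a <= m <= b by rewrite am.
  rewrite (Int_split (m := m)) ?xm//; last by apply: cont_onB; apply: cP.
  have cQz w : a <= w <= b -> cont_on z t (fun v => Q (w, v)) by apply: cQ.
  rewrite (IntB (cQz _ yB) (cQz _ xB)) (IntB (cQz _ mB) (cQz _ xB)) (IntB (cQz _ yB) (cQz _ mB)).
  by ring.
- move=> x y z m t ax xy yb cz zm mt td.
  have cm : c <= m := le_trans cz zm; have md : m <= d := le_trans mt td.
  have xB : a <= x <= b by rewrite ax (le_trans xy yb).
  have yB : a <= y <= b by rewrite yb (le_trans ax xy).
  have zB : c <= z <= d by rewrite cz (le_trans zm md).
  have tB : c <= t <= d by rewrite td (le_trans cm mt).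
  have mB : c <= m <= d by rewrite cm.
  rewrite [Int z t _](Int_split (m := m)) ?zm//; last by apply: cont_onB; apply: cQ.
  have cPz w : c <= w <= d -> cont_on x y (fun u => P (u, w)) by apply: cP.
  rewrite (IntB (cPz _ zB) (cPz _ tB)) (IntB (cPz _ zB) (cPz _ mB)) (IntB (cPz _ mB) (cPz _ tB)).
  by ring.
move=> x0 y0 e x0ab y0cd e0; have [dP dQ dPQ] := h x0 y0 x0ab y0cd.
(* Halved because each integrand is a difference of two values and so carries two linearization
   errors. *)
have e20 : 0 < e / 2 by rewrite divr_gt0.
have [r1 r10 hr1] := diff_box dP e20.
have [r2 r20 hr2] := diff_box dQ e20.
exists (Num.min r1 r2); first by rewrite lt_min r10.
move=> x y z t ax xx0 x0y yb cz zy0 y0t td; rewrite !lt_min => /andP[yx1 yx2] /andP[tz1 tz2].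
have X : x <= x0 <= y by rewrite xx0.
have Y : z <= y0 <= t by rewrite zy0.
have {}hr1 u v := hr1 x y z t u v X Y yx1 tz1.
have {}hr2 u v := hr2 x y z t u v X Y yx2 tz2.
set S := (y - x) + (t - z) in hr1 hr2 *; set k := 'd P (x0, y0) (0, 1) in dPQ.
have xy : x <= y := le_trans xx0 x0y.
have zt : z <= t := le_trans zy0 y0t.
have zB : c <= z <= d by rewrite cz (le_trans zt td).
have tB : c <= t <= d by rewrite td (le_trans cz zt).
have xB : a <= x <= b by rewrite ax (le_trans xy yb).
have yB : a <= y <= b by rewrite yb (le_trans ax xy).
have I1 : `|Int x y (fun u => P (u, z) - P (u, t)) - (z - t) * k * (y - x)| <=
    2 * (e / 2 * S) * (y - x).
  apply: Int_near => [//||u xuy]; first by apply: cont_onB; exact: cP.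
  have -> : (z - t) * k = (z - y0 - (t - y0)) * k by congr (_ * k); ring.
  rewrite -(diff_snd_sub (u - x0))//; apply: distB_le; apply: hr1 => //.
    by rewrite lexx.
  by rewrite lexx zt.
have I2 : `|Int z t (fun v => Q (y, v) - Q (x, v)) - (y - x) * k * (t - z)| <=
    2 * (e / 2 * S) * (t - z).
  apply: Int_near => [//||v zvt]; first by apply: cont_onB; exact: cQ.
  have -> : (y - x) * k = (y - x0 - (x - x0)) * k by congr (_ * k); ring.
  rewrite dPQ -(diff_fst_sub (v - y0))//; apply: distB_le; apply: hr2 => //.
    by rewrite lexx xy.
  by rewrite lexx.
rewrite -[X in `|X + _|](subrK ((z - t) * k * (y - x))).
rewrite -[X in `|_ + X|](subrK ((y - x) * k * (t - z))) addrACA.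
have -> : (z - t) * k * (y - x) + (y - x) * k * (t - z) = 0 by ring.
rewrite addr0; apply: le_trans (ler_normD _ _) _; apply: le_trans (lerD I1 I2) _.
have -> : 2 * (e / 2 * S) = e * S by field.
by rewrite -mulrDr -/S expr2 mulrA.
Qed.

End GoursatDiff.

(** * Integrals of quaternion-valued functions *)

Section QuatIntegral.
Variable R : realType.
Local Notation H := (quat R).
Implicit Types (h g : R -> H) (p q u : H) (a b : R).

Lemma quat_cvgM (T : Type) (F : set_system T) (FF : Filter F) (f g : T -> H) (l m : H) :
  f @ F --> l -> g @ F --> m -> (f x * g x) @[x --> F] --> l * m.
Proof.
move=> /cvgrPdist_le fl /cvgrPdist_le gm; apply/cvgrPdist_le => e e0.
have k0 : 0 < 1 + `|l| + `|m| by rewrite -addrA ltr_pwDl// addr_ge0.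
pose d := Num.min 1 (e / (1 + `|l| + `|m|)).
have d0 : 0 < d by rewrite lt_min ltr01 divr_gt0.
near=> x; rewrite distrC.
have -> : f x * g x - l * m = (l - f x) * (m - g x) - l * (m - g x) - (l - f x) * m.
  by rewrite !mulrBl !mulrBr; apply: quat_eqP => /=; ring.
have fx : `|l - f x| <= d by near: x; exact: fl.
have gx : `|m - g x| <= d by near: x; exact: gm.
have d1 : d <= 1 by rewrite ge_min lexx.
have de : d * (1 + `|l| + `|m|) <= e by rewrite -ler_pdivlMr// ge_min lexx orbT.
apply: le_trans (ler_normB _ _) _; apply: le_trans (lerD (ler_normB _ _) (lexx _)) _.
rewrite !quat_normM; apply: le_trans de; rewrite !mulrDr mulr1.
apply: lerD; last by rewrite ler_wpM2r.
apply: lerD; last by rewrite mulrC ler_wpM2r.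
apply: (@le_trans _ _ (d * 1)); last by rewrite mulr1.
by apply: ler_pM => //; exact: le_trans gx d1.
Unshelve. all: by end_near. Qed.

Lemma q_re_cvg (T : Type) (F : set_system T) (FF : Filter F) (f : T -> H) (l : H) u :
  f @ F --> l -> q_re (u * f x) @[x --> F] --> q_re (u * l).
Proof.
move=> /cvgrPdist_le fl; apply/cvgrPdist_le => e e0.
have u0 : 0 < `|u| + 1 by rewrite ltr_wpDl.
near=> x.
have hx : `|l - f x| <= e / (`|u| + 1) by near: x; apply: fl; rewrite divr_gt0.
have -> : q_re (u * l) - q_re (u * f x) = q_re (u * (l - f x)) by rewrite /=; ring.
apply: le_trans (abs_q_re _) _; rewrite quat_normM.
apply: le_trans (ler_wpM2l (normr_ge0 u) hx) _.
by rewrite mulrA ler_pdivrMr// mulrC ler_wpM2l ?(ltW e0)// lerDl.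
Unshelve. all: by end_near. Qed.

(** Testing against [1], [-i], [-j], [-k] reads off the four components. Identities between
    quaternionic integrals thereby reduce to real integrals, with a free multiplier [u]. *)
Lemma q_re_mul_ext p q : (forall u, q_re (u * p) = q_re (u * q)) -> p = q.
Proof.
move=> h; apply: quat_eqP.
- by have := h 1; rewrite !mul1r.
- by have := h (Quat 0 (-1) 0 0); rewrite /=; lra.
- by have := h (Quat 0 0 (-1) 0); rewrite /=; lra.
- by have := h (Quat 0 0 0 (-1)); rewrite /=; lra.
Qed.

Lemma q_re_mulC p q : q_re (p * q) = q_re (q * p).
Proof. by rewrite /=; ring. Qed.

Definition qcont_on a b h := forall x, a <= x <= b -> {for x, continuous h}.

Lemma qcont_on_re a b h u : qcont_on a b h -> cont_on a b (fun x => q_re (u * h x)).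
Proof. by move=> ch x /ch; exact: q_re_cvg. Qed.

Lemma qcont_on_cst a b p : qcont_on a b (fun=> p).
Proof. by move=> x _; exact: cst_continuous. Qed.

Lemma qcont_onM a b h g : qcont_on a b h -> qcont_on a b g ->
  qcont_on a b (fun x => h x * g x).
Proof. by move=> ch cg x xab; apply: quat_cvgM; [exact: ch|exact: cg]. Qed.

Lemma qcont_onX a b h n : qcont_on a b h -> qcont_on a b (fun x => h x ^+ n).
Proof.
move=> ch; elim: n => [|n IH]; first exact: qcont_on_cst.
have -> : (fun x => h x ^+ n.+1) = (fun x => h x * h x ^+ n).
  by apply/funext => x; rewrite exprS.
exact: qcont_onM.
Qed.

Lemma qcont_onB a b h g : qcont_on a b h -> qcont_on a b g ->
  qcont_on a b (fun x => h x - g x).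
Proof. by move=> ch cg x xab; apply: cvgB; [exact: ch|exact: cg]. Qed.

Lemma qcont_onD a b h g : qcont_on a b h -> qcont_on a b g ->
  qcont_on a b (fun x => h x + g x).
Proof. by move=> ch cg x xab; apply: cvgD; [exact: ch|exact: cg]. Qed.

Lemma qcont_on_slice a b (I : H) (f g : R -> R) : cont_on a b f -> cont_on a b g ->
  qcont_on a b (fun x => slice_pt I (f x, g x)).
Proof.
move=> cf cg x xab; apply: cvgD; apply: cvgZr_tmp; [exact: cf|exact: cg].
Qed.

Definition qInt a b h : H :=
  Quat (Int a b (fun x => q_re (h x))) (Int a b (fun x => q_i (h x)))
       (Int a b (fun x => q_j (h x))) (Int a b (fun x => q_k (h x))).

Lemma q_re_qInt a b h u : qcont_on a b h ->
  q_re (u * qInt a b h) = Int a b (fun x => q_re (u * h x)).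
Proof.
move=> ch; have c p := @qcont_on_re a b h p ch.
have c0 : cont_on a b (fun x => q_re (h x)).
  by have := c 1; under [X in cont_on _ _ X]eq_fun do rewrite mul1r.
have c1 : cont_on a b (fun x => q_i (h x)).
  have := c (Quat 0 (-1) 0 0); congr cont_on; apply/funext => x /=; ring.
have c2 : cont_on a b (fun x => q_j (h x)).
  have := c (Quat 0 0 (-1) 0); congr cont_on; apply/funext => x /=; ring.
have c3 : cont_on a b (fun x => q_k (h x)).
  have := c (Quat 0 0 0 (-1)); congr cont_on; apply/funext => x /=; ring.
have cZ (k : R) f : cont_on a b f -> cont_on a b (fun x => k * f x).
  by move=> cf x /cf; exact: cvgMl_tmp.
have cB (f g : R -> R) : cont_on a b f -> cont_on a b g -> cont_on a b (fun x => f x - g x).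
  by move=> cf cg x xab; apply: cvgB; [exact: cf|exact: cg].
rewrite -[RHS]/(Int a b (fun x => q_re u * q_re (h x) - q_i u * q_i (h x)
  - q_j u * q_j (h x) - q_k u * q_k (h x))).
rewrite IntB; [|by apply: (cB); [apply: (cB); exact: (cZ)|exact: (cZ)]|exact: (cZ)].
rewrite IntB; [|by apply: (cB); exact: (cZ)|exact: (cZ)].
by rewrite IntB; [|exact: (cZ)..]; rewrite !IntZ.
Qed.

Lemma qIntD a b h g : qcont_on a b h -> qcont_on a b g ->
  qInt a b (fun x => h x + g x) = qInt a b h + qInt a b g.
Proof.
move=> ch cg; apply: q_re_mul_ext => u.
rewrite q_re_qInt; last exact: qcont_onD.
under eq_Int do rewrite mulrDr; rewrite mulrDr -[RHS]/(q_re _ + q_re _) !q_re_qInt//.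
by rewrite -IntD//; exact: qcont_on_re.
Qed.

Lemma qIntMl a b h p : qcont_on a b h -> qInt a b (fun x => p * h x) = p * qInt a b h.
Proof.
move=> ch; apply: q_re_mul_ext => u.
rewrite q_re_qInt; last exact: (qcont_onM (@qcont_on_cst a b p)).
by under eq_Int do rewrite mulrA; rewrite mulrA q_re_qInt.
Qed.

Lemma qIntMr a b h p : qcont_on a b h -> qInt a b (fun x => h x * p) = qInt a b h * p.
Proof.
move=> ch; apply: q_re_mul_ext => u.
rewrite q_re_qInt; last exact: (qcont_onM ch (@qcont_on_cst a b p)).
under eq_Int do rewrite mulrA q_re_mulC mulrA.
by rewrite mulrA q_re_mulC mulrA q_re_qInt.
Qed.

(** Pair with the conjugate of the integral [v] itself: [|v| ^+ 2] is the integral of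
    [q_re (qconj v * h x)], at most [|v| * C * (b - a)]. No constant is lost to componentwise
    bounds. *)
Lemma qInt_norm_le a b h C : a <= b -> qcont_on a b h ->
  (forall x, a <= x <= b -> `|h x| <= C) -> `|qInt a b h| <= C * (b - a).
Proof.
move=> ab ch hC; set v := qInt a b h.
have [->|v0] := eqVneq v 0.
  rewrite normr0 mulr_ge0 ?subr_ge0//; apply: le_trans (hC a _); first exact: normr_ge0.
  by rewrite lexx ab.
have vp : 0 < `|v| by rewrite normr_gt0.
rewrite -(ler_pM2l vp); have -> : `|v| * `|v| = q_re (qconj v * v).
  by rewrite mul_conjq -expr2 /= mulr1.
rewrite q_re_qInt// mulrA; apply: le_trans (ler_norm _) _.
apply: Int_norm_le => //; first exact: qcont_on_re.
move=> x /hC hx; apply: le_trans (abs_q_re _) _.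
by rewrite quat_normM quat_norm_conj ler_wpM2l.
Qed.

Lemma qInt_sum a b n (h : nat -> R -> H) : (forall k, qcont_on a b (h k)) ->
  qInt a b (fun x => \sum_(0 <= k < n) h k x) = \sum_(0 <= k < n) qInt a b (h k)
  /\ qcont_on a b (fun x => \sum_(0 <= k < n) h k x).
Proof.
move=> ch; elim: n => [|n [IH IHc]].
  under eq_fun do rewrite big_nil; rewrite big_nil; split; last exact: qcont_on_cst.
  by under [X in qInt _ _ X]eq_fun do rewrite -(mul0r (0 : H)); rewrite qIntMl ?mul0r//; exact: qcont_on_cst.
under eq_fun do rewrite big_nat_recr//=; rewrite big_nat_recr//=.
by split; [rewrite qIntD// IH|exact: qcont_onD].
Qed.

End QuatIntegral.

(** * Cauchy's formula on the circles of a slice *)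

Section CircleFormula.
Variable R : realType.
Local Notation H := (quat R).

Lemma is_derive_curve (G : R * R -> R) (g1 g2 : R -> R) (s d1 d2 : R) :
  is_derive s 1 g1 d1 -> is_derive s 1 g2 d2 -> differentiable G (g1 s, g2 s) ->
  is_derive s 1 (fun x => G (g1 x, g2 x)) ('d G (g1 s, g2 s) (d1, d2)).
Proof.
move=> h1 h2 dG.
have dg1 : differentiable g1 s by apply/derivable1_diffP.
have dg2 : differentiable g2 s by apply/derivable1_diffP.
have dg : differentiable (fun x => (g1 x, g2 x)) s by exact: differentiable_pair.
have dc : differentiable (G \o (fun x => (g1 x, g2 x))) s by exact: differentiable_comp.
apply: DeriveDef; first exact/derivable1_diffP.
rewrite -[X in 'D_1 X s]/(G \o (fun x => (g1 x, g2 x))).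
rewrite deriveE// diff_comp//= diff_pair//=; congr ('d G _ (_, _)).
- by rewrite -deriveE// derive_val.
- by rewrite -deriveE// derive_val.
Qed.

Lemma diff_snd_dir (P : R * R -> R) (x y : R) : differentiable P (x, y) ->
  'd P (x, y) (0, 1) = 'D_1 (fun v => P (x, v)) y.
Proof.
by move=> dP; rewrite (derive_val (is_derive := is_derive_curve (is_derive_cst x y 1)
  (is_derive_id y 1) dP)).
Qed.

Lemma diff_fst_dir (P : R * R -> R) (x y : R) : differentiable P (x, y) ->
  'd P (x, y) (1, 0) = 'D_1 (fun v => P (v, y)) x.
Proof.
by move=> dP; rewrite (derive_val (is_derive := is_derive_curve (is_derive_id x 1)
  (is_derive_cst y x 1) dP)).
Qed.

Lemma differentiable_fst2 (p : R * R) : differentiable (fst : R * R -> R) p.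
Proof. by apply: linear_differentiable => ?; apply: cvg_fst. Qed.

Lemma differentiable_snd2 (p : R * R) : differentiable (snd : R * R -> R) p.
Proof. by apply: linear_differentiable => ?; apply: cvg_snd. Qed.

Section WithF.
Variables (I : H) (I2 : I ^+ 2 = -1) (F : R * R -> H).

(** Cauchy-Riemann equations with [I] acting from the left, so that the differential along [v] is
    [slice_pt I v] times one quaternion, the slice derivative. *)
Definition hol := forall w : R * R, w.1 ^+ 2 + w.2 ^+ 2 < 1 ->
  differentiable F w /\ 'd F w (0, 1) = I * 'd F w (1, 0).

Hypothesis holF : hol.

Lemma hol_diff (w v : R * R) : w.1 ^+ 2 + w.2 ^+ 2 < 1 ->
  'd F w v = slice_pt I v * 'd F w (1, 0).
Proof.
case: v => a b /holF[_ h]; have e : (a, b) = a *: (1, 0) + b *: (0, 1) :> R * R.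
  apply: injective_projections; rewrite /= ?scaler0 ?addr0 ?add0r.
    by rewrite -[RHS]/(_ * _) mulr1.
  by rewrite -[RHS]/(_ * _) mulr1.
by rewrite [in LHS]e linearD !linearZ /= h /slice_pt /= mulrDl mulr_algl -scalerAl.
Qed.

Definition Gre (u : H) (w : R * R) : R := q_re (u * F w).

Definition re_mul (u : H) (x : H) : R := q_re (u * x).

Fact re_mul_linear u : linear (re_mul u).
Proof. by move=> a x y; rewrite /re_mul /= -[_ *: _ : R]/(_ * _); ring. Qed.

Lemma Gre_diff u (w : R * R) : w.1 ^+ 2 + w.2 ^+ 2 < 1 ->
  differentiable (Gre u) w /\
  forall v, 'd (Gre u) w v = q_re (u * (slice_pt I v * 'd F w (1, 0))).
Proof.
move=> wB; have [dF _] := holF wB.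
pose lM := GRing.isLinear.Build _ _ _ _ _ (re_mul_linear u).
pose L : {linear H -> R} := HB.pack (re_mul u) lM.
have cL : continuous L by move=> x; apply: (@q_re_cvg _ _ (nbhs x) _ id x u).
have dL : differentiable L (F w) by exact: linear_differentiable.
split; first exact: (@differentiable_comp _ _ _ _ F L w).
move=> v; rewrite -[Gre u]/(L \o F) diff_comp// -[LHS]/('d L (F w) ('d F w v)).
by rewrite diff_lin// hol_diff.
Qed.

Lemma slice_ptE (a b : R) : slice_pt I (a, b) = a%:A + b *: I. Proof. by []. Qed.

Lemma slice_ptI (a b t : R) :
  slice_pt I (- (t * b), t * a) = t *: (I * slice_pt I (a, b)).
Proof.
have e : I * slice_pt I (a, b) = - (b%:A) + a *: I.
  by rewrite slice_ptE mulrDr -!scalerAr -expr2 I2 mulr1 scalerN addrC.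
by rewrite e scalerDr scalerN !scalerA slice_ptE scaleNr.
Qed.

Lemma slice_mul (a b : R) (x : H) : slice_pt I (a, b) * x = a *: x + b *: (I * x).
Proof. by rewrite /slice_pt /= mulrDl mulr_algl -scalerAl. Qed.

Lemma slice_ptM (v w : R * R) : slice_pt I v * slice_pt I w =
  slice_pt I (v.1 * w.1 - v.2 * w.2, v.1 * w.2 + v.2 * w.1).
Proof.
have [] := imag_unitP I2; case: I => e0 e1 e2 e3 /= -> h.
apply: quat_eqP; rewrite /=; [|ring..].
transitivity (v.1 * w.1 - v.2 * w.2 * (e1 ^+ 2 + e2 ^+ 2 + e3 ^+ 2)); first by ring.
by rewrite h; ring.
Qed.

Section Circle.
Variables (z : R * R) (rho : R).
Hypotheses (rho01 : 0 < rho < 1) (zr : z.1 ^+ 2 + z.2 ^+ 2 < rho ^+ 2).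

Definition cpt (v : R) : R * R := (rho * cos v, rho * sin v).
Let d1 v := rho * cos v - z.1.
Let d2 v := rho * sin v - z.2.
Let N v := d1 v ^+ 2 + d2 v ^+ 2.
(** For the circle point [w], [k1] and [k2] are the real and the [I] component of [w] times the
    conjugate of [w - z], divided by [|w - z| ^+ 2]. *)
Let k1 v := (rho * cos v * d1 v + rho * sin v * d2 v) / N v.
Let k2 v := (rho * sin v * d1 v - rho * cos v * d2 v) / N v.

(* The Cauchy kernel [w / (w - z)] at the point [w] of the circle. *)
Definition ckernel v : H := slice_pt I (k1 v, k2 v).

Let trig v : (rho * cos v) ^+ 2 + (rho * sin v) ^+ 2 = rho ^+ 2.
Proof. by have := cos2Dsin2 v; nra. Qed.

Let N0 v : N v != 0.
Proof.
rewrite /N paddr_eq0 ?sqr_ge0// !sqrf_eq0 !subr_eq0; apply/negP => /andP[/eqP e1 /eqP e2].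
by have := trig v; have := zr; rewrite e1 e2 => ? ?; lra.
Qed.

Lemma ckernelE v : ckernel v * (slice_pt I (cpt v) - slice_pt I z) = slice_pt I (cpt v).
Proof.
have -> : slice_pt I (cpt v) - slice_pt I z = slice_pt I (d1 v, d2 v).
  by rewrite /slice_pt /= !scalerBl opprD addrACA.
have n0 := N0 v.
rewrite slice_ptM /=; congr slice_pt; congr (_, _); rewrite /k1 /k2.
- by rewrite /N in n0 *; field.
- by rewrite /N in n0 *; field.
Qed.

Let zeta (p : R * R) : R * R := (z.1 + p.1 * d1 p.2, z.2 + p.1 * d2 p.2).

Let zeta_ball (t v : R) : 0 <= t <= 1 -> (zeta (t, v)).1 ^+ 2 + (zeta (t, v)).2 ^+ 2 < 1.
Proof.
move=> /andP[t0 t1]; rewrite /zeta /d1 /d2 /=; have := trig v; have := zr.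
move: (rho * cos v) (rho * sin v) => A B h1 h2.
have h3 : 0 <= t * (1 - t) * ((A - z.1) ^+ 2 + (B - z.2) ^+ 2).
  by rewrite mulr_ge0 ?mulr_ge0 ?subr_ge0// addr_ge0 ?sqr_ge0.
have h4 : rho ^+ 2 < 1 by case/andP: rho01 => r0 r1; rewrite expr_lt1// ltW.
have h5 : (1 - t) * (z.1 ^+ 2 + z.2 ^+ 2) <= (1 - t) * rho ^+ 2.
  by rewrite ler_wpM2l ?subr_ge0// ltW.
have -> : (z.1 + t * (A - z.1)) ^+ 2 + (z.2 + t * (B - z.2)) ^+ 2 =
   (1 - t) * (z.1 ^+ 2 + z.2 ^+ 2) + t * (A ^+ 2 + B ^+ 2)
   - t * (1 - t) * ((A - z.1) ^+ 2 + (B - z.2) ^+ 2) by ring.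
by rewrite h2; nra.
Qed.

Let dd1 (v : R) : is_derive v 1 d1 (- (rho * sin v)).
Proof. by apply: trigger_derive; rewrite /GRing.scale /=; ring. Qed.
Let dd2 (v : R) : is_derive v 1 d2 (rho * cos v).
Proof. by apply: trigger_derive; rewrite /GRing.scale /=; ring. Qed.

Let diff_snd (g : R -> R) (p : R * R) : derivable g p.2 1 -> differentiable (fun p : R * R => g p.2) p.
Proof.
move=> dg; apply: (@differentiable_comp _ _ _ _ snd g); first exact: differentiable_snd2.
exact/derivable1_diffP.
Qed.

Let dk1 (v : R) : derivable k1 v 1.
Proof.
by apply: ex_derive; apply: trigger_derive.
Qed.

Let dk2 (v : R) : derivable k2 v 1.
Proof.
by apply: ex_derive; apply: trigger_derive.
Qed.

(** Subtracting the value at [z] makes the integrand vanish in the limit when the circle is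
    contracted to [z]. *)
Let Gc u w := Gre u w - Gre u z.

Let dGc u (w : R * R) : w.1 ^+ 2 + w.2 ^+ 2 < 1 ->
  differentiable (Gc u) w /\ forall v, 'd (Gc u) w v = 'd (Gre u) w v.
Proof.
move=> wB; have [dG _] := Gre_diff u wB.
rewrite -[Gc u]/(Gre u - cst (Gre u z)); split; first exact: differentiableB.
by move=> v; rewrite diffB//= diff_cst subr0.
Qed.

Let dzeta (p : R * R) : differentiable zeta p.
Proof.
have D g : (forall v : R, derivable g v 1) -> differentiable (fun p : R * R => p.1 * g p.2) p.
  move=> dg; apply: differentiableM; first exact: differentiable_fst2.
  by apply: diff_snd; exact: dg.
apply: differentiable_pair; apply: differentiableD => //; apply: D => v.
- by have := dd1 v => ?; exact: ex_derive.
- by have := dd2 v => ?; exact: ex_derive.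
Qed.

(** Along the homotopy, [d zeta / (zeta - z) = dt / t + I * ckernel v * dv], because the circle
    point [w] moves with velocity [I * w]. Multiplying this by [- I], letting it act from the left
    on [F - F z], and taking the real part after a further multiplication by [u], gives the form
    [P dt + Q dv]. *)
Let P u (p : R * R) : R := - p.1^-1 * Gc (u * I) (zeta p).
Let Q u (p : R * R) : R := k1 p.2 * Gc u (zeta p) + k2 p.2 * Gc (u * I) (zeta p).

(** Both partial derivatives equal the real part of [u * slice_pt I (cpt v) * c], with [c] the slice
    derivative of [F] at [zeta (t, v)]: for [P] because the factors [t] cancel and [I ^+ 2 = -1],
    for [Q] by [ckernelE]. *)
Let dPQ u (t v : R) : 0 < t <= 1 ->
  [/\ differentiable (P u) (t, v), differentiable (Q u) (t, v) &
      'd (P u) (t, v) (0, 1) = 'd (Q u) (t, v) (1, 0)].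
Proof.
move=> /andP[t0 t1]; have tB : 0 <= t <= 1 by rewrite ltW.
have wB := zeta_ball v tB; set w := zeta (t, v) in wB.
have tn0 : t != 0 by rewrite gt_eqF.
have dG u' : differentiable (fun p => Gc u' (zeta p)) (t, v).
  apply: (@differentiable_comp _ _ _ _ zeta (Gc u')); first exact: dzeta.
  by have [] := dGc u' wB.
have dP : differentiable (P u) (t, v).
  apply: differentiableM => //; apply: differentiableN; apply: differentiableV => //.
  exact: differentiable_fst2.
have dQ : differentiable (Q u) (t, v).
  apply: differentiableD; apply: differentiableM => //; exact: diff_snd.
split=> //; rewrite diff_snd_dir// diff_fst_dir//.
pose c := 'd F w (1, 0).
have HG u' a b : 'd (Gc u') w (a, b) = q_re (u' * (slice_pt I (a, b) * c)).
  by have [_ ->] := dGc u' wB; have [_ ->] := Gre_diff u' wB.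
have E1 : is_derive v 1 (fun v => P u (t, v))
    (- t^-1 * 'd (Gc (u * I)) w (- (t * (rho * sin v)), t * (rho * cos v))).
  have h1 : is_derive v 1 (fun v => z.1 + t * d1 v) (- (t * (rho * sin v))).
    by apply: trigger_derive; rewrite /GRing.scale /=; ring.
  have h2 : is_derive v 1 (fun v => z.2 + t * d2 v) (t * (rho * cos v)).
    by apply: trigger_derive; rewrite /GRing.scale /=; ring.
  have [dGw _] := dGc (u * I) wB.
  exact: (is_deriveZ (- t^-1) (is_derive_curve h1 h2 dGw)).
have E2 : is_derive t 1 (fun t => Q u (t, v))
    (k1 v * 'd (Gc u) w (d1 v, d2 v) + k2 v * 'd (Gc (u * I)) w (d1 v, d2 v)).
  have h1 : is_derive t 1 (fun t => z.1 + t * d1 v) (d1 v).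
    by apply: trigger_derive; rewrite /GRing.scale /=; ring.
  have h2 : is_derive t 1 (fun t => z.2 + t * d2 v) (d2 v).
    by apply: trigger_derive; rewrite /GRing.scale /=; ring.
  have [dGw _] := dGc u wB.
  have [dGw' _] := dGc (u * I) wB.
  exact: (is_deriveD (is_deriveZ (k1 v) (is_derive_curve h1 h2 dGw))
    (is_deriveZ (k2 v) (is_derive_curve h1 h2 dGw'))).
rewrite (derive_val (is_derive := E1)) (derive_val (is_derive := E2)) !HG.
have -> : k1 v * q_re (u * (slice_pt I (d1 v, d2 v) * c)) +
    k2 v * q_re (u * I * (slice_pt I (d1 v, d2 v) * c)) =
    q_re (u * (ckernel v * slice_pt I (d1 v, d2 v) * c)).
  rewrite /ckernel -[slice_pt I (k1 v, k2 v) * _ * c]mulrA.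
  move: (slice_pt I (d1 v, d2 v) * c) => X.
  rewrite slice_mul.
  have -> : u * (k1 v *: X + k2 v *: (I * X)) = k1 v *: (u * X) + k2 v *: (u * I * X).
    by rewrite mulrDr -!scalerAr mulrA.
  by [].
have -> : slice_pt I (d1 v, d2 v) = slice_pt I (cpt v) - slice_pt I z.
  by rewrite /slice_pt /= !scalerBl opprD addrACA.
rewrite ckernelE.
have -> : slice_pt I (- (t * (rho * sin v)), t * (rho * cos v)) =
    t *: (I * slice_pt I (cpt v)).
  exact: slice_ptI.
have -> : u * I * (t *: (I * slice_pt I (cpt v)) * c) = - t *: (u * (slice_pt I (cpt v) * c)).
  rewrite -scalerAl -scalerAr scaleNr -scalerN; congr (_ *: _).
  by rewrite -!mulrA (mulrA I I) -expr2 I2 mulN1r mulrN.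
move: (u * (slice_pt I (cpt v) * c)) => y.
by rewrite -[q_re (_ *: y)]/(- t * q_re y) mulrA mulrNN mulVf// mul1r.
Qed.

Let QE u p : Q u p = q_re (u * (ckernel p.2 * (F (zeta p) - F z))).
Proof.
rewrite /ckernel slice_mul /Q /Gc /Gre; move: (F (zeta p)) (F z) => x y.
have -> : u * (k1 p.2 *: (x - y) + k2 p.2 *: (I * (x - y))) =
    k1 p.2 *: (u * x - u * y) + k2 p.2 *: (u * I * x - u * I * y).
  by rewrite mulrDr -!scalerAr mulrA !mulrBr.
by [].
Qed.

(** In [goursat], with the angle running from [- pi] to [pi], the two [P] sides cancel because
    [zeta] takes the same values at both ends. *)
Let Q_indep u (t : R) : 0 < t <= 1 ->
  Int (- pi) pi (fun v => Q u (1, v)) = Int (- pi) pi (fun v => Q u (t, v)).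
Proof.
move=> /andP[t0 t1]; have pi0 := pi_gt0 R.
have pp : - pi <= pi :> R by lra.
have hPQ x v : t <= x <= 1 -> - pi <= v <= pi ->
     [/\ differentiable (P u) (x, v), differentiable (Q u) (x, v) &
         'd (P u) (x, v) (0, 1) = 'd (Q u) (x, v) (1, 0)].
  by move=> /andP[tx x1] _; apply: dPQ; rewrite x1 (lt_le_trans t0 tx).
have := goursat t1 pp hPQ.
have -> : (fun x => P u (x, - pi) - P u (x, pi)) = (fun=> 0).
  apply/funext => x; have -> : P u (x, - pi) = P u (x, pi); last by rewrite subrr.
  rewrite /P; congr (_ * Gc _ _).
  by rewrite /zeta /d1 /d2 /= cosN sinN sinpi oppr0.
rewrite Int_cst// mul0r add0r IntB; first by move/eqP; rewrite subr_eq0 => /eqP.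
- by move=> v _; apply: cont_vline; have [] := @dPQ u 1 v; rewrite ?lexx ?ltr01.
- by move=> v _; apply: cont_vline; have [] := @dPQ u t v; rewrite ?t0.
Qed.

Lemma norm_cpt v : `|slice_pt I (cpt v)| = rho.
Proof.
case/andP: rho01 => r0 _.
by apply/eqP; rewrite -(@eqrXn2 _ 2) ?(ltW r0)// sqr_norm_slice// trig.
Qed.

Lemma norm_center : `|slice_pt I z| < rho.
Proof.
case/andP: rho01 => r0 _.
by rewrite -(@ltr_pXn2r _ 2) ?nnegrE ?(ltW r0)// sqr_norm_slice.
Qed.

Lemma norm_ckernel v : `|ckernel v| <= rho / (rho - `|slice_pt I z|).
Proof.
have h := norm_center; rewrite ler_pdivlMr ?subr_gt0//.
rewrite -[leRHS](norm_cpt v) -(ckernelE v) quat_normM ler_wpM2l//.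
by rewrite -(norm_cpt v) lerB_dist.
Qed.

Lemma cont_ckernel a b : qcont_on a b ckernel.
Proof.
apply: qcont_on_slice => v _; apply: differentiable_continuous; apply/derivable1_diffP.
- exact: dk1.
- exact: dk2.
Qed.

Lemma cpt_ball v : (cpt v).1 ^+ 2 + (cpt v).2 ^+ 2 < 1.
Proof. by rewrite /= trig; case/andP: rho01 => r0 r1; rewrite expr_lt1// ltW. Qed.

Lemma cont_F_cpt a b : qcont_on a b (fun v => F (cpt v)).
Proof.
move=> v _; apply: differentiable_continuous.
apply: (@differentiable_comp _ _ _ _ cpt F); last by have [] := holF (cpt_ball v).
by apply: differentiable_pair; apply/derivable1_diffP; exact: derivableM.
Qed.

(** The integral is that of [Q] at [t = 1], hence at every [t] in []0, 1]]; as [t] tends to 0 the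
    integrand goes to zero uniformly, by continuity of [F] at [z]. *)
Lemma circle_integral0 : qInt (- pi) pi (fun v => ckernel v * (F (cpt v) - F z)) = 0.
Proof.
have pi0 := pi_gt0 R; have pp : - pi <= pi :> R by lra.
apply: q_re_mul_ext => u; rewrite mulr0 q_re_qInt; last first.
  apply: qcont_onM; first exact: cont_ckernel.
  by apply: qcont_onB; [exact: cont_F_cpt|exact: qcont_on_cst].
have -> : Int (- pi) pi (fun v => q_re (u * (ckernel v * (F (cpt v) - F z)))) =
    Int (- pi) pi (fun v => Q u (1, v)).
  have z1v v : zeta (1, v) = cpt v.
    by rewrite /cpt /zeta /d1 /d2 /= !mul1r ![_ + (_ - _)]addrC !subrK.
  by apply: eq_Int => v _; rewrite QE z1v.
have rz := norm_center.
have zB : z.1 ^+ 2 + z.2 ^+ 2 < 1.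
  by apply: lt_trans zr _; case/andP: rho01 => r0 r1; rewrite expr_lt1// ltW.
apply/eqP; rewrite -normr_le0; apply/ler_addgt0Pr => e e0; rewrite add0r.
pose C := `|u| * (rho / (rho - `|slice_pt I z|)) * (pi - - pi).
have C0 : 0 <= C.
  rewrite mulr_ge0 ?subr_ge0// mulr_ge0// divr_ge0 ?subr_ge0 ?(ltW rz)//.
  by case/andP: rho01 => r0 _; rewrite ltW.
have C1 : 0 < C + 1 by lra.
have e1 : 0 < e / (C + 1) by rewrite divr_gt0.
have [dF _] := holF zB.
have /cvgrPdist_le /(_ _ e1) /nbhs_ballP[r r0 hr] := differentiable_continuous dF.
(* Each coordinate of [zeta (t, v)] is within [2 * t], hence within [r / 2], of that of [z]. *)
pose t := Num.min 1 (r / 4).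
have t01 : 0 < t <= 1 by rewrite lt_min ltr01 divr_gt0//= ge_min lexx.
have tr : t <= r / 4 by rewrite ge_min lexx orbT.
rewrite (Q_indep u t01).
have Qb v : `|Q u (t, v)| <= `|u| * (rho / (rho - `|slice_pt I z|)) * (e / (C + 1)).
  rewrite QE; apply: le_trans (abs_q_re _) _; rewrite !quat_normM mulrA.
  apply: ler_pM => //.
  by rewrite ler_wpM2l// norm_ckernel.
  rewrite distrC; apply: hr; rewrite -ball_normE /= prod_normE /= gt_max.
  have Db (a b : R) : -1 <= a <= 1 -> b ^+ 2 < 1 -> `|b - (b + t * (rho * a - b))| < r.
    move=> /andP[a1 a2] b1; case/andP: t01 => t0 _; case/andP: rho01 => ? ?.
    rewrite opprD addrA subrr add0r normrN normrM (gtr0_norm t0).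
    have : `|rho * a - b| <= 2.
      apply: le_trans (ler_normB _ _) _; rewrite normrM (_ : 2 = 1 + 1)//.
      apply: lerD; first by rewrite mulr_ile1// ler_norml; lra.
      by rewrite -(@expr_le1 _ 2)// real_normK ?num_real// ltW.
    by move=> h; apply: (@le_lt_trans _ _ (t * 2)); [rewrite ler_wpM2l// ltW|lra].
  by rewrite /zeta /d1 /d2 /= !Db// ?cos_geN1 ?cos_le1 ?sin_geN1 ?sin_le1//; nra.
apply: le_trans (Int_norm_le pp _ (fun v _ => Qb v)) _.
  by move=> v _; apply: cont_vline; have [] := @dPQ u t v.
rewrite mulrAC -/C mulrA ler_pdivrMr// mulrC ler_wpM2l ?(ltW e0)//; lra.
Qed.

End Circle.
End WithF.
End CircleFormula.

(** * Taylor expansion on one slice *)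

Section CauchyExpansion.
Variable R : realType.
Local Notation H := (quat R).

Lemma Int_cos (k : nat) : (0 < k)%N -> Int (- pi) pi (fun v : R => cos (k%:R * v)) = 0.
Proof.
move=> k0; have kn : (k%:R : R) != 0 by rewrite pnatr_eq0 -lt0n.
have pi0 := pi_gt0 R.
have d (v : R) : is_derive v 1 (fun v => sin (k%:R * v) / k%:R) (cos (k%:R * v)).
  by apply: trigger_derive; rewrite /GRing.scale /=; field.
have c : continuous (fun v : R => sin (k%:R * v) / k%:R).
  by move=> v; apply: differentiable_continuous; apply/derivable1_diffP; exact: ex_derive.
rewrite /Int /Rintegral.
rewrite (@continuous_FTC2 _ _ (fun v => sin (k%:R * v) / k%:R)) /=; last first.
- by move=> v _; rewrite derive1E; exact: derive_val.
- by split=> [v _||]; [exact: ex_derive|apply: cvg_at_right_filter; exact: c|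
    apply: cvg_at_left_filter; exact: c].
- apply: continuous_subspaceT => v; apply: differentiable_continuous.
  by apply/derivable1_diffP; apply: ex_derive; apply: trigger_derive.
- by lra.
have sk : sin (k%:R * pi : R) = 0.
  by clear; elim: k => [|k IH]; rewrite ?mul0r ?sin0// -natr1 mulrDl mul1r sinDpi IH oppr0.
by rewrite mulrN sinN sk oppr0 mul0r subr0.
Qed.

Lemma Int_sin (k : nat) : (0 < k)%N -> Int (- pi) pi (fun v : R => sin (k%:R * v)) = 0.
Proof.
move=> k0; have kn : (k%:R : R) != 0 by rewrite pnatr_eq0 -lt0n.
have pi0 := pi_gt0 R.
have d (v : R) : is_derive v 1 (fun v => - (cos (k%:R * v) / k%:R)) (sin (k%:R * v)).
  by apply: trigger_derive; rewrite /GRing.scale /=; field.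
have c : continuous (fun v : R => - (cos (k%:R * v) / k%:R)).
  by move=> v; apply: differentiable_continuous; apply/derivable1_diffP; exact: ex_derive.
rewrite /Int /Rintegral.
rewrite (@continuous_FTC2 _ _ (fun v => - (cos (k%:R * v) / k%:R))) /=; last first.
- by move=> v _; rewrite derive1E; exact: derive_val.
- by split=> [v _||]; [exact: ex_derive|apply: cvg_at_right_filter; exact: c|
    apply: cvg_at_left_filter; exact: c].
- apply: continuous_subspaceT => v; apply: differentiable_continuous.
  by apply/derivable1_diffP; apply: ex_derive; apply: trigger_derive.
- by lra.
by rewrite mulrN cosN subrr.
Qed.

Section WithI.
Variables (I : H) (I2 : I ^+ 2 = -1).

(** This is [exp (- I * v)]; divided by [rho], it inverts the circle point. *)
Definition conj_unit (v : R) : H := slice_pt I (cos v, - sin v).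

Lemma conj_unitX v k : conj_unit v ^+ k = slice_pt I (cos (k%:R * v), - sin (k%:R * v)).
Proof.
elim: k => [|k IH]; first by rewrite mul0r cos0 sin0 oppr0 expr0 slice_ptE scale0r addr0 scale1r.
rewrite exprS IH slice_ptM//=; congr slice_pt; rewrite -natr1 mulrDl mul1r cosD sinD.
by congr (_, _); ring.
Qed.

Lemma norm_conj_unit v : `|conj_unit v| = 1.
Proof.
apply/eqP; rewrite -(@eqrXn2 _ 2)// sqr_norm_slice//= sqrrN cos2Dsin2 expr1n.
by [].
Qed.

Lemma cont_conj_unit a b : qcont_on a b conj_unit.
Proof.
apply: qcont_on_slice => v _; first exact: continuous_cos.
by apply: cvgN; exact: continuous_sin.
Qed.

Lemma qInt_conj_unit (k : nat) : (0 < k)%N -> qInt (- pi) pi (fun v => conj_unit v ^+ k) = 0.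
Proof.
move=> k0; apply: q_re_mul_ext => u; rewrite mulr0 q_re_qInt; last first.
  by apply: qcont_onX; exact: cont_conj_unit.
have cc : cont_on (- pi) pi (fun v : R => cos (k%:R * v)).
  move=> v _; apply: differentiable_continuous; apply/derivable1_diffP.
  by apply: ex_derive; apply: trigger_derive.
have cs : cont_on (- pi) pi (fun v : R => sin (k%:R * v)).
  move=> v _; apply: differentiable_continuous; apply/derivable1_diffP.
  by apply: ex_derive; apply: trigger_derive.
have -> : (fun v => q_re (u * conj_unit v ^+ k)) =
    (fun v => q_re u * cos (k%:R * v) - q_re (u * I) * sin (k%:R * v)).
  by apply/funext => v; rewrite conj_unitX /slice_pt /=; ring.
have cZ (c : R) g : cont_on (- pi) pi g -> cont_on (- pi) pi (fun x => c * g x).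
  by move=> cf x /cf; exact: cvgMl_tmp.
rewrite IntB; [|exact: cZ..]; rewrite !IntZ// Int_cos// Int_sin//.
by rewrite !mulr0 subrr.
Qed.

Section WithF.
Variables (F : R * R -> H) (holF : hol I F) (rho : R) (rho01 : 0 < rho < 1).

(** A Fourier coefficient of [F] on the circle, the exponential standing to the left of [F] because
    series coefficients are written to the right of [q ^+ k]. *)
Definition taylor_coef (k : nat) : H :=
  (2 * pi)^-1 *: (rho ^- k *: qInt (- pi) pi (fun v => conj_unit v ^+ k * F (cpt rho v))).

Lemma circle_bounded : exists M, forall v, - pi <= v <= pi -> `|F (cpt rho v)| <= M.
Proof.
have pi0 := pi_gt0 R; have pp : - pi <= pi :> R by lra.
have cn : {within `[- pi, pi], continuous (fun v => `|F (cpt rho v)|)}.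
  apply: continuous_in_subspaceT => v; rewrite inE /= in_itv /= => hv.
  by apply: cvg_norm; exact: (cont_F_cpt holF rho01 hv).
have [c _ hc] := EVT_max pp cn; exists `|F (cpt rho c)| => v hv.
by apply: hc; rewrite in_itv.
Qed.

Lemma taylor_coef_bound C : (forall v, - pi <= v <= pi -> `|F (cpt rho v)| <= C) ->
  forall k, `|taylor_coef k| * rho ^+ k <= C.
Proof.
case/andP: rho01 => r0 r1 FC k; have pi0 := pi_gt0 R.
have rk : 0 < rho ^+ k by rewrite exprn_gt0.
rewrite /taylor_coef !normrZ !gtr0_norm ?invr_gt0 ?mulr_gt0//.
have pp : - pi <= pi :> R by lra.
have h := @qInt_norm_le _ (- pi) pi (fun v => conj_unit v ^+ k * F (cpt rho v)) C pp.
have : `|qInt (- pi) pi (fun v => conj_unit v ^+ k * F (cpt rho v))| <= C * (pi - - pi).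
  apply: h.
    by apply: qcont_onM; [apply: qcont_onX; exact: cont_conj_unit|exact: (cont_F_cpt holF rho01)].
  by move=> v hv; rewrite quat_normM quat_normX norm_conj_unit expr1n mul1r FC.
set q := `|qInt _ _ _| => hq.
have rk0 : rho ^+ k != 0 by rewrite gt_eqF.
have -> : (2 * pi)^-1 * (rho ^- k * q) * rho ^+ k = q / (2 * pi).
  by rewrite [_ * q]mulrC mulrA -mulrA mulVf// mulr1 mulrC.
by rewrite ler_pdivrMr ?mulr_gt0//; lra.
Qed.

Lemma taylor_cvg (z : R * R) : z.1 ^+ 2 + z.2 ^+ 2 < rho ^+ 2 ->
  qseries taylor_coef (slice_pt I z) @ \oo --> F z.
Proof.
move=> zr; have pi0 := pi_gt0 R; case/andP: (rho01) => r0 r1.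
have pp : - pi <= pi :> R by lra.
have p2 : 0 < 2 * pi :> R by rewrite mulr_gt0.
set q := slice_pt I z; have qr : `|q| < rho := norm_center I2 rho01 zr.
pose A v := slice_pt I (cpt rho v).
pose Ai v := rho^-1 *: conj_unit v.
have AAi v : A v * Ai v = 1.
  rewrite /A /Ai /conj_unit -scalerAr slice_ptM//= /cpt /=.
  have -> : rho * cos v * cos v - rho * sin v * - sin v = rho.
    by transitivity (rho * (cos v ^+ 2 + sin v ^+ 2)); [ring|rewrite cos2Dsin2 mulr1].
  have -> : rho * cos v * - sin v + rho * sin v * cos v = 0 by ring.
  by rewrite slice_ptE scale0r addr0 scalerA mulVf ?gt_eqF// scale1r.
pose K := ckernel I z rho.
pose x v := q * Ai v.
have K1 v : K v * (1 - x v) = 1.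
  have : K v * (A v - q) * Ai v = A v * Ai v by rewrite /K /A ckernelE.
  by rewrite -mulrA mulrBl AAi.
(* [K v] inverts [1 - x v], so it is a finite geometric sum plus a remainder whose size is
   controlled by [(|q| / rho) ^+ N]. *)
have KE v N : K v = \sum_(0 <= k < N) x v ^+ k + K v * x v ^+ N.
  have h : (1 - x v) * \sum_(0 <= k < N) x v ^+ k = 1 - x v ^+ N.
    by rewrite big_mkord -opprB mulNr -subrX1 opprB.
  have : K v * (1 - x v) * \sum_(0 <= k < N) x v ^+ k = K v * (1 - x v ^+ N).
    by rewrite -mulrA h.
  by rewrite K1 mul1r mulrBr mulr1 => ->; rewrite subrK.
have xE v k : x v ^+ k = (rho ^- k *: q ^+ k) * conj_unit v ^+ k.
  have cm : GRing.comm q (Ai v).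
    by rewrite /GRing.comm /Ai -scalerAr -scalerAl; congr (_ *: _); exact: slice_comm.
  by rewrite /x exprMn_comm// /Ai exprZn -scalerAr -scalerAl exprVn.
have cK : qcont_on (- pi) pi K := cont_ckernel zr (b := pi).
have cE k : qcont_on (- pi) pi (fun v => conj_unit v ^+ k).
  by apply: qcont_onX; exact: cont_conj_unit.
have cx k : qcont_on (- pi) pi (fun v => x v ^+ k).
  apply: qcont_onX; apply: qcont_onM; first exact: qcont_on_cst.
  by move=> v hv; apply: cvgZl_tmp; exact: cont_conj_unit hv.
have exp_g (g : R -> H) N : qcont_on (- pi) pi g ->
  qInt (- pi) pi (fun v => K v * g v) =
  \sum_(0 <= k < N) (rho ^- k *: q ^+ k) * qInt (- pi) pi (fun v => conj_unit v ^+ k * g v)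
  + qInt (- pi) pi (fun v => K v * x v ^+ N * g v).
  move=> cg.
  have -> : (fun v => K v * g v) = (fun v => \sum_(0 <= k < N)
      ((rho ^- k *: q ^+ k) * (conj_unit v ^+ k * g v)) + K v * x v ^+ N * g v).
    apply/funext => v; rewrite [in LHS](KE v N) mulrDl; congr (_ + _).
    by rewrite mulr_suml; apply: eq_bigr => k _; rewrite xE mulrA.
  have cs k : qcont_on (- pi) pi (fun v => (rho ^- k *: q ^+ k) * (conj_unit v ^+ k * g v)).
    by apply: qcont_onM; [exact: qcont_on_cst|exact: qcont_onM].
  have [e c] := qInt_sum N cs.
  rewrite qIntD//; last by do 2 apply: qcont_onM => //.
  rewrite e; congr (_ + _); apply: eq_bigr => k _.
  by rewrite qIntMl//; exact: qcont_onM.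
pose Q := `|q| / rho; have Q0 : 0 <= Q by rewrite divr_ge0// ltW.
have Q01 : 0 <= Q < 1 by rewrite Q0 ltr_pdivrMr// mul1r.
have nx v : `|x v| = Q.
  by rewrite /x quat_normM /Ai normrZ norm_conj_unit mulr1 gtr0_norm// invr_gt0.
pose CK := rho / (rho - `|q|).
have rem_bound (g : R -> H) M N : qcont_on (- pi) pi g ->
    (forall v, - pi <= v <= pi -> `|g v| <= M) ->
    `|qInt (- pi) pi (fun v => K v * x v ^+ N * g v)| <= CK * M * (pi - - pi) * Q ^+ N.
  move=> cg gM.
  have : forall v, - pi <= v <= pi -> `|K v * x v ^+ N * g v| <= CK * Q ^+ N * M.
    move=> v /gM gv; rewrite !quat_normM quat_normX nx ler_pM ?mulr_ge0 ?exprn_ge0//.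
    by rewrite ler_wpM2r ?exprn_ge0//; exact: norm_ckernel.
  move=> /(qInt_norm_le pp) h; apply: le_trans (h _) _.
    by do 2 apply: qcont_onM => //.
  by rewrite le_eqVlt; apply/orP; left; apply/eqP; ring.
(* The expansion with [g = 1] computes the integral of the kernel: all terms of positive index
   integrate to zero, and [N.+1] terms are taken so that index [0] is always present. *)
have IK : qInt (- pi) pi K = (2 * pi)%:A.
  have h N : `|qInt (- pi) pi K - (2 * pi)%:A| <= CK * 1 * (pi - - pi) * Q * Q ^+ N.
    have -> : K = (fun v => K v * 1) by apply/funext => v; rewrite mulr1.
    rewrite (exp_g _ N.+1); last exact: qcont_on_cst.
    rewrite big_nat_recl//= big1_seq; last first.
      move=> k _; rewrite (_ : (fun v => _) = (fun v => conj_unit v ^+ k.+1)).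
        by rewrite qInt_conj_unit// mulr0.
      by apply/funext => v; rewrite mulr1.
    rewrite !expr0 invr1 scale1r mul1r addr0.
    have -> : qInt (- pi) pi (fun _ : R => 1 * 1 : H) = (2 * pi)%:A.
      apply: q_re_mul_ext => u; rewrite q_re_qInt; last exact: qcont_on_cst.
      by rewrite Int_cst// mulr1 mulr_algr -[RHS]/(2 * pi * q_re u) mulr1; ring.
    rewrite addrC addKr -mulrA -exprS; apply: rem_bound => [|v _]; first exact: qcont_on_cst.
    by rewrite quat_norm1.
  by apply/eqP; rewrite -subr_eq0 -normr_le0; apply: le_expr_eq0 Q01 h.
have cF : qcont_on (- pi) pi (fun v => F (cpt rho v)) := cont_F_cpt holF rho01 (b := pi).
have [M FM] := circle_bounded.
have KF : qInt (- pi) pi (fun v => K v * F (cpt rho v)) = (2 * pi) *: F z.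
  have := circle_integral0 I2 holF rho01 zr.
  have -> : (fun v => ckernel I z rho v * (F (cpt rho v) - F z)) =
      (fun v => K v * F (cpt rho v) + K v * - F z).
    by apply/funext => v; rewrite mulrBr mulrN.
  rewrite qIntD; [|exact: qcont_onM|by apply: qcont_onM => //; exact: qcont_on_cst].
  by rewrite qIntMr// IK mulrN mulr_algl => /eqP; rewrite subr_eq0 => /eqP.
pose B := (2 * pi)^-1 * (CK * M * (pi - - pi)).
have conv N : `|F z - qseries taylor_coef q N| <= B * Q ^+ N.
  have := exp_g _ N cF; rewrite KF => /(congr1 (fun y => (2 * pi)^-1 *: y)).
  rewrite scalerA mulVf ?gt_eqF// scale1r => ->.
  rewrite scalerDr scaler_sumr.
  have -> : qseries taylor_coef q N = \sum_(0 <= i < N) (2 * pi)^-1 *: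
    ((rho ^- i *: q ^+ i) * qInt (- pi) pi (fun v => conj_unit v ^+ i * F (cpt rho v))).
    rewrite /qseries /series /=; apply: eq_bigr => k _; rewrite /taylor_coef.
    by rewrite -!scalerAr -scalerAl.
  rewrite addrC addKr normrZ gtr0_norm ?invr_gt0// -mulrA.
  by rewrite ler_wpM2l ?invr_ge0 ?(ltW p2)//; exact: rem_bound.
apply/cvgrPdist_le => e e0.
have : (B * Q ^+ n : R) @[n --> \oo] --> B * 0.
  by apply: cvgMl_tmp; apply: cvg_expr; rewrite ger0_norm//; case/andP: Q01.
rewrite mulr0 => /cvgr_lt /(_ e e0); apply: filterS => n hn.
exact: le_trans (conv n) (ltW hn).
Qed.

End WithF.
End WithI.
End CauchyExpansion.

(** * Power series and Cauchy estimates on the whole ball *)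

Section RegularExpansion.
Variable R : realType.
Local Notation H := (quat R).
Implicit Types (f : H -> H) (I : H) (z : R * R) (q : H).

Lemma qball_slice I z : I ^+ 2 = -1 -> qball (slice_pt I z) <-> z.1 ^+ 2 + z.2 ^+ 2 < 1.
Proof.
move=> I2; rewrite /qball /= -(sqr_norm_slice z I2).
by rewrite -[X in _ <-> _ < X](expr1n _ 2) ltr_pXn2r ?nnegrE.
Qed.

Lemma slice_regular_hol f I : slice_regular qball f -> I ^+ 2 = -1 -> hol I (f \o slice_pt I).
Proof.
move=> rf I2 w /(qball_slice w I2).2 wB; have [df] := rf I I2 w wB.
rewrite !deriveE// => /eqP; rewrite scaler_eq0 invr_eq0 pnatr_eq0 /=.
rewrite addr_eq0 => /eqP h; split=> //.
by rewrite h mulrN mulrA -expr2 I2 mulN1r opprK.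
Qed.

Lemma hol_slice_regular f :
  (forall I, I ^+ 2 = -1 -> hol I (f \o slice_pt I)) -> slice_regular qball f.
Proof.
move=> h I I2 z /(qball_slice z I2).1 zB; have [df e] := h I I2 z zB; split=> //.
by rewrite !deriveE// e mulrA -expr2 I2 mulN1r subrr scaler0.
Qed.

Lemma slice_real I (x : R) : slice_pt I (x, 0) = x%:A.
Proof. by rewrite slice_ptE scale0r addr0. Qed.

Section Glue.
Variables (f : H -> H) (rf : slice_regular qball f).

Let tc I rho := taylor_coef I (f \o slice_pt I) rho.

(** Both expansions converge to [f] at the reals between 0 and the smaller radius, which is enough
    to identify the coefficients. *)
Let tc_unique I J (r s : R) : I ^+ 2 = -1 -> J ^+ 2 = -1 -> 0 < r < 1 -> 0 < s < 1 ->
  tc I r = tc J s.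
Proof.
move=> I2 J2 r01 s01.
have [M hM] := circle_bounded (slice_regular_hol rf I2) r01.
have [M' hM'] := circle_bounded (slice_regular_hol rf J2) s01.
have bM := taylor_coef_bound I2 (slice_regular_hol rf I2) r01 hM.
have bM' := taylor_coef_bound J2 (slice_regular_hol rf J2) s01 hM'.
case/andP: (r01) => r0 r1; case/andP: (s01) => s0 s1.
pose t := Num.min r s; have t0 : 0 < t by rewrite lt_min r0.
have tr : t <= r by rewrite ge_min lexx.
have ts : t <= s by rewrite ge_min lexx orbT.
apply/funext => k; apply/eqP; rewrite -subr_eq0; apply/eqP; move: k.
apply: (@expands0_inj R (fun k => tc I r k - tc J s k) t t (M + M')) => //.
  move=> k; apply: le_trans (lerD (bM k) (bM' k)).
  apply: le_trans (ler_wpM2r (exprn_ge0 _ (ltW t0)) (ler_normB _ _)) _.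
  by rewrite mulrDl lerD// ler_wpM2l// lerXn2r// ?nnegrE ltW.
move=> x /andP[x0 xt].
have xx (u : R) : t <= u -> (x, 0 : R).1 ^+ 2 + (x, 0 : R).2 ^+ 2 < u ^+ 2.
  move=> tu; rewrite /= expr0n addr0 ltr_pXn2r ?nnegrE ?(ltW x0)//.
    exact: lt_le_trans tu.
  exact: le_trans (ltW t0) tu.
have S1 := taylor_cvg I2 (slice_regular_hol rf I2) r01 (xx r tr).
have S2 := taylor_cvg J2 (slice_regular_hol rf J2) s01 (xx s ts).
move: S1 S2; rewrite /= !slice_real => S1 S2.
have -> : qseries (fun k => tc I r k - tc J s k) x%:A =
    qseries (tc I r) x%:A - qseries (tc J s) x%:A.
  apply/funext => n; rewrite /qseries /series/= -[RHS]/(_ - _) -sumrB.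
  by apply: eq_bigr => k _; rewrite mulrBr.
by rewrite -(subrr (f x%:A)); exact: cvgB S1 S2.
Qed.

Let I0 : H := Quat 0 1 0 0.
Let I02 : I0 ^+ 2 = -1.
Proof. by rewrite expr2; apply: quat_eqP => /=; ring. Qed.
Let half01 : 0 < (2^-1 : R) < 1.
Proof. by apply/andP; split; lra. Qed.

(** Coefficients are taken once from the slice of [i] at radius one half; for a given [q] they are
    recomputed on the slice through [q], with a radius between [|q|] and [1]. *)
Theorem slice_regular_expands : exists a, expands a f.
Proof.
exists (tc I0 2^-1) => q qB; have [I [I2 [z qz]]] := slice_exists q.
pose r := (1 + `|q|) / 2; have q0 := normr_ge0 q; move: qB; rewrite /qball /= => q1.
have r01 : 0 < r < 1 by rewrite /r; apply/andP; split; lra.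
rewrite (tc_unique I02 I2 half01 r01) qz; apply: (taylor_cvg I2 (slice_regular_hol rf I2) r01).
rewrite -(sqr_norm_slice z I2) -qz ltr_pXn2r ?nnegrE//; last by rewrite /r; lra.
by rewrite /r; lra.
Qed.

(** The circle of one slice suffices, since the coefficients may be computed there. [max_modulus]
    relies on this: its powers are evaluated multiplicatively on one chosen slice. *)
Theorem cauchy_estimate a I (r C : R) : expands a f -> I ^+ 2 = -1 -> 0 < r < 1 ->
  (forall z, `|slice_pt I z| = r -> `|f (slice_pt I z)| <= C) ->
  forall k, `|a k| * r ^+ k <= C.
Proof.
move=> af I2 r01 fC k.
have -> : a = tc I r.
  apply: (expands_inj af) => q qB; have [J [J2 [z qz]]] := slice_exists q.
  pose s := (1 + `|q|) / 2; have q0 := normr_ge0 q; move: qB; rewrite /qball /= => q1.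
  have s01 : 0 < s < 1 by rewrite /s; apply/andP; split; lra.
  rewrite (tc_unique I2 J2 r01 s01) qz; apply: (taylor_cvg J2 (slice_regular_hol rf J2) s01).
  rewrite -(sqr_norm_slice z J2) -qz ltr_pXn2r ?nnegrE//; last by rewrite /s; lra.
  by rewrite /s; lra.
apply: (taylor_coef_bound I2 (slice_regular_hol rf I2) r01) => v _.
by apply: fC; exact: norm_cpt.
Qed.

End Glue.

End RegularExpansion.

(** * Differential quotients, and regularity of power series *)

Section DifferentialQuotient.
Variable R : realType.
Local Notation H := (quat R).
Local Notation ps := (ps R).
Implicit Types (a b : ps) (p q : H).

Definition ps_shift m a : ps := fun k => a (m + k)%N.

(** Synthetic division: dividing [a] minus its value at [p] by [q - p] requires coefficients with
    [c n = a n.+1 + p * c n.+1], which unrolls to the sum of [p ^+ k * a (n.+1 + k)]. *)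
Definition dq a p : ps := fun n => qsum (ps_shift n.+1 a) p.

Lemma tame_shift m a : tame a -> tame (ps_shift m a).
Proof.
move=> ta; apply: tameP => s /andP[s0 s1]; have [|M hM] := ta s; first by rewrite ltW.
exists (M / s ^+ m) => k; rewrite ler_pdivlMr ?exprn_gt0// -mulrA -exprD addnC.
exact: hM.
Qed.

Lemma qsum_shift a p : tame a -> qball p -> qsum a p = a 0%N + p * qsum (ps_shift 1 a) p.
Proof.
move=> ta pB; have ts := tame_shift 1 ta.
have e : a - psX R * ps_shift 1 a = psC (a 0%N).
  apply/funext => n; rewrite ps_subE psXM_coef.
  by case: n => [|n] /=; rewrite ?subr0// /ps_shift add1n subrr.
have := qsum_sub ta (tameM (@tameX R) ts) pB; rewrite e qsum_psC.
rewrite qsum_mul_comm//; [|exact: tameX|by rewrite qsumX].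
by rewrite qsumX => ->; rewrite subrK.
Qed.

Lemma dq_rec a p n : tame a -> qball p -> dq a p n = a n.+1 + p * dq a p n.+1.
Proof.
move=> ta pB; rewrite /dq (qsum_shift (tame_shift _ ta) pB).
have -> : ps_shift 1 (ps_shift n.+1 a) = ps_shift n.+2 a.
  by apply/funext => k; rewrite /ps_shift add1n addnS addSn.
by rewrite {1}/ps_shift addn0.
Qed.

Lemma dq_mul a p : tame a -> qball p -> (psX R - psC p) * dq a p = a - psC (qsum a p).
Proof.
move=> ta pB; apply/funext => n; rewrite mulrBl !ps_subE psXM_coef psCM_coef.
case: n => [|n] /=; last by rewrite subr0 (dq_rec n ta pB) addrK.
rewrite (qsum_shift ta pB) opprD addrA subrr; congr (_ - _).
Qed.

Lemma tame_dq a p : tame a -> qball p -> tame (dq a p).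
Proof.
rewrite /qball /= => ta p1; apply: tameP => s /andP[s0 s1].
have p0 := normr_ge0 p.
have [t [t0 t1 s_t p_t]] : exists t, [/\ 0 < t, t < 1, s <= t & `|p| < t].
  have mx : Num.max s `|p| < 1 by rewrite gt_max s1.
  have st : s <= Num.max s `|p| by rewrite le_max lexx.
  have pt : `|p| <= Num.max s `|p| by rewrite le_max lexx orbT.
  by exists ((1 + Num.max s `|p|) / 2); split; lra.
have [|M hM] := ta t; first by rewrite ltW.
have x01 : 0 <= `|p| / t < 1 by rewrite divr_ge0 ?(ltW t0)//= ltr_pdivrMr// mul1r.
exists (M / t / (1 - `|p| / t)) => n.
have ub k : `|p ^+ k * ps_shift n.+1 a k| <= M / t ^+ n.+1 * (`|p| / t) ^+ k.
  have -> : M / t ^+ n.+1 * (`|p| / t) ^+ k = `|p| ^+ k * (M / t ^+ (n.+1 + k)).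
    by rewrite expr_div_n exprD invfM mulrCA -[_ / _ / _]mulrA.
  rewrite quat_normM quat_normX ler_wpM2l ?exprn_ge0//.
  by rewrite ler_pdivlMr ?exprn_gt0//; exact: hM.
have pB : qball p by [].
have := geo_tail 0 x01 ub (qsum_cvg (tame_shift n.+1 ta) pB).
rewrite big_geq// subr0 expr0 mul1r -/(dq a p n) => h.
apply: le_trans (ler_wpM2r (exprn_ge0 _ (ltW s0)) h) _.
have M0 : 0 <= M by apply: le_trans (hM 0%N); rewrite mulr_ge0// exprn_ge0// ltW.
have d0 : 0 < (1 - `|p| / t)^-1 by rewrite invr_gt0 subr_gt0; case/andP: x01.
have -> : M / t ^+ n.+1 * (1 - `|p| / t)^-1 * s ^+ n =
   M / t * (1 - `|p| / t)^-1 * (s ^+ n / t ^+ n).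
  by rewrite exprS invfM; ring.
rewrite ler_piMr//; first by rewrite mulr_ge0 ?(ltW d0)// divr_ge0// ltW.
by rewrite ler_pdivrMr ?exprn_gt0// mul1r lerXn2r// ?nnegrE ltW.
Qed.

Lemma qsum_XsubC p q : qball q -> qsum (psX R - psC p) q = q - p.
Proof. by move=> qB; rewrite qsum_sub ?qsumX ?qsum_psC//; [exact: tameX|exact: tame_psC]. Qed.

Lemma tame_XsubC p : tame (psX R - psC p).
Proof. by apply: tame_sub; [exact: tameX|exact: tame_psC]. Qed.

Lemma qsum_dq a p q : tame a -> qball p -> qball q -> GRing.comm q p ->
  qsum a q = qsum a p + (q - p) * qsum (dq a p) q.
Proof.
move=> ta pB qB qp; have := congr1 (fun c => qsum c q) (dq_mul ta pB).
rewrite qsum_mul_comm//; last first.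
- by rewrite qsum_XsubC//; apply: commrB.
- exact: tame_dq.
- exact: tame_XsubC.
rewrite qsum_XsubC// qsum_sub ?qsum_psC//; last exact: tame_psC.
by move=> ->; rewrite addrC subrK.
Qed.

Lemma qsum_bounded a (r : R) : tame a -> 0 <= r < 1 ->
  exists C, forall q, `|q| <= r -> `|qsum a q| <= C.
Proof.
move=> ta /andP[r0 r1]; pose t := (1 + r) / 2.
have t0 : 0 < t by rewrite /t; lra.
have rt : r < t by rewrite /t; lra.
have [|M hM] := ta t; first by rewrite ltW//= /t; lra.
have x01 : 0 <= r / t < 1 by rewrite divr_ge0 ?(ltW t0)//= ltr_pdivrMr// mul1r.
exists (M / (1 - r / t)) => q qr.
have ub k : `|q ^+ k * a k| <= M * (r / t) ^+ k.
  rewrite quat_normM quat_normX expr_div_n mulrA ler_pdivlMr ?exprn_gt0//.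
  apply: (@le_trans _ _ (r ^+ k * (`|a k| * t ^+ k))); last first.
    by rewrite mulrC ler_wpM2r ?exprn_ge0.
  by rewrite -mulrA ler_wpM2r ?mulr_ge0 ?exprn_ge0 ?(ltW t0)// lerXn2r ?nnegrE.
have := geo_tail 0 x01 ub (qsum_cvg ta (le_lt_trans qr r1)).
by rewrite big_geq// subr0 expr0 mul1r.
Qed.

(* Second-order remainder: dividing twice by [q - p] gives
   [a(q) = a(p) + (q - p) a'(p) + (q - p)^2 k(q)] with [k] locally bounded. *)
Theorem qsum_slice_regular a : tame a -> slice_regular qball (qsum a).
Proof.
move=> ta; apply: hol_slice_regular => I I2 w wB.
set p := slice_pt I w; have pB : qball p by apply/qball_slice.
pose b := dq a p; have tb : tame b := tame_dq ta pB.
pose c := dq b p; have tc : tame c := tame_dq tb pB.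
pose L (v : R * R) : H := slice_pt I v * qsum b p.
have lL : linear L.
  move=> k u v; rewrite /L /slice_pt scalerAl -mulrDl; congr (_ * _).
  by rewrite scalerDr !scalerA /= !scalerDl -!addrA; congr (_ + _); rewrite addrCA.
pose lM := GRing.isLinear.Build _ _ _ _ _ lL.
pose Ll : {linear (R * R)%type -> H} := HB.pack L lM.
have ns (v : R * R) : `|slice_pt I v| <= 2 * `|v|.
  rewrite /slice_pt; apply: le_trans (ler_normD _ _) _.
  rewrite normrZ quat_norm1 mulr1 normrZ imag_unit_norm// mulr1 prod_normE mulr2n mulrDl mul1r.
  by rewrite lerD// le_max lexx ?orbT.
have sD (v : R * R) : slice_pt I (w + v) = p + slice_pt I v.
  by rewrite /p /slice_pt /= !scalerDl addrACA.
have H0 : is_diff w (qsum a \o slice_pt I) Ll.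
  apply: (@eps_diff _ _ _ _ Ll _ (2 * `|qsum b p|)) => [h|e e0].
    by rewrite /= /L quat_normM -mulrA [_ * `|h|]mulrC mulrA ler_wpM2r.
  pose r := (1 + `|p|) / 2; have p0 := normr_ge0 p.
  have p1 : `|p| < 1 by [].
  have r01 : 0 <= r < 1 by rewrite /r; apply/andP; split; lra.
  have [C hC] := qsum_bounded tc r01.
  have C0 : 0 <= C by apply: le_trans (hC 0 _); rewrite ?normr0 //; case/andP: r01.
  have C1 : 0 < C + 1 by lra.
  (* Since [slice_pt I h] has modulus at most [2 * |h|], the first bound keeps [p + slice_pt I h] in
     the ball of radius [r], and the second makes [(2 * |h|) ^+ 2 * C] at most [e * |h|]. *)
  exists (Num.min ((1 - `|p|) / 4) (e / (4 * (C + 1)))).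
    by rewrite lt_min !divr_gt0 ?mulr_gt0 ?subr_gt0.
  move=> h; rewrite lt_min => /andP[h1 h2]; rewrite /= sD.
  set x := slice_pt I h; have xh : `|x| <= 2 * `|h| := ns h.
  have xr : `|p + x| <= r by apply: le_trans (ler_normD _ _) _; rewrite /r; lra.
  have qB : qball (p + x) by rewrite /qball /=; case/andP: r01 => _; exact: le_lt_trans.
  have cm : GRing.comm (p + x) p.
    by apply: commr_sym; apply: commrD => //; exact: slice_comm.
  rewrite (qsum_dq ta pB qB cm) (qsum_dq tb pB qB cm) -/b -/c [p + x - p]addrC addKr.
  rewrite [X in X - _ - _]addrC addrK mulrDr /L -/x [X in X - _]addrC addrK.
  rewrite !quat_normM; apply: (@le_trans _ _ (2 * `|h| * (2 * `|h| * C))).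
    by rewrite ler_pM ?mulr_ge0// ler_pM// hC.
  have h3 : `|h| * (4 * (C + 1)) <= e by rewrite -ler_pdivlMr ?mulr_gt0// ltW.
  have -> : 2 * `|h| * (2 * `|h| * C) = `|h| * (4 * C) * `|h| by ring.
  rewrite ler_wpM2r//; apply: le_trans h3; rewrite ler_wpM2l//.
  by rewrite ler_wpM2l// lerDl.
split; first by have [] := H0.
by rewrite (diff_val (is_diff_def := H0)) /= /L !slice_ptE !scale0r scale1r addr0 add0r scale1r mul1r.
Qed.

End DifferentialQuotient.

(** * The maximum modulus principle *)

Section MaximumModulus.
Variable R : realType.
Local Notation H := (quat R).
Local Notation ps := (ps R).
Implicit Types (a b : ps) (p q : H).

Lemma tame_cauchy a I (r C : R) : tame a -> I ^+ 2 = -1 -> 0 < r < 1 ->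
  (forall z, `|slice_pt I z| = r -> `|qsum a (slice_pt I z)| <= C) ->
  forall k, `|a k| * r ^+ k <= C.
Proof.
by move=> ta; apply: (cauchy_estimate (qsum_slice_regular ta)); exact: expands_qsum.
Qed.

Lemma qsum_geo_le a q (r C : R) : tame a -> 0 < r < 1 -> `|q| < r ->
  (forall k, `|a k| * r ^+ k <= C) -> `|qsum a q| <= C / (1 - `|q| / r).
Proof.
move=> ta /andP[r0 r1] qr aC.
have x01 : 0 <= `|q| / r < 1 by rewrite divr_ge0 ?(ltW r0)//= ltr_pdivrMr// mul1r.
have ub k : `|q ^+ k * a k| <= C * (`|q| / r) ^+ k.
  rewrite quat_normM quat_normX expr_div_n mulrA ler_pdivlMr ?exprn_gt0//.
  by rewrite -mulrA mulrC ler_wpM2r ?exprn_ge0.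
have := geo_tail 0 x01 ub (qsum_cvg ta (lt_trans qr r1)).
by rewrite big_geq// subr0 expr0 mul1r.
Qed.

Section Landau.
Variables (I : H) (I2 : I ^+ 2 = -1).

Lemma comm_slice x z : GRing.comm I x -> GRing.comm (slice_pt I z) x.
Proof.
move=> Ix; rewrite /slice_pt /GRing.comm mulrDl mulrDr scale_commq; congr (_ + _).
by rewrite -scalerAl -scalerAr Ix.
Qed.

(* Projection onto the commutative subfield [R + I R]. *)
Definition slice_proj a : ps := psC (2^-1)%:A * (a - psC I * a * psC I).

Lemma slice_projE a k : slice_proj a k = 2^-1 *: (a k - I * a k * I).
Proof. by rewrite /slice_proj psCM_coef ps_subE psMC psCM_coef mulr_algl. Qed.

Lemma tame_slice_proj a : tame a -> tame (slice_proj a).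
Proof.
move=> ta; apply: tameM; first exact: tame_psC.
by apply: tame_sub => //; apply: tameM; [apply: tameM => //|]; exact: tame_psC.
Qed.

Lemma slice_proj_comm x : GRing.comm I (2^-1 *: (x - I * x * I)).
Proof.
rewrite /GRing.comm -scalerAl -scalerAr; congr (_ *: _).
rewrite mulrBr mulrBl !mulrA -expr2 I2 mulN1r mulNr opprK.
by rewrite -[I * x * I * I]mulrA -expr2 I2 mulrN1 opprK addrC.
Qed.

Lemma qsum_slice_proj a z : tame a -> qball (slice_pt I z) ->
  qsum (slice_proj a) (slice_pt I z) =
  2^-1 *: (qsum a (slice_pt I z) - I * qsum a (slice_pt I z) * I).
Proof.
move=> ta zB; have tC p := @tame_psC R p.
have cI : GRing.comm (slice_pt I z) I by exact: comm_slice.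
have tI : tame (psC I * a) by exact: tameM.
rewrite /slice_proj qsum_mul_comm ?qsum_psC//; last 2 first.
- by apply: tame_sub => //; exact: tameM.
- exact/esym/scale_commq.
rewrite mulr_algl qsum_sub//; last exact: tameM.
by rewrite qsum_mulC// qsum_mul_comm ?qsum_psC.
Qed.

Lemma slice_proj_norm x : `|2^-1 *: (x - I * x * I)| <= `|x|.
Proof.
rewrite normrZ ger0_norm ?invr_ge0// mulrC ler_pdivrMr// mulr_natr mulr2n.
apply: le_trans (ler_normB _ _) _.
by rewrite !quat_normM imag_unit_norm// mul1r mulr1.
Qed.

Lemma qsum_expn_slice a z n : tame a -> qball (slice_pt I z) ->
  (forall k, GRing.comm I (a k)) -> qsum (a ^+ n) (slice_pt I z) = qsum a (slice_pt I z) ^+ n.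
Proof.
move=> ta zB Ia; elim: n => [|n IH]; first by rewrite !expr0 qsum1.
rewrite !exprS qsum_mul_comm ?IH//; first exact: tame_expn.
by apply: qsum_commute => // k; exact: comm_slice.
Qed.

End Landau.

(* Landau's trick: Cauchy's estimate for the powers of a commutative component,
   and then an N-th root. *)
Theorem max_modulus a (r C : R) : tame a -> 0 < r < 1 ->
  (forall q, `|q| = r -> `|qsum a q| <= C) -> forall q, `|q| < r -> `|qsum a q| <= C.
Proof.
move=> ta r01 aC q qr; case/andP: (r01) => r0 r1.
have [I [I2 [z qz]]] := slice_exists q.
set w := qsum a q; rewrite leNgt; apply/negP => Cw.
have C0 : 0 <= C.
  have nr : `|r%:A : H| = r by rewrite quat_normA gtr0_norm.
  exact: le_trans (normr_ge0 _) (aC _ nr).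
have w0 : 0 < `|w| by apply: le_lt_trans Cw.
(* Multiplying by [qconj w] makes the value at [q] the real number [|w| ^+ 2], which the projection
   keeps. *)
pose d := slice_proj I (a * psC (qconj w)).
have tb : tame (a * psC (qconj w)) by apply: tameM => //; exact: tame_psC.
have td : tame d by exact: tame_slice_proj.
have dI k : GRing.comm I (d k) by rewrite /d slice_projE; exact: slice_proj_comm.
have qB : qball (slice_pt I z) by rewrite -qz /qball /=; exact: lt_trans r1.
have dq : qsum d (slice_pt I z) = (`|w| ^+ 2)%:A.
  rewrite qsum_slice_proj// qsum_mulC// -qz -/w mulq_conj -scale_commq -mulrA -expr2 I2.
  by rewrite mulrN1 opprK -scalerDl scalerA; congr (_ *: _); move: (_ ^+ 2) => t; field.
pose x := `|q| / r.
have x01 : 0 <= x < 1 by rewrite divr_ge0 ?(ltW r0)//= ltr_pdivrMr// mul1r.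
(* The projected series is at most [C * |w|] on the circle, so Cauchy's estimate for its [N]-th
   power bounds [|w| ^+ (2 * N)] by [(C * |w|) ^+ N / (1 - x)]. The factor [1 - x] does not depend
   on [N]. *)
have Nbound N : `|w| ^+ N <= C ^+ N / (1 - x).
  have tdN : tame (d ^+ N) := tame_expn N td.
  have h : forall k, `|(d ^+ N) k| * r ^+ k <= (C * `|w|) ^+ N.
    apply: (tame_cauchy tdN I2 r01) => y yr.
    have yB : qball (slice_pt I y) by rewrite /qball /= yr.
    rewrite qsum_expn_slice// quat_normX lerXn2r ?nnegrE ?mulr_ge0//.
    rewrite qsum_slice_proj//; apply: le_trans (slice_proj_norm I2 _) _.
    by rewrite qsum_mulC// quat_normM quat_norm_conj ler_wpM2r// aC.
  have := qsum_geo_le tdN r01 qr h; rewrite {1}qz qsum_expn_slice// dq quat_normX.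
  rewrite quat_normA ger0_norm ?exprn_ge0// expr2 !exprMn -/x mulrAC.
  by rewrite ler_pM2r// exprn_gt0.
have y01 : 0 <= C / `|w| < 1 by rewrite divr_ge0//= ltr_pdivrMr// mul1r.
have : (1 : R) <= 0.
  apply: (le_expr_eq0 (C := (1 - x)^-1) y01) => N.
  rewrite expr_div_n mulrA ler_pdivlMr ?exprn_gt0// mul1r mulrC; exact: Nbound.
by rewrite ler10.
Qed.

(** The applications bound a series only near the unit sphere, up to an arbitrarily small excess;
    [max_modulus] on a sphere of radius close to 1 carries this inside. *)
Lemma boundary_max a : tame a ->
  (forall e : R, 0 < e -> exists2 s : R, s < 1 &
     forall q, s < `|q| < 1 -> `|qsum a q| <= 1 + e) ->
  forall q, qball q -> `|qsum a q| <= 1.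
Proof.
move=> ta h q; rewrite /qball /= => q1; apply/ler_addgt0Pr => e e0.
have [s s1 hs] := h e e0; pose m := Num.max s `|q|.
have m1 : m < 1 by rewrite gt_max s1.
have sm : s <= m by rewrite le_max lexx.
have qm : `|q| <= m by rewrite le_max lexx orbT.
have q0 := normr_ge0 q.
have r01 : 0 < (1 + m) / 2 < 1 by apply/andP; split; lra.
apply: (max_modulus ta r01) => [p pr|]; last by lra.
by apply: hs; rewrite pr; apply/andP; split; lra.
Qed.

End MaximumModulus.

(** * Reciprocals in the ring of series *)

Section Reciprocal.
Variable R : realType.
Local Notation H := (quat R).
Local Notation ps := (ps R).
Implicit Types (a b : ps) (p q : H) (f g : H -> H).

Lemma qsum_mul_conj a b q : tame a -> tame b -> qball q ->
  exists p, [/\ `|p| = `|q|, qsum (a * b) q = qsum a q * qsum b p & (qsum a q != 0 -> q * qsum a q = qsum a q * p)].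
Proof.
move=> ta tb qB; have [A0|A0] := eqVneq (qsum a q) 0.
  by exists q; split=> //; rewrite (qsum_mul ta tb qB qB)// A0 mulr0 mul0r.
pose p := (qsum a q)^-1 * q * qsum a q.
have np : `|p| = `|q|.
  by rewrite /p !quat_normM quat_normV mulrAC mulVf ?mul1r// normr_eq0.
have e : q * qsum a q = qsum a q * p by rewrite /p !mulrA mulrV ?quat_unitE// mul1r.
by exists p; split=> //; apply: qsum_mul => //; rewrite /qball /= np.
Qed.

(** The second factor is evaluated at another point, but of the same modulus, so bounds on the ball
    multiply. *)
Lemma qsum_mul_le a b (A B : R) : tame a -> tame b ->
  (forall q, qball q -> `|qsum a q| <= A) -> (forall q, qball q -> `|qsum b q| <= B) ->
  forall q, qball q -> `|qsum (a * b) q| <= A * B.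
Proof.
move=> ta tb hA hB q qB; have [p [pq -> _]] := qsum_mul_conj ta tb qB.
rewrite quat_normM; apply: ler_pM; [exact: normr_ge0|exact: normr_ge0|exact: hA|].
by apply: hB; rewrite /qball /= pq.
Qed.

(** The powers of [a] are summed coefficient by coefficient. They are bounded by [c ^+ N] on the
    ball, and Cauchy's estimate turns this into decay in [N] of each coefficient, with a weight
    [s ^- k] that makes the sum tame. The identity passes to the limit because a coefficient of a
    product is a finite sum. *)
Lemma neumann a (c : R) : tame a -> c < 1 -> (forall q, qball q -> `|qsum a q| <= c) ->
  exists2 b, tame b & (1 - a) * b = 1.
Proof.
move=> ta c1 hc.
have qB0 : qball (0 : H) by rewrite /qball /= normr0.
have c0 : 0 <= c by apply: le_trans (hc 0 qB0).
have c01 : 0 <= c < 1 by rewrite c0.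
have aN N q : qball q -> `|qsum (a ^+ N) q| <= c ^+ N.
  elim: N q => [|N IH] q qB; first by rewrite !expr0 qsum1 quat_norm1.
  by rewrite !exprS; apply: qsum_mul_le => //; exact: tame_expn.
have [I [I2 _]] := slice_exists (0 : H).
have coefN N k (s : R) : 0 < s < 1 -> `|(a ^+ N) k| <= (s ^+ k)^-1 * c ^+ N.
  move=> s01; case/andP: (s01) => s0 s1.
  rewrite mulrC ler_pdivlMr ?exprn_gt0//.
  apply: (tame_cauchy (tame_expn N ta) I2 s01) => z zs.
  by apply: aN; rewrite /qball /= zs.
have h01 : 0 < (2^-1 : R) < 1 by apply/andP; split; lra.
pose b : ps := fun k => limn (series (fun N => (a ^+ N) k)).
have bc k : series (fun N => (a ^+ N) k) @ \oo --> b k.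
  by apply: (geo_quat_cvg c01 (fun N => coefN N k _ h01)).
exists b.
  apply: tameP => s s01; exists (1 - c)^-1 => k; case/andP: (s01) => s0 s1.
  have := geo_tail 0 c01 (fun N => coefN N k s s01) (bc k).
  rewrite big_geq// subr0 expr0 mul1r => h.
  by rewrite -ler_pdivlMr ?exprn_gt0// mulrC.
pose S m : ps := \sum_(N < m) a ^+ N.
have SE m k : S m k = series (fun N => (a ^+ N) k) m.
  rewrite /series /= big_mkord /S; elim/big_rec2: _ => // i x y _ <-.
  by rewrite ps_addE.
apply/funext => n.
have l1 : ((1 - a) * S m) n @[m --> \oo] --> ((1 - a) * b) n.
  have -> : (fun m => ((1 - a) * S m) n) =
      (fun m => \sum_(k < n.+1) (1 - a) k * series (fun N => (a ^+ N) (n - k)%N) m).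
    by apply/funext => m; rewrite ps_mulE; apply: eq_bigr => k _; rewrite SE.
  rewrite ps_mulE; apply: cvg_big => [|k _]; first exact: add_continuous.
  by apply: quat_cvgMl; exact: bc.
have l2 : ((1 - a) * S m) n @[m --> \oo] --> (1 : ps) n.
  have -> : (fun m => ((1 - a) * S m) n) = (fun m => (1 : ps) n - (a ^+ m) n).
    apply/funext => m; rewrite -ps_subE; congr (_ n).
    by rewrite /S -opprB mulNr -subrX1 opprB.
  rewrite -[X in _ --> X]subr0; apply: cvgB; first exact: cvg_cst.
  exact: cvg_series_cvg_0 (cvgP _ (bc n)).
exact: quat_cvg_unique l1 l2.
Qed.

(** Symmetrizations have real coefficients, hence are central; this brings [ps_conj b * ps_conj a],
    which is 1 by conjugating the hypothesis, next to [a * b]. *)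
Lemma right_inv_sym a b : a * b = 1 -> (a * ps_conj a) * (b * ps_conj b) = 1.
Proof.
move=> ab; have ba : ps_conj b * ps_conj a = 1 by rewrite -ps_conjM ab ps_conj1.
rewrite (ps_symC b) mulrA (ps_realC _ (ps_real_sym a)) (ps_symC a) !mulrA ba mul1r.
exact: ab.
Qed.

(** The two symmetrizations have real coefficients, so their values, too, multiply to 1. *)
Lemma sym_neq0 a b q : tame a -> tame b -> qball q -> a * b = 1 ->
  qsum (a * ps_conj a) q != 0.
Proof.
move=> ta tb qB ab; have ta' := tame_conj ta; have tb' := tame_conj tb.
have := congr1 (fun c => qsum c q) (right_inv_sym ab).
rewrite qsum_real_mul ?qsum1//; last 3 first.
- exact: ps_real_sym.
- exact: tameM.
- exact: tameM.
by move=> h; apply/eqP => h0; move/eqP: h; rewrite h0 mul0r eq_sym oner_eq0.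
Qed.

Lemma expands_mul a b f g : expands a f -> expands b g -> expands (a * b) (rmul f g).
Proof.
move=> af bg; have e : rmul f g = qsum (a * b).
  by rewrite /rmul (coefsE af) (coefsE bg).
by rewrite e; apply: expands_qsum; apply: tameM; [exact: expands_tame af|exact: expands_tame bg].
Qed.

Lemma rmulE a b f g : expands a f -> expands b g -> rmul f g = qsum (a * b).
Proof. by move=> af bg; rewrite /rmul (coefsE af) (coefsE bg). Qed.

Lemma rconjE a f : expands a f -> rconj f = qsum (ps_conj a).
Proof. by move=> af; rewrite /rconj (coefsE af). Qed.

Lemma expands_conj a f : expands a f -> expands (ps_conj a) (rconj f).
Proof.
by move=> af; rewrite (rconjE af); apply: expands_qsum; apply: tame_conj; exact: expands_tame af.
Qed.

Lemma rsymE a f : expands a f -> rsym f = qsum (a * ps_conj a).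
Proof. by move=> af; rewrite /rsym (rmulE af (expands_conj af)). Qed.

(** The symmetrization of [a] times [b] is [ps_conj a], and the real left factor evaluates
    pointwise; so the pointwise quotient in [rrecip] is the ring inverse. *)
Lemma expands_recip a b f : expands a f -> tame b -> a * b = 1 -> expands b (rrecip f).
Proof.
move=> af tb ab; have ta := expands_tame af; have ta' := tame_conj ta.
apply: eq_expands (expands_qsum tb) => q qB.
rewrite /rrecip (rsymE af) (rconjE af).
have s0 := sym_neq0 ta tb qB ab.
have e : (a * ps_conj a) * b = ps_conj a by rewrite ps_symC -mulrA ab mulr1.
have -> : qsum (ps_conj a) q = qsum (a * ps_conj a) q * qsum b q.
  by rewrite -(qsum_real_mul (ps_real_sym a) (tameM ta ta') tb qB) e.
by rewrite mulKr.
Qed.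

Lemma expands_psC p : expands (psC p) (fun=> p).
Proof.
apply: eq_expands (expands_qsum (@tame_psC _ p)) => q _; exact: qsum_psC.
Qed.

Lemma expands_XsubC p : expands (psX R - psC p) (fun q => q - p).
Proof.
by apply: eq_expands (expands_qsum (@tame_XsubC _ p)) => q qB; exact: qsum_XsubC.
Qed.

End Reciprocal.

(** * Moebius factors and their behaviour at the boundary *)

Section Factors.
Variable R : realType.
Local Notation H := (quat R).
Local Notation ps := (ps R).
Implicit Types (a b : ps) (p q w : H) (f g : H -> H).

(** The right inverse [b] is its own symmetrization times [ps_conj a]; multiplying by [a] on the
    right gives the product of the two symmetrizations, which is 1. *)
Lemma ps_left_inv a b : a * b = 1 -> b * a = 1.
Proof.
move=> ab; have S := right_inv_sym ab.
rewrite (ps_realC _ (ps_real_sym a)) (ps_symC b) in S.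
have bE : b = (ps_conj b * b) * ps_conj a.
  by rewrite -[LHS]mul1r -S (ps_symC a) -!mulrA ab mulr1.
by rewrite {1}bE -mulrA -(ps_symC a).
Qed.

Lemma moebius_gap q w : `|1 - q * qconj w| ^+ 2 - `|q - w| ^+ 2 =
  (1 - `|q| ^+ 2) * (1 - `|w| ^+ 2).
Proof. by rewrite !sqr_quat_norm /quat_sqn /=; ring. Qed.

Lemma moebius_le q w : `|q| <= 1 -> `|w| <= 1 -> `|q - w| <= `|1 - q * qconj w|.
Proof.
move=> q1 w1; rewrite -(@ler_pXn2r _ 2) ?nnegrE// -subr_ge0 moebius_gap.
by rewrite mulr_ge0// subr_ge0 exprn_ile1.
Qed.

(** The difference in [moebius_gap] tends to zero at the boundary while [|q - w|] stays bounded
    below. Uniformity in [w] of modulus [t] matters: [w] will vary with [q] on the sphere of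
    [q0]. *)
Lemma moebius_boundary (t e : R) : 0 <= t < 1 -> 0 < e -> exists2 s : R, s < 1 &
  forall q w, s < `|q| < 1 -> `|w| = t -> `|1 - q * qconj w| <= (1 + e) * `|q - w|.
Proof.
move=> /andP[t0 t1] e0; pose d := 1 - t; have d0 : 0 < d by rewrite subr_gt0.
(* The first threshold ensures [|q - w| >= d / 2]; the second makes the gap at most
   [2 * e * (d / 2) ^+ 2], so that it fits in the cross term of [(1 + e) ^+ 2]. *)
exists (Num.max ((1 + t) / 2) (1 - e * d ^+ 2 / 4)).
  by rewrite gt_max; apply/andP; split; rewrite ?gtrBl ?divr_gt0 ?mulr_gt0 ?exprn_gt0//; lra.
move=> q w; rewrite gt_max => /andP[/andP[q1 q2] q3] wt.
have e1 : 0 <= 1 + e by lra.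
rewrite -(@ler_pXn2r _ 2) ?nnegrE ?mulr_ge0// exprMn.
have := moebius_gap q w; rewrite wt => /eqP; rewrite subr_eq => /eqP ->.
have qw : d / 2 <= `|q - w|.
  have := lerB_dist q w; rewrite wt /d; lra.
have q0 := normr_ge0 q.
have h1 : (1 - `|q| ^+ 2) * (1 - t ^+ 2) <= 2 * (1 - `|q|).
  have -> : (1 - `|q| ^+ 2) * (1 - t ^+ 2) = (1 - `|q|) * ((1 + `|q|) * (1 - t ^+ 2)) by ring.
  rewrite mulrC ler_wpM2r ?subr_ge0 ?(ltW q3)//.
  have t2 : 0 <= t ^+ 2 by rewrite exprn_ge0.
  have h : 0 <= `|q| * t ^+ 2 by rewrite mulr_ge0.
  by rewrite mulrBr mulr1 mulrDl mul1r; lra.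
have h2 : 2 * (1 - `|q|) <= 2 * e * (d / 2) ^+ 2.
  have -> : 2 * e * (d / 2) ^+ 2 = 2 * (e * d ^+ 2 / 4) by field.
  lra.
have h3 : 2 * e * (d / 2) ^+ 2 <= 2 * e * `|q - w| ^+ 2.
  by rewrite ler_wpM2l ?mulr_ge0 ?(ltW e0)// lerXn2r// nnegrE// divr_ge0// ltW.
have h4 : 0 <= e ^+ 2 * `|q - w| ^+ 2 by rewrite mulr_ge0 ?exprn_ge0// ltW.
have -> : (1 + e) ^+ 2 * `|q - w| ^+ 2 =
  `|q - w| ^+ 2 + 2 * e * `|q - w| ^+ 2 + e ^+ 2 * `|q - w| ^+ 2 by ring.
by lra.
Qed.

Lemma expr_1D_le n (e : R) : 0 < e -> exists2 d : R, 0 < d & (1 + d) ^+ n <= 1 + e.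
Proof.
elim: n e => [|n IH] e e0; first by exists 1; rewrite // expr0 lerDl ltW.
pose e' := Num.min 1 (e / 3).
have e'0 : 0 < e' by rewrite lt_min ltr01 divr_gt0.
have e'1 : e' <= 1 by rewrite ge_min lexx.
have e'3 : e' <= e / 3 by rewrite ge_min lexx orbT.
have [d d0 hd] := IH e' e'0; exists (Num.min d e'); first by rewrite lt_min d0.
have m0 : 0 < Num.min d e' by rewrite lt_min d0.
have md : Num.min d e' <= d by rewrite ge_min lexx.
have me : Num.min d e' <= e' by rewrite ge_min lexx orbT.
rewrite exprS; apply: (@le_trans _ _ ((1 + e') * (1 + e'))).
  apply: ler_pM; [lra|by apply: exprn_ge0; lra|lra|].
  by apply: le_trans hd; rewrite lerXn2r ?nnegrE; lra.
have : e' * e' <= e' by rewrite ler_piMr// ltW.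
by rewrite mulrDl mul1r mulrDr mulr1; lra.
Qed.

(** With [c = q0], [ps_num] and [ps_den] are the coefficients of [Delta] and [D]. Written as
    symmetrizations, they are real by [ps_real_sym], hence central and evaluated pointwise. *)
Definition ps_num c : ps := (psX R - psC c) * ps_conj (psX R - psC c).
Definition ps_lin c : ps := 1 - psX R * psC (qconj c).
Definition ps_den c : ps := ps_lin c * ps_conj (ps_lin c).

Lemma tame_lin c : tame (ps_lin c).
Proof. by apply: tame_sub; [exact: tame1|apply: tameM; [exact: tameX|exact: tame_psC]]. Qed.

Lemma tame_num c : tame (ps_num c).
Proof. by apply: tameM; [|apply: tame_conj]; exact: tame_XsubC. Qed.

Lemma tame_den c : tame (ps_den c).
Proof. by apply: tameM; [|apply: tame_conj]; exact: tame_lin. Qed.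

Lemma qsum_lin c q : qball q -> qsum (ps_lin c) q = 1 - q * qconj c.
Proof.
move=> qB; have tX := @tameX R.
rewrite qsum_sub ?qsum1 ?qsum_mulC ?qsumX//; first exact: tame1.
by apply: tameM => //; exact: tame_psC.
Qed.

Lemma ps_conj_lin c : ps_conj (ps_lin c) = ps_lin (qconj c).
Proof.
by rewrite /ps_lin ps_conjB ps_conj1 ps_conjM ps_conjX ps_conjC qconjK psX_comm.
Qed.

Lemma ps_conj_XsubC c : ps_conj (psX R - psC c) = psX R - psC (qconj c).
Proof. by rewrite ps_conjB ps_conjX ps_conjC. Qed.

Lemma ps_numE c : ps_num c = psX R * psX R - psX R * psC (c + qconj c) + psC ((`|c| ^+ 2)%:A).
Proof.
rewrite /ps_num ps_conj_XsubC mulrBl !mulrBr -mulq_conj psCM psCD mulrDr.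
rewrite (psX_comm (psC c)) opprB opprD !addrA addrAC; congr (_ + _).
by rewrite addrAC.
Qed.

Lemma ps_denE c : ps_den c = 1 - psX R * psC (c + qconj c) +
  psX R * psX R * psC ((`|c| ^+ 2)%:A).
Proof.
rewrite /ps_den ps_conj_lin /ps_lin qconjK mulrBl mul1r mulrBr mulr1 -mul_conjq psCM psCD.
rewrite mulrDr !opprD opprK !addrA; congr (_ + _).
by rewrite -!mulrA; congr (_ * _); rewrite !mulrA psX_comm.
Qed.

(** By [ps_numE] only [c + qconj c] and [|c|] matter; the centre can thus be moved along its sphere
    to a point commuting with a given [q]. *)
Lemma ps_num_sphere c w : q_re c = q_re w -> `|c| = `|w| -> ps_num c = ps_num w.
Proof.
move=> h1 h2; rewrite !ps_numE h2; congr (_ - _ * psC _ + _).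
by apply: quat_eqP; rewrite /= ?h1 ?subrr.
Qed.

Lemma ps_den_sphere c w : q_re c = q_re w -> `|c| = `|w| -> ps_den c = ps_den w.
Proof.
move=> h1 h2; rewrite !ps_denE h2; congr (_ - _ * psC _ + _).
by apply: quat_eqP; rewrite /= ?h1 ?subrr.
Qed.

(* The slice containing [q] meets the sphere of [q0]. *)
Lemma sphere_comm (x0 y0 : R) (I : H) q : I ^+ 2 = -1 -> exists J,
  [/\ J ^+ 2 = -1, GRing.comm q (slice_pt J (x0, y0)), 
   GRing.comm q (qconj (slice_pt J (x0, y0))),
   q_re (slice_pt I (x0, y0)) = q_re (slice_pt J (x0, y0)) &
   `|slice_pt I (x0, y0)| = `|slice_pt J (x0, y0)|].
Proof.
move=> I2; have [J [J2 [z qz]]] := slice_exists q; exists J; split=> //.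
- by rewrite qz; exact: slice_comm.
- have -> : qconj (slice_pt J (x0, y0)) = slice_pt J (x0, - y0).
    rewrite !slice_ptE qconjD scaleNr; congr (_ + _).
      by apply: quat_eqP => /=; ring.
    have -> : qconj (y0 *: J) = y0 *: qconj J by apply: quat_eqP => /=; ring.
    by rewrite imag_unit_conj// scalerN.
  by rewrite qz; exact: slice_comm.
- by have [hI _] := imag_unitP I2; have [hJ _] := imag_unitP J2; rewrite /= hI hJ.
- by apply/eqP; rewrite -(@eqrXn2 _ 2)// !sqr_norm_slice.
Qed.

Lemma qsum_num_comm w q : qball q -> GRing.comm q w ->
  qsum (ps_num w) q = (q - w) * (q - qconj w).
Proof.
move=> qB qw; rewrite /ps_num qsum_mul_comm//.
- by rewrite ps_conj_XsubC !qsum_XsubC.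
- exact: tame_XsubC.
- by apply: tame_conj; exact: tame_XsubC.
- by rewrite qsum_XsubC//; apply: commrB.
Qed.

Lemma qsum_den_comm w q : qball q -> GRing.comm q (qconj w) ->
  qsum (ps_den w) q = (1 - q * qconj w) * (1 - q * w).
Proof.
move=> qB qw; rewrite /ps_den qsum_mul_comm//.
- by rewrite ps_conj_lin !qsum_lin// qconjK.
- exact: tame_lin.
- by apply: tame_conj; exact: tame_lin.
- by rewrite qsum_lin//; apply: commrB; [exact: commr1|exact: commrM].
Qed.

End Factors.

(** * Factoring out the powers of [Delta] *)

Section SphericalExpansion.
Variable R : realType.
Local Notation H := (quat R).
Local Notation ps := (ps R).
Implicit Types (a b c : ps) (p q : H) (f g : H -> H).

(** [dquot] is a choice of which only the defining property is known: [dq] shows that this property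
    can be met, and regularity then expands whatever function was chosen. *)
Lemma dquot_expands a g p : expands a g -> qball p -> exists2 c,
  expands c (dquot p g) & a - psC (g p) = (psX R - psC p) * c.
Proof.
move=> ag pB; have ta := expands_tame ag.
pose Q : set (H -> H) := [set h | slice_regular qball h /\
    forall q, qball q -> g q - g p = rmul (fun q => q - p) h q].
have agp : expands (a - psC (g p)) (fun q => g q - g p).
  by apply: expandsB => //; exact: expands_psC.
have [hr he] : Q (dquot p g).
  apply: xgetPex; exists (qsum (dq a p)); split.
    by apply: qsum_slice_regular; exact: tame_dq.
  move=> q qB; rewrite (rmulE (@expands_XsubC R p) (expands_qsum (tame_dq ta pB))).
  by rewrite dq_mul// -(expandsE ag pB) (expandsE agp qB).
have [c ec] := slice_regular_expands hr; exists c => //.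
apply: (expands_inj agp); apply: eq_expands (expands_mul (@expands_XsubC R p) ec) => q qB.
by rewrite -he.
Qed.

(** Divide by [q - q0], then by [q - qconj q0]; when the constant left by the second division
    vanishes, the two linear factors combine into [ps_num q0]. *)
Lemma dquot_iter_step a g q0 : expands a g -> qball q0 -> exists c,
  [/\ expands c (dquot (qconj q0) (dquot q0 g)) &
      dquot q0 g (qconj q0) = 0 -> a = psC (g q0) + ps_num q0 * c].
Proof.
move=> ag qB; have qB' : qball (qconj q0) by rewrite /qball /= quat_norm_conj.
have [e ee he] := dquot_expands ag qB.
have [c ec hc] := dquot_expands ee qB'.
exists c; split=> // h0; rewrite h0 -[psC 0]/(psC (0 : H)) in hc.
rewrite psC0 subr0 in hc.
by rewrite /ps_num ps_conj_XsubC -mulrA -hc -he addrC subrK.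
Qed.

Lemma sph_coef_even q0 f k : sph_coef q0 f (2 * k) = dquot_iter q0 k f q0.
Proof. by rewrite /sph_coef mul2n odd_double doubleK. Qed.

Lemma sph_coef_odd q0 f k :
  sph_coef q0 f (2 * k).+1 = dquot q0 (dquot_iter q0 k f) (qconj q0).
Proof. by rewrite /sph_coef mul2n /= odd_double /= uphalf_double. Qed.

Lemma spherical_expansion a f q0 n : expands a f -> qball q0 -> (1 <= n)%N ->
  (forall m : nat, (1 <= m <= 2 * n - 1)%N -> sph_coef q0 f m = 0) ->
  exists2 c, expands c (dquot_iter q0 n f) & a - psC (f q0) = ps_num q0 ^+ n * c.
Proof.
move=> af qB n1 h.
(* Indexed from [k.+1] because the constant [f q0] is split off in the first step. Passing from
   [k.+1] to [k.+2] uses the vanishing of the coefficients of index [2k + 2] and [2k + 3]. *)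
have A0 k : (k.+1 <= n)%N -> exists2 c, expands c (dquot_iter q0 k.+1 f) &
    a - psC (f q0) = ps_num q0 ^+ k.+1 * c.
  elim: k => [|k IH] kn.
    have [c [ec hc]] := dquot_iter_step af qB; exists c => //.
    rewrite expr1 [in LHS]hc; first by rewrite addrC addKr.
    by rewrite -(sph_coef_odd q0 f 0) h//; apply/andP; split=> //; lia.
  have [|c ec hc] := IH; first exact: ltnW.
  have [c' [ec' hc']] := dquot_iter_step ec qB; exists c' => //.
  rewrite hc hc'; last by rewrite -(sph_coef_odd q0 f k.+1) h//; apply/andP; split=> //; lia.
  rewrite -(sph_coef_even q0 f k.+1) h; last by apply/andP; split; lia.
  by rewrite psC0 add0r mulrA -exprSr.
by case: n n1 h A0 => // n _ _; apply.
Qed.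

End SphericalExpansion.

(** * Schwarz-Pick estimates *)

Section SchwarzPick.
Variable R : realType.
Local Notation H := (quat R).
Local Notation ps := (ps R).
Implicit Types (a b c : ps) (p q : H) (f g : H -> H).

Lemma mulCX q : psC q * psX R = psX R * psC q. Proof. exact: psX_comm. Qed.

Lemma lin_XsubC_comm q0 : ps_lin q0 * (psX R - psC q0) = (psX R - psC q0) * ps_lin q0.
Proof.
rewrite /ps_lin mulrBl mul1r [RHS]mulrBr mulr1; congr (_ - _).
rewrite mulrBr mulrBl; congr (_ - _); first by rewrite -mulrA mulCX.
by rewrite [RHS]mulrA mulCX -!mulrA -!psCM mulq_conj mul_conjq.
Qed.

(* The Moebius transform of [f] is also [(1 - f * conj w)^-* * (f - w)], which is
   a pointwise quotient up to a change of argument. *)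
Lemma moebius_transform_le a b w : tame a -> tame b -> `|w| < 1 ->
  (forall q, qball q -> qball (qsum a q)) -> (1 - psC (qconj w) * a) * b = 1 ->
  forall q, qball q -> `|qsum ((a - psC w) * b) q| <= 1.
Proof.
move=> ta tb w1 aB ab p pB.
have tw : tame (a * psC (qconj w)) by apply: tameM => //; exact: tame_psC.
pose g : ps := 1 - a * psC (qconj w).
have tg : tame g by apply: tame_sub => //; exact: tame1.
have [|g' tg' gg'] := neumann tw w1.
  move=> q qB; rewrite qsum_mulC// quat_normM quat_norm_conj.
  by rewrite ler_piMl// ltW//; exact: aB.
have e : g * ((a - psC w) * b) = a - psC w.
  (* Both sides expand to [a - w - a * qconj w * a + |w| ^+ 2 * a], the real constant being
     central. *)
  have e1 : g * (a - psC w) = (a - psC w) * (1 - psC (qconj w) * a).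
    rewrite /g mulrBl mul1r [RHS]mulrBr mulr1; congr (_ - _).
    rewrite mulrBr mulrBl !mulrA; congr (_ - _).
    rewrite -[LHS]mulrA -!psCM mul_conjq mulq_conj; apply: esym; apply: ps_realC.
    by move=> [|k]; [exists (`|w| ^+ 2)|exists 0; rewrite scale0r].
  by rewrite mulrA e1 -mulrA ab mulr1.
(* Read at the preimage [q], identity [e] involves the transform at the prescribed [p], while [g]
   and [a - psC w] are both taken at the same point [q]. *)
have [q [qp qg g0]] := sphere_preimage tg pB (sym_neq0 tg tg' pB gg').
have qB : qball q by rewrite /qball /= qp.
have tf : tame ((a - psC w) * b).
  by apply: tameM => //; apply: tame_sub => //; exact: tame_psC.
have := congr1 (fun c => qsum c q) e.
rewrite (qsum_mul tg tf qB pB qg) qsum_sub ?qsum_psC//; last exact: tame_psC.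
have gq : qsum g q = 1 - qsum a q * qconj w.
  by rewrite qsum_sub ?qsum1 ?qsum_mulC//; exact: tame1.
move=> h; have := moebius_le (ltW (aB q qB)) (ltW w1).
rewrite -h quat_normM gq -gq => h2.
by rewrite -(@ler_pM2l _ `|qsum g q|) ?normr_gt0// mulr1.
Qed.

Section Main.
Variables (x0 y0 : R) (I q0 : H) (I2 : I ^+ 2 = -1).
Hypotheses (q0E : q0 = slice_pt I (x0, y0)) (q0B : qball q0).

(** As [q0] need not commute with [q], it is replaced by a point of its sphere on the slice of [q],
    where the two linear factors multiply pointwise. *)
Lemma qsum_den q : qball q -> qsum (ps_den q0) q = (1 - x0 *: q) ^+ 2 + (y0 *: q) ^+ 2.
Proof.
move=> qB; have [J [J2 cq cq' hre hn]] := sphere_comm x0 y0 q I2.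
rewrite q0E (ps_den_sphere hre hn) qsum_den_comm//; set w := slice_pt J _ in cq cq' hre hn *.
have e1 : w + qconj w = (2 * x0)%:A.
  have [J0 _] := imag_unitP J2.
  by rewrite /w; apply: quat_eqP; rewrite /= ?J0; ring.
have e2 : qconj w * w = (x0 ^+ 2 + y0 ^+ 2)%:A by rewrite mul_conjq sqr_norm_slice.
have -> : (1 - q * qconj w) * (1 - q * w) = 1 - q * (w + qconj w) + q * q * (qconj w * w).
  have e3 : q * qconj w * (q * w) = q * q * (qconj w * w).
    by rewrite -!mulrA; congr (_ * _); rewrite !mulrA cq'.
  rewrite mulrBl mul1r [q * qconj w * _]mulrBr mulr1 [q * (w + _)]mulrDr e3.
  move: (q * w) (q * qconj w) (q * q * _) => u v t.
  by rewrite opprB opprD !addrA addrAC.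
by rewrite e1 e2 !expr2; apply: quat_eqP => /=; ring.
Qed.

(** On the slice of [q] the ratio splits into two Moebius ratios, at [w] and at [qconj w], each
    costing a factor [1 + d]. *)
Lemma ratio_boundary (e : R) : 0 < e -> exists2 s : R, s < 1 &
  forall q, s < `|q| < 1 -> `|qsum (ps_den q0) q| <= (1 + e) * `|qsum (ps_num q0) q|.
Proof.
move=> e0; have [d d0 hd] := expr_1D_le 2 e0.
have t01 : 0 <= `|q0| < 1 by rewrite normr_ge0.
have [s s1 hs] := moebius_boundary t01 d0; exists s => // q sq.
have qB : qball q by case/andP: sq.
have [J [J2 cq cq' hre hn]] := sphere_comm x0 y0 q I2.
move: hs; rewrite q0E (ps_den_sphere hre hn) (ps_num_sphere hre hn) hn.
rewrite qsum_den_comm// qsum_num_comm//; set w := slice_pt J _ => hs.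
have h1 := hs q w sq erefl.
have := hs q (qconj w) sq (quat_norm_conj w); rewrite qconjK => h2.
rewrite !quat_normM; apply: (@le_trans _ _ ((1 + d) ^+ 2 * (`|q - w| * `|q - qconj w|))).
  by rewrite expr2 mulrACA ler_pM.
by rewrite ler_wpM2r// mulr_ge0.
Qed.

Lemma lin_inverse : exists2 b, tame b & ps_lin q0 * b = 1.
Proof.
have tX : tame (psX R * psC (qconj q0)) by apply: tameM; [exact: tameX|exact: tame_psC].
apply: (@neumann _ _ `|q0| tX) => // q qB.
by rewrite qsum_mulC ?qsumX//; [rewrite quat_normM quat_norm_conj ler_piMl// ltW|exact: tameX].
Qed.

Lemma den_neq0 q : qball q -> qsum (ps_den q0) q != 0.
Proof.
have [b tb h] := lin_inverse => qB.
exact: (sym_neq0 (@tame_lin _ q0) tb qB h).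
Qed.

Variables (b : ps) (tb : tame b) (Eb : ps_lin q0 * b = 1).

(** The coefficients of [moebius q0], [b] being those of the reciprocal of [1 - q * qconj q0]. *)
Let m : ps := b * (psX R - psC q0).

Let tm : tame m.
Proof. by apply: tameM => //; exact: tame_XsubC. Qed.

Lemma moebius_coefE : m = (psX R - psC q0) * b.
Proof.
have bE := ps_left_inv Eb.
by rewrite /m -[LHS]mulr1 -Eb mulrA -[b * _ * _]mulrA -lin_XsubC_comm mulrA bE mul1r.
Qed.

Lemma den_moebius_sym : ps_den q0 * (m * ps_conj m) = ps_num q0.
Proof.
have rN : ps_real (ps_num q0) by exact: ps_real_sym.
have -> : m * ps_conj m = ps_num q0 * (b * ps_conj b).
  rewrite /m ps_conjM !mulrA -[b * _ * _]mulrA -/(ps_num q0).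
  by rewrite -(ps_realC b rN) -mulrA.
by rewrite mulrA -(ps_realC _ rN) -mulrA (right_inv_sym Eb) mulr1.
Qed.

Lemma moebius_sym_norm q : qball q ->
  `|qsum (m * ps_conj m) q| = `|qsum (ps_num q0) q| / `|qsum (ps_den q0) q|.
Proof.
move=> qB; have d0 := den_neq0 qB.
have := congr1 (fun c => `|qsum c q|) den_moebius_sym.
rewrite qsum_real_mul ?quat_normM//; last 3 first.
- exact: ps_real_sym.
- exact: tame_den.
- by apply: tameM => //; exact: tame_conj.
by move=> <-; rewrite mulrC mulKf// normr_eq0.
Qed.

(** At a preimage [q] of [p], the product of [ps_lin q0] and [m] evaluates so that
    [|1 - q * qconj q0|] times the modulus of [m] at [p] is [|q - q0|]. As [|q| = |p|],
    [moebius_boundary] applies. *)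
Lemma moebius_boundary_lower (e : R) : 0 < e -> exists2 s : R, s < 1 &
  forall q, s < `|q| < 1 -> 1 <= (1 + e) * `|qsum m q|.
Proof.
move=> e0; have t01 : 0 <= `|q0| < 1 by rewrite normr_ge0.
have [s s1 hs] := moebius_boundary t01 e0; exists s => // p sp.
have pB : qball p by case/andP: sp.
have tE := @tame_lin _ q0.
have [q [qp qE E0]] := sphere_preimage tE pB (sym_neq0 tE tb pB Eb).
have qB : qball q by rewrite /qball /= qp.
have Em : ps_lin q0 * m = psX R - psC q0 by rewrite /m mulrA Eb mul1r.
have := congr1 (fun c => `|qsum c q|) Em.
rewrite (qsum_mul tE tm qB pB qE) quat_normM qsum_XsubC// => h.
have := hs q q0; rewrite qp => /(_ sp erefl); rewrite -qsum_lin// -h mulrCA.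
by rewrite -[X in X <= _ -> _]mulr1 ler_pM2l// normr_gt0.
Qed.

Section Estimates.
Variables (F W : ps) (n : nat) (tF : tame F) (tW : tame W).
Hypothesis (F1 : forall q, qball q -> `|qsum F q| <= 1).

Let D := ps_den q0.
Let N := ps_num q0.
Let rD : ps_real D. Proof. exact: ps_real_sym. Qed.
Let rN : ps_real N. Proof. exact: ps_real_sym. Qed.
Let tD : tame D. Proof. exact: tame_den. Qed.
Let tN : tame N. Proof. exact: tame_num. Qed.

Lemma schwarz_pick_even : F = N ^+ n * W -> forall q, qball q ->
  `|qsum F q| <= `|qsum (m * ps_conj m) q| ^+ n /\
  `|qsum W q| <= `|qsum D q| ^- n.
Proof.
move=> FW; pose X := D ^+ n * W.
have tDn : tame (D ^+ n) := tame_expn n tD.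
have tNn : tame (N ^+ n) := tame_expn n tN.
have rDn : ps_real (D ^+ n) := ps_realX n rD.
have rNn : ps_real (N ^+ n) := ps_realX n rN.
have tX : tame X by exact: tameM.
have DF : D ^+ n * F = N ^+ n * X.
  by rewrite FW /X !mulrA (ps_realC _ rDn).
have DFq q : qball q -> `|qsum D q| ^+ n * `|qsum F q| = `|qsum N q| ^+ n * `|qsum X q|.
  move=> qB; have := congr1 (fun c => `|qsum c q|) DF.
  rewrite (qsum_real_mul rDn tDn tF qB) (qsum_real_mul rNn tNn tX qB).
  by rewrite (qsum_expn_real n rD tD qB) (qsum_expn_real n rN tN qB) !quat_normM !quat_normX.
have X1 q : qball q -> `|qsum X q| <= 1.
  apply: boundary_max => // e e0; have [d d0 hd] := expr_1D_le n e0.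
  have [s s1 hs] := ratio_boundary d0; exists s => // p sp.
  have pB : qball p by case/andP: sp.
  have Dp : 0 < `|qsum D p| by rewrite normr_gt0 den_neq0.
  have h := hs p sp.
  (* [N] vanishes on the sphere of [q0], inside the ball; near the boundary it cannot, because there
     the nonzero [|D|] is at most a multiple of [|N|]. *)
  have Np : 0 < `|qsum N p|.
    by rewrite -(@pmulr_rgt0 _ (1 + d)); [exact: lt_le_trans h|lra].
  rewrite -(@ler_pM2l _ (`|qsum N p| ^+ n)) ?exprn_gt0// -DFq//.
  apply: (@le_trans _ _ (`|qsum D p| ^+ n)).
    by rewrite ler_piMr ?exprn_ge0// F1.
  apply: (@le_trans _ _ (`|qsum N p| ^+ n * (1 + d) ^+ n)).
    by rewrite -exprMn mulrC lerXn2r ?nnegrE// mulr_ge0//; lra.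
  by rewrite ler_wpM2l// exprn_ge0.
move=> q qB; have Dq : 0 < `|qsum D q| by rewrite normr_gt0 den_neq0.
split.
  rewrite moebius_sym_norm// expr_div_n ler_pdivlMr ?exprn_gt0// mulrC DFq//.
  by rewrite ler_piMr ?exprn_ge0// X1.
rewrite -[leRHS]mul1r ler_pdivlMr ?exprn_gt0// mulrC.
by have := X1 q qB; rewrite (qsum_real_mul rDn tDn tW qB) (qsum_expn_real n rD tD qB) quat_normM quat_normX.
Qed.

(** The extra factor [q - q0] is [m * ps_lin q0], and [m] need not have real coefficients, so
    [m * X] is evaluated with a change of argument. The factor [ps_lin q0] placed in [X] returns as
    its inverse [b] in the second bound. *)
Lemma schwarz_pick_odd : F = N ^+ n * ((psX R - psC q0) * W) -> forall q, qball q ->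
  `|qsum F q| <= `|qsum (m * ps_conj m) q| ^+ n * `|qsum m q| /\
  `|qsum W q| <= `|qsum D q| ^- n * `|qsum b q|.
Proof.
move=> FW; pose X := ps_lin q0 * (D ^+ n * W).
have tDn : tame (D ^+ n) := tame_expn n tD.
have tNn : tame (N ^+ n) := tame_expn n tN.
have rDn : ps_real (D ^+ n) := ps_realX n rD.
have rNn : ps_real (N ^+ n) := ps_realX n rN.
have tX : tame X by apply: tameM; [exact: tame_lin|exact: tameM].
have tmX : tame (m * X) by exact: tameM.
have bE := ps_left_inv Eb.
have DF : D ^+ n * F = N ^+ n * (m * X).
  rewrite FW /X moebius_coefE -!mulrA [b * _]mulrA bE mul1r.
  rewrite [RHS]mulrA -[_ * (D ^+ n * W)]mulrA.
  by rewrite !mulrA (ps_realC _ rDn) -!mulrA [D ^+ n * _]mulrA (ps_realC _ rDn) -!mulrA.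
have DFq q : qball q -> `|qsum D q| ^+ n * `|qsum F q| = `|qsum N q| ^+ n * `|qsum (m * X) q|.
  move=> qB; have := congr1 (fun c => `|qsum c q|) DF.
  rewrite (qsum_real_mul rDn tDn tF qB) (qsum_real_mul rNn tNn tmX qB).
  by rewrite (qsum_expn_real n rD tD qB) (qsum_expn_real n rN tN qB) !quat_normM !quat_normX.
have X1 q : qball q -> `|qsum X q| <= 1.
  (* Of the [n.+1] factors [1 + d], [n] pay for the ratio of [D] to [N] and one for the lower bound
     on [m]. *)
  apply: boundary_max => // e e0; have [d d0 hd] := expr_1D_le n.+1 e0.
  have [s s1 hs] := ratio_boundary d0.
  have [s' s1' hs'] := moebius_boundary_lower d0.
  exists (Num.max s s'); first by rewrite gt_max s1.
  move=> p; rewrite gt_max => /andP[/andP[sp sp'] p1].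
  have pB : qball p by [].
  have Dp q' : qball q' -> 0 < `|qsum D q'| by move=> ?; rewrite normr_gt0 den_neq0.
  have Nsp q' : `|q'| = `|p| -> 0 < `|qsum N q'|.
    move=> qp; have h : s < `|q'| < 1 by rewrite qp sp.
    rewrite -(@pmulr_rgt0 _ (1 + d)); last by lra.
    by apply: lt_le_trans (hs q' h); apply: Dp; rewrite /qball /= qp.
  have ms : qsum (m * ps_conj m) p != 0.
    by rewrite -normr_gt0 moebius_sym_norm//; apply: divr_gt0; [exact: Nsp|exact: Dp].
  (* To bound [X] at [p], identity [DF] is read at [q'], where [m * X] is the value of [m] at [q']
     times that of [X] at [p]. *)
  have [q' [qp qm m0]] := sphere_preimage tm pB ms.
  have qB' : qball q' by rewrite /qball /= qp.
  have h := hs q'; rewrite qp sp p1 in h; have {}h := h isT.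
  have h' := hs' q'; rewrite qp sp' p1 in h'; have {}h' := h' isT.
  have := DFq q' qB'; rewrite (qsum_mul tm tX qB' pB qm) quat_normM => e1.
  have Np := Nsp q' qp; have mp : 0 < `|qsum m q'| by rewrite normr_gt0.
  have d1 : 0 <= 1 + d by lra.
  have a1 : `|qsum N q'| ^+ n * (`|qsum m q'| * `|qsum X p|) <=
      `|qsum N q'| ^+ n * (1 + d) ^+ n.
    rewrite -e1; apply: (@le_trans _ _ (`|qsum D q'| ^+ n)).
      by rewrite ler_piMr ?exprn_ge0// F1.
    by rewrite -exprMn mulrC lerXn2r ?nnegrE// mulr_ge0.
  rewrite ler_pM2l ?exprn_gt0// in a1.
  apply: le_trans hd; rewrite exprS.
  apply: (@le_trans _ _ ((1 + d) * (`|qsum m q'| * `|qsum X p|))).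
    by rewrite mulrA ler_peMl.
  by rewrite ler_wpM2l.
move=> q qB; have Dq : 0 < `|qsum D q| by rewrite normr_gt0 den_neq0.
split.
  rewrite moebius_sym_norm// expr_div_n mulrAC ler_pdivlMr ?exprn_gt0// mulrC DFq//.
  have [p [pq -> _]] := qsum_mul_conj tm tX qB.
  by rewrite quat_normM ler_wpM2l ?exprn_ge0// ler_piMr// X1// /qball /= pq.
rewrite mulrC ler_pdivlMr ?exprn_gt0// mulrC.
have bX : b * X = D ^+ n * W by rewrite /X mulrA bE mul1r.
have := congr1 (fun c => `|qsum c q|) bX; have [p [pq -> _]] := qsum_mul_conj tb tX qB.
rewrite (qsum_real_mul rDn tDn tW qB) (qsum_expn_real n rD tD qB) !quat_normM quat_normX => <-.
by rewrite ler_piMr// X1// /qball /= pq.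
Qed.

End Estimates.

End Main.
End SchwarzPick.

Theorem theorem5p4 (R : realType) (f : quat R -> quat R)
    (f_regular : slice_regular qball f)
    (f_ball : forall q, qball q -> qball (f q))
    (x0 y0 : R) (I q0 : quat R) (I2 : I ^+ 2 = -1)
    (q0E : q0 = x0%:A + y0 *: I) (q0_ball : qball q0)
    (n : nat) (n_ge1 : (1 <= n)%N)
    (A0 : forall m : nat, (1 <= m <= 2 * n - 1)%N -> sph_coef q0 f m = 0) :
  let recip := rrecip (fun q => 1 - rmul (fun=> qconj (f q0)) f q) in
  (forall q, qball q ->
     `|rmul (fun q => f q - f q0) recip q| <= `|rsym (moebius q0) q| ^+ n /\
     `|rmul (dquot_iter q0 n f) recip q|
       <= `|(1 - x0 *: q) ^+ 2 + (y0 *: q) ^+ 2| ^- n) /\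
  (sph_coef q0 f (2 * n) = 0 ->
   forall q, qball q ->
     `|rmul (fun q => f q - f q0) recip q|
       <= `|rsym (moebius q0) q| ^+ n * `|moebius q0 q| /\
     `|rmul (dquot q0 (dquot_iter q0 n f)) recip q|
       <= `|(1 - x0 *: q) ^+ 2 + (y0 *: q) ^+ 2| ^- n
          * `|rrecip (fun q => 1 - q * qconj q0) q|).
Proof.
move=> recip; have [a af] := slice_regular_expands f_regular.
have ta := expands_tame af.
have aB q : qball q -> qball (qsum a q) by move=> qB; rewrite -(expandsE af qB); exact: f_ball.
have w1 : `|f q0| < 1 := f_ball q0 q0_ball.
have [c ec ac] := spherical_expansion af q0_ball n_ge1 A0.
have tc := expands_tame ec.
have twa : tame (psC (qconj (f q0)) * a) by apply: tameM => //; exact: tame_psC.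
(* The subtracted term is bounded on the ball by [|f q0| < 1], so the reciprocal exists there. *)
have [|b tb hb] := neumann twa w1.
  move=> q qB; rewrite -[leRHS]mulr1; apply: qsum_mul_le qB => //; first exact: tame_psC.
    by move=> p _; rewrite qsum_psC quat_norm_conj.
  by move=> p pB; apply: ltW; exact: aB.
have eb : expands b recip.
  apply: expands_recip tb hb.
  apply: (@expandsB _ (1 : ps R) _ (fun=> 1)); first by rewrite -psC1; exact: expands_psC.
  by apply: expands_mul af; exact: expands_psC.
have [e te Ee] := lin_inverse q0_ball.
have elin : expands (ps_lin q0) (fun q => 1 - q * qconj q0).
  by apply: eq_expands (expands_qsum (@tame_lin _ q0)) => q; exact: qsum_lin.
have ee := expands_recip elin te Ee.
have em : expands ((e : ps R) * (psX R - psC q0)) (moebius q0) :=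
  expands_mul ee (@expands_XsubC R q0).
pose F : ps R := ((a : ps R) - psC (f q0)) * b.
have F1 : forall q, qball q -> `|qsum F q| <= 1 by apply: moebius_transform_le.
have tF : tame F by apply: tameM => //; apply: tame_sub => //; exact: tame_psC.
have eF : rmul (fun q => f q - f q0) recip = qsum F.
  by apply: rmulE eb; apply: expandsB => //; exact: expands_psC.
have q0E' : q0 = slice_pt I (x0, y0) := q0E.
rewrite eF (rsymE em); split.
  move=> q qB; rewrite (rmulE ec eb) -(qsum_den I2 q0E' qB).
  by apply: (schwarz_pick_even I2 q0E' q0_ball) => //; [exact: tameM|rewrite /F ac mulrA].
move=> A2n q qB; have [d ed hd] := dquot_expands ec q0_ball.
rewrite sph_coef_even in A2n; have td := expands_tame ed.
(* The coefficient of index [2 * n] is the value of the [n]-th iterate at [q0]; its vanishing leaves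
   no remainder in the division by [q - q0]. *)
have hd' : c = (psX R - psC q0) * d.
  by rewrite -hd A2n psC0 subr0.
rewrite (rmulE ed eb) -(qsum_den I2 q0E' qB) (expandsE em qB) (expandsE ee qB).
apply: (schwarz_pick_odd I2 q0E' q0_ball) => //; first exact: tameM.
by rewrite /F ac hd' !mulrA.
Qed.
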